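(* Let $\Omega\subset\mathbb R^3$ be a bounded contractible polyhedral domain, $\{\mathcal T_h\}_{h>0}$ a regular family of tetrahedral meshes of $\Omega$, and $\boldsymbol g_h\in L^2(\Omega;\mathbb S)$. The nonconforming linear element method: find $(\boldsymbol{\sigma}_h, \boldsymbol{p}_h, \boldsymbol{r}_h) \in \mathring{V}_h^{\mathbb{S}} \times \mathbb{P}_0(\mathcal{T}_h; \mathbb{T}) \times V_h $ such that $$a_h(\boldsymbol{\sigma}_h, \boldsymbol{r}_h; \boldsymbol{\tau}, \boldsymbol{s}) + b_h(\boldsymbol{\tau}, \boldsymbol{s}; \boldsymbol{p}_h ) = ( \boldsymbol{g}_h, \boldsymbol{\tau} )\quad \forall\, \boldsymbol{\tau} \in \mathring{V}_h^{\mathbb{S}},\ \boldsymbol{s} \in V_h,$$ $$b_h(\boldsymbol{\sigma}_h, \boldsymbol{r}_h; \boldsymbol{q} ) = 0\quad \forall\, \boldsymbol{q} \in \mathbb{P}_0(\mathcal{T}_h; \mathbb{T}),$$ is well-posed (it has a unique solution), and its solution satisfies $\operatorname{curl}_h\boldsymbol\sigma_h+\operatorname{dev}\operatorname{grad}_h\boldsymbol r_h=0$.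
   Context: $\mathbb S$ and $\mathbb T$ denote the spaces of symmetric and of traceless real $3\times3$ matrices. $\operatorname{dev}\boldsymbol\tau=\boldsymbol\tau-\frac13\operatorname{tr}(\boldsymbol\tau)\boldsymbol I$; $\operatorname{grad}=\nabla$ and $\operatorname{curl}$ act row-wise, and the subscript $h$ denotes the element-wise operator. $(\cdot,\cdot)$ and $(\cdot,\cdot)_F$ are the $L^2(\Omega)$ and $L^2(F)$ inner products. ''Regular'' means shape-regular. $\Delta_2(\mathcal T_h)$ and $\Delta_2(\mathring{\mathcal T}_h)$ are the sets of all faces and of all interior faces, $h_F$ is the diameter of the face $F$. $\mathbb P_k(\mathcal T_h)$ is the space of piecewise polynomials of degree $\le k$, and $\mathbb P_k(\mathcal T_h;\mathbb X)=\mathbb P_k(\mathcal T_h)\otimes\mathbb X$. For each face a unit normal $\boldsymbol n_F$ is fixed; the jump on an interior face $F$ shared by $T_1,T_2$ is $[w]=(w|_{T_1})|_F\,\boldsymbol n_F\cdot\boldsymbol n_{\partial T_1}+(w|_{T_2})|_F\,\boldsymbol n_F\cdot\boldsymbol n_{\partial T_2}$, and $[w]=w|_F$ on a boundary face. The nonconforming linear (Crouzeix–Raviart) space is $V_h^{\mathrm{CR}}=\{v\in\mathbb P_1(\mathcal T_h): Q_{0,F}v\text{ is single-valued for all }F\in\Delta_2(\mathring{\mathcal T}_h)\}$, where $Q_{0,F}$ is the $L^2(F)$-projection onto constants, and $\mathring V_h^{\mathrm{CR}}$ is the subspace with $Q_{0,F}v=0$ for all boundary faces $F$. $V_h=V_h^{\mathrm{CR}}\otimes\mathbb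 R^3$, $\mathring V_h^{\mathbb S}=\mathring V_h^{\mathrm{CR}}\otimes\mathbb S$. Bilinear forms: $$a_h(\boldsymbol{\sigma}, \boldsymbol{r}; \boldsymbol{\tau}, \boldsymbol{s}) = ( \nabla_h \boldsymbol{\sigma}, \nabla_h \boldsymbol{\tau} ) + \sum_{F \in \Delta_{2}(\mathcal{T}_h) } h_F^{-1} ( [\boldsymbol{r}], [\boldsymbol{s}] )_{F},\qquad b_h(\boldsymbol{\tau}, \boldsymbol{s}; \boldsymbol{p} ) = ( \operatorname{curl}_h \boldsymbol{\tau} + \operatorname{dev}\operatorname{grad}_h \boldsymbol{s}, \boldsymbol{p}).$$ *)

(* Defs.v *)
From HB Require Import structures.
From mathcomp Require Import all_boot all_order all_algebra.
From mathcomp Require Import all_classical all_reals all_analysis.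

Set Implicit Arguments.
Unset Strict Implicit.
Unset Printing Implicit Defensive.
Import Order.TTheory GRing.Theory Num.Theory.
Import numFieldNormedType.Exports.

Local Open Scope classical_set_scope.
Local Open Scope ring_scope.

Notation pt3 R := 'rV[R]_3.

Section Euclidean.
Context {R : realType}.

Definition frob m n (A B : 'M[R]_(m, n)) : R := \sum_i \sum_j A i j * B i j.

(* The library norm on matrices is the sup norm, hence this one. *)
Definition enorm n (v : 'rV[R]_n) : R := Num.sqrt (frob v v).

Definition diam n (A : set 'rV[R]_n) : R :=
  sup [set d | exists x y, [/\ A x, A y & d = enorm (x - y)]].

Definition inscribed_diam n (A : set 'rV[R]_n) : R :=
  2 * sup [set rho | 0 <= rho /\
                     exists c, forall y, enorm (y - c) <= rho -> A y].

(* Here and in [curl], j + 1 and j + 2 are taken in 'I_3, i.e. modulo 3. *)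
Definition cross (u v : pt3 R) : pt3 R :=
  \row_(j < 3) (u 0 (j + 1) * v 0 (j + 2) - u 0 (j + 2) * v 0 (j + 1)).

Definition dev (A : 'M[R]_3) : 'M[R]_3 := A - (\tr A / 3)%:M.

Definition symmetric_matrices : set 'M[R]_3 := [set A | A^T = A].
Definition traceless_matrices : set 'M[R]_3 := [set A | \tr A = 0].

End Euclidean.

Section DifferentialOperators.
Context {R : realType}.

Definition partial (j : 'I_3) (u : pt3 R -> R) (x : pt3 R) : R :=
  'D_(delta_mx 0 j) u x.

Definition grad m (u : pt3 R -> 'rV[R]_m) (x : pt3 R) : 'M[R]_(m, 3) :=
  \matrix_(i, j) partial j (fun y => u y 0 i) x.

Definition curl (t : pt3 R -> 'M[R]_3) (x : pt3 R) : 'M[R]_3 :=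
  \matrix_(i, j) (partial (j + 1) (fun y => t y i (j + 2)) x
                  - partial (j + 2) (fun y => t y i (j + 1)) x).

Definition polynomial_le (k : nat) (u : pt3 R -> R) : Prop :=
  exists c : nat -> nat -> nat -> R, forall x,
    u x = \sum_(i < k.+1) \sum_(j < k.+1) \sum_(l < k.+1 | (i + j + l <= k)%N)
            c i j l * x 0 0 ^+ i * x 0 1 ^+ j * x 0 2 ^+ l.

End DifferentialOperators.

Section L2Domain.
Context {R : realType}.

Definition to_pt3 (y : R * R * R) : pt3 R :=
  \row_(j < 3) [:: y.1.1; y.1.2; y.2]`_j.

Definition leb2 := (@lebesgue_measure R \x @lebesgue_measure R)%E.
HB.instance Definition _ := Measure.on leb2.

(* The canonical structures of the library make a product measure sigma-finite
   only when both factors are subprobabilities. *)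
Lemma leb2_sigma_finite : sigma_finite setT leb2.
Proof.
have /sigma_finiteP[F [TF ndF Foo]] := sigma_finiteT (@lebesgue_measure R).
exists (fun n => F n `*` F n); last first.
  move=> k; have [mF oo] := Foo k.
  split; first exact: measurableX.
  by rewrite /leb2 product_measure1E// lte_mul_pinfty// ge0_fin_numE.
rewrite -setXTT TF predeqE => -[x y]; split.
  move=> [/= [n _ Fnx] [k _ Fky]]; exists (maxn n k) => //; split.
  - by move: x Fnx; exact/subsetPset/ndF/leq_maxl.
  - by move: y Fky; exact/subsetPset/ndF/leq_maxr.
by move=> [n _ []/= ? ?]; split; exists n.
Qed.

HB.instance Definition _ := Measure_isSigmaFinite.Build _ _ _ leb2
  leb2_sigma_finite.

Definition leb3 := (leb2 \x @lebesgue_measure R)%E.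
HB.instance Definition _ := Measure.on leb3.

Definition l2dot m n (D : set (pt3 R)) (f g : pt3 R -> 'M[R]_(m, n)) : R :=
  \int[leb3]_(y in to_pt3 @^-1` D) frob (f (to_pt3 y)) (g (to_pt3 y)).

Definition L2 m n (D : set (pt3 R)) (X : set 'M[R]_(m, n))
    (g : pt3 R -> 'M[R]_(m, n)) : Prop :=
  (forall i j,
     (fun y => g (to_pt3 y) i j) \_ (to_pt3 @^-1` D) \in Lfun leb3 2%:E) /\
  {ae leb3, forall y, D (to_pt3 y) -> X (g (to_pt3 y))}.

End L2Domain.

Section Geometry.
Context {R : realType}.

Definition hull (I : finType) (x : I -> pt3 R) (A : {set I}) : set (pt3 R) :=
  [set y | exists w : I -> R,
     [/\ forall i, 0 <= w i, forall i, i \notin A -> w i = 0,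
         \sum_i w i = 1 & y = \sum_i w i *: x i]].

Definition affinely_independent (I : finType) (x : I -> pt3 R) (A : {set I}) :=
  forall w : I -> R, (forall i, i \notin A -> w i = 0) ->
    \sum_i w i = 0 -> \sum_i w i *: x i = 0 -> forall i, w i = 0.

Definition polyhedron (A : set (pt3 R)) : Prop :=
  exists (n : nat) (t : 'I_n -> 'I_4 -> pt3 R),
    (forall k, affinely_independent (t k) [set: 'I_4]%SET) /\
    A = \bigcup_k hull (t k) [set: 'I_4]%SET.

(* The condition on the interior of the closure excludes slits. *)
Definition bounded_polyhedral_domain (Omega : set (pt3 R)) : Prop :=
  [/\ Omega !=set0, open Omega, connected Omega, bounded_set Omega &
      polyhedron (closure Omega) /\ Omega = (closure Omega)°].

Definition contractible (A : set (pt3 R)) : Prop :=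
  exists (c : pt3 R) (H : R * pt3 R -> pt3 R),
    [/\ A c,
        {within `[0, 1] `*` A, continuous H},
        forall t x, t \in `[0, 1] -> A x -> A (H (t, x)),
        forall x, A x -> H (0, x) = x &
        forall x, A x -> H (1, x) = c].

End Geometry.

Record mesh (R : realType) := Mesh {
  nvert : nat;
  node : 'I_nvert -> pt3 R;
  cells : {set {set 'I_nvert}}
}.

Section Meshes.
Context {R : realType}.
Implicit Types M : mesh R.

Definition is_mesh (Omega : set (pt3 R)) M : Prop :=
  [/\ injective (@node R M),
      forall T, T \in cells M ->
        #|T| = 4%N /\ affinely_independent (@node R M) T,
      forall T T', T \in cells M -> T' \in cells M ->
        hull (@node R M) T `&` hull (@node R M) T'
          = hull (@node R M) (T :&: T')%SET &
      closure Omega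
        = \bigcup_(T in [set T | T \in cells M]) hull (@node R M) T].

Definition cell M := {T : {set 'I_(nvert M)} | T \in cells M}.

Definition elem M (T : cell M) : set (pt3 R) := hull (@node R M) (val T).

Definition shape_regular (I : set R) (Th : R -> mesh R) : Prop :=
  exists kappa : R, 0 < kappa /\
    forall h, I h -> forall T : cell (Th h),
      diam (elem T) <= kappa * inscribed_diam (elem T).

Definition faces M : {set {set 'I_(nvert M)}} :=
  [set F : {set 'I_(nvert M)} |
    (#|F| == 3%N) && [exists T in cells M, F \subset T]]%SET.

Definition interior_face M (F : {set 'I_(nvert M)}) : bool :=
  (F \in faces M) &&
  (1 < #|[set T in cells M | F \subset T]%SET|)%N.

Definition boundary_face M (F : {set 'I_(nvert M)}) : bool :=
  (F \in faces M) && ~~ interior_face F.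

Definition barycenter M (A : {set 'I_(nvert M)}) : pt3 R :=
  (#|A|%:R)^-1 *: \sum_(i in A) node i.

Definition face_diam M (F : {set 'I_(nvert M)}) : R :=
  diam (hull (@node R M) F).

Definition unit_normals M (nF : {set 'I_(nvert M)} -> pt3 R) : Prop :=
  forall F, F \in faces M ->
    enorm (nF F) = 1 /\
    forall i j, i \in F -> j \in F -> frob (nF F) (node i - node j) = 0.

Definition outward_normal M (nF : {set 'I_(nvert M)} -> pt3 R)
    (T : cell M) (F : {set 'I_(nvert M)}) : pt3 R :=
  if frob (nF F) (barycenter (val T) - barycenter F) < 0
  then nF F else - nF F.

(* Surface integral over the triangle F, through the affine parametrization
   of F by the unit triangle; it does not depend on the vertex ordering. *)
Definition face_integral M (F : {set 'I_(nvert M)}) (f : pt3 R -> R) : R :=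
  let a k := [seq node i | i <- enum F]`_k in
  enorm (cross (a 1%N - a 0%N) (a 2%N - a 0%N)) *
  \int[leb2]_(y in [set y | [/\ 0 <= y.1, 0 <= y.2 & y.1 + y.2 <= 1]])
    f (a 0%N + y.1 *: (a 1%N - a 0%N) + y.2 *: (a 2%N - a 0%N)).

Definition l2dot_face M (F : {set 'I_(nvert M)}) m n
    (f g : pt3 R -> 'M[R]_(m, n)) : R :=
  face_integral F (fun x => frob (f x) (g x)).

Definition Q0 M (F : {set 'I_(nvert M)}) (v : pt3 R -> R) : R :=
  xget 0 [set c | forall d : R, face_integral F (fun x => (v x - c) * d) = 0].

End Meshes.

Section DiscreteSpaces.
Context {R : realType}.
Implicit Types M : mesh R.

(* Piecewise smooth functions are given by one function per cell, so that both
   traces on an interior face are available.  For piecewise polynomials each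
   piece is the polynomial itself, a function on the whole space. *)
Definition broken M (V : Type) := cell M -> pt3 R -> V.

(* The function on Omega, defined up to the (null) union of the faces, where
   it is given the value 0. *)
Definition glued M m n (w : broken M 'M[R]_(m, n)) (x : pt3 R) : 'M[R]_(m, n) :=
  \sum_(T : cell M) (w T \_ (elem T)°) x.

Definition Pk M (k : nat) : set (broken M R) :=
  [set v : broken M R | forall T, polynomial_le k (v T)].

Definition CR M : set (broken M R) :=
  [set v | Pk 1 v /\
    forall F, interior_face F -> forall T1 T2 : cell M,
      F \subset val T1 -> F \subset val T2 -> Q0 F (v T1) = Q0 F (v T2)].

Definition CR0 M : set (broken M R) :=
  [set v | CR v /\
    forall F, boundary_face F -> forall T : cell M,
      F \subset val T -> Q0 F (v T) = 0].

(* The tensor product of V with a linear subspace X of matrices. *)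
Definition tensor M m n (V : set (broken M R)) (X : set 'M[R]_(m, n)) :
    set (broken M 'M[R]_(m, n)) :=
  [set w : broken M 'M[R]_(m, n) | (forall i j, V (fun T x => w T x i j)) /\
           forall T x, X (w T x)].

Definition jump M (nF : {set 'I_(nvert M)} -> pt3 R) m n
    (w : broken M 'M[R]_(m, n)) (F : {set 'I_(nvert M)}) (x : pt3 R) :
    'M[R]_(m, n) :=
  if interior_face F then
    \sum_(T : cell M | F \subset val T)
      frob (nF F) (outward_normal nF T F) *: w T x
  else \sum_(T : cell M | F \subset val T) w T x.

Definition grad_h M m (w : broken M 'rV[R]_m) : broken M 'M[R]_(m, 3) :=
  fun T => grad (w T).

Definition curl_h M (w : broken M 'M[R]_3) : broken M 'M[R]_3 :=
  fun T => curl (w T).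

Definition curl_dev_grad_h M (t : broken M 'M[R]_3) (s : broken M 'rV[R]_3) :
    broken M 'M[R]_3 :=
  fun T x => curl_h t T x + dev (grad_h s T x).

(* The gradient of a matrix field is a third-order tensor, stored by its
   rows: the i-th slice is the gradient of the i-th row. *)
Definition a_h (Omega : set (pt3 R)) M (nF : {set 'I_(nvert M)} -> pt3 R)
    (sigma : broken M 'M[R]_3) (r : broken M 'rV[R]_3)
    (tau : broken M 'M[R]_3) (s : broken M 'rV[R]_3) : R :=
  \sum_(i < 3) l2dot Omega
    (glued (grad_h (fun T x => row i (sigma T x))))
    (glued (grad_h (fun T x => row i (tau T x)))) +
  \sum_(F in faces M)
    (face_diam F)^-1 * l2dot_face F (jump nF r F) (jump nF s F).

Definition b_h (Omega : set (pt3 R)) M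
    (tau : broken M 'M[R]_3) (s : broken M 'rV[R]_3)
    (p : broken M 'M[R]_3) : R :=
  l2dot Omega (glued (curl_dev_grad_h tau s)) (glued p).

Definition V0S M := tensor (@CR0 M) (@symmetric_matrices R).
Definition P0T M := tensor (@Pk M 0) (@traceless_matrices R).
Definition Vh M := tensor (@CR M) [set: 'rV[R]_3].

Definition CR_method (Omega : set (pt3 R)) M
    (nF : {set 'I_(nvert M)} -> pt3 R) (g : pt3 R -> 'M[R]_3)
    (u : broken M 'M[R]_3 * broken M 'M[R]_3 * broken M 'rV[R]_3) : Prop :=
  let: (sigma, p, r) := u in
  [/\ V0S sigma, P0T p, Vh r,
      forall tau s, V0S tau -> Vh s ->
        a_h Omega nF sigma r tau s + b_h Omega tau s p
          = l2dot Omega g (glued tau) &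
      forall q, P0T q -> b_h Omega sigma r q = 0].

End DiscreteSpaces.

(* Main.v *)
Require Import Defs.
From mathcomp Require Import all_boot all_order all_algebra all_fingroup.
From mathcomp Require Import all_classical all_reals all_analysis.
From mathcomp Require Import measurable_realfun.
From mathcomp Require Import ring lra.
Import Order.TTheory GRing.Theory Num.Theory.
Import numFieldNormedType.Exports.
Set Implicit Arguments.
Unset Strict Implicit.
Unset Printing Implicit Defensive.
Local Open Scope classical_set_scope.
Local Open Scope ring_scope.

(** The method is a square linear system on a finite-dimensional space, so it is
    enough that the homogeneous system has only the zero solution ([galerkin]);
    the constraint holds because its left-hand side is itself a traceless
    cellwise constant field, hence an admissible test function.

    Let (sigma, p, r) solve the homogeneous system.  The constraint kills the
    coupling term when the system is tested with (sigma, r), and what remains is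
    a sum of nonnegative terms: sigma is cellwise constant and the jumps of r
    vanish on all faces, boundary faces included.  Constants in the
    Crouzeix-Raviart space with zero boundary means vanish
    ([CR0_constant_zero]).  Then dev grad r = 0 on each cell, so r = c_T x + b_T
    there, and continuity with zero trace forces r = 0 ([rigid_zero]).

    For p the test functions are the Crouzeix-Raviart basis functions of single
    faces.  Their gradient times the volume of the cell is a multiple of the
    outward normal that depends on the face only ([volume_slope_apex]), so vector
    tests give that p n is continuous across interior faces and zero on boundary
    faces, and symmetric matrix tests on interior faces give that the symmetric
    part of p x n is continuous.  A traceless jump with both properties is zero
    ([traceless_jump_zero]), so p is single-valued with zero normal component on
    the boundary, hence zero ([multiplier_zero]).

    In each of the three cases the final step from single-valued with zero
    boundary data to zero is a discrete divergence theorem ([flux_free_zero]),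
    which sums fluxes over cells and faces.  It needs that a face belongs to at
    most two cells, lying on opposite sides of it ([away_opposite]).

    The rest of the work evaluates integrals.  The volume of a simplex must be
    proportional to its determinant, which follows from the scaling of Lebesgue
    measure under invertible 3 x 3 matrices ([volume_scaled_unit]); the face
    integrals reduce to moments of the unit triangle
    ([Rintegral_affine2_mul]). *)

(** * Scaling of Lebesgue measure *)

Section Scaling.
Local Open Scope ereal_scope.
Context {R : realType}.

(** Factors are positive reals and measures are extended reals, so the factor
    is always finite and composition multiplies factors. *)
Definition scales d (T : measurableType d) (mu : set T -> \bar R) (c : R)
    (phi : T -> T) : Prop :=
  [/\ (0 < c)%R, measurable_fun setT phi &
      forall A, measurable A -> mu (phi @^-1` A) = c%:E * mu A].

Lemma scales_comp d (T : measurableType d) (mu : set T -> \bar R) c1 c2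
    (phi psi : T -> T) :
  scales mu c1 phi -> scales mu c2 psi -> scales mu (c1 * c2)%R (psi \o phi).
Proof.
move=> [c10 mphi h1] [c20 mpsi h2]; split.
- exact: mulr_gt0.
- exact: measurableT_comp.
- move=> A mA; rewrite comp_preimage h1 ?h2 ?muleA//.
  by rewrite -[X in measurable X]setTI; exact: mpsi.
Qed.

Lemma scales_id d (T : measurableType d) (mu : set T -> \bar R) :
  scales mu 1%R idfun.
Proof. by split => [//||A mA]; [exact: measurable_id | rewrite preimage_id mul1e]. Qed.

Notation leb := (@lebesgue_measure R).

Let measurable_affine (a b : R) :
  measurable_fun setT (fun t : measurableTypeR R => (a * t + b)%R : measurableTypeR R).
Proof.
apply: (@measurable_funD _ _ _ _ (fun t : measurableTypeR R => a * t)%R (cst b)) => //.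
apply: (@measurable_funM _ _ _ _ (cst a) (fun t : measurableTypeR R => t)) => //.
Qed.

(** The measure A |-> |a| leb {t | a t + b \in A} agrees with leb on half-open
    intervals, which determine leb. *)
Lemma lebesgue_affine (a b : R) : a != 0%R ->
  scales leb `|a|^-1%R (fun t : measurableTypeR R => (a * t + b)%R : measurableTypeR R).
Proof.
move=> a0; split; [by rewrite invr_gt0 normr_gt0| exact: measurable_affine |].
move=> A mA.
have na : (0 < `|a|)%R by rewrite normr_gt0.
pose f : measurableTypeR R -> measurableTypeR R := fun t => (a * t + b)%R.
have mf : measurable_fun setT f by exact: measurable_affine.
have e : forall X, ocitv X -> leb X = mscale (NngNum (ltW na)) (pushforward leb f) X.
  move=> m _ [[u v]] _ <- /=.
  rewrite /mscale /pushforward /=.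
  have [ap|an|a00] := ltgtP a 0%R; last by rewrite a00 eqxx in a0.
  - rewrite [X in _ * leb X](_ : _ = `[((v - b) / a)%R, ((u - b) / a)%R[%classic); last first.
      apply/seteqP; split => t; rewrite /f /= !in_itv /=.
        by rewrite ler_ndivrMr // ltr_ndivlMr // [(t * a)%R]mulrC => /andP[? ?]; apply/andP; split; lra.
      by rewrite ler_ndivrMr // ltr_ndivlMr // [(t * a)%R]mulrC => /andP[? ?]; apply/andP; split; lra.
    rewrite !lebesgue_measure_itv /= !lte_fin.
    rewrite ltr_nM2r ?invr_lt0 // ltrD2r.
    case: ltP => uv; last by rewrite mule0.
    rewrite -!EFinB -EFinM ltr0_norm //; congr EFin; field; exact: a0.
  - rewrite [X in _ * leb X](_ : _ = `]((u - b) / a)%R, ((v - b) / a)%R]%classic); last first.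
      apply/seteqP; split => t; rewrite /f /= !in_itv /=.
        by rewrite ler_pdivlMr // ltr_pdivrMr // [(t * a)%R]mulrC => /andP[? ?]; apply/andP; split; lra.
      by rewrite ler_pdivlMr // ltr_pdivrMr // [(t * a)%R]mulrC => /andP[? ?]; apply/andP; split; lra.
    rewrite !lebesgue_measure_itv /= !lte_fin.
    rewrite ltr_pM2r ?invr_gt0 // ltrD2r.
    case: ltP => uv; last by rewrite mule0.
    rewrite -!EFinB -EFinM gtr0_norm //; congr EFin; field; exact: a0.
rewrite (lebesgue_measure_unique (e mf) mA) /= /mscale /= /pushforward muleA -EFinM.
by rewrite mulVf ?mul1e // normr_eq0.
Qed.

(** The skew product (x, t) |-> (phi x, a t + f x) is the step of all the
    volume computations below: on a measurable rectangle the fibre over x is an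
    affine preimage, whose length does not depend on the shift f x, and
    rectangles determine the product measure. *)
Lemma scales_skew d (T : measurableType d)
    (mu : {sigma_finite_measure set T -> \bar R}) c (phi : T -> T)
    (f : T -> R) (a : R) :
  scales mu c phi -> measurable_fun setT f -> a != 0%R ->
  scales (mu \x leb) (c * `|a|^-1)%R
    (fun y : T * measurableTypeR R =>
       (phi y.1, (a * y.2 + f y.1)%R : measurableTypeR R)).
Proof.
move=> [c0 mphi hphi] mf a0.
have hk b : scales leb `|a|^-1%R (fun t => (a * t + b)%R) by exact: lebesgue_affine.
have k0 : (0 < `|a|^-1)%R by rewrite invr_gt0 normr_gt0.
move: (`|a|^-1)%R hk k0 => k hk k0.
have d0 : (0 < c * k)%R by rewrite mulr_gt0.
set psi := fun y : T * measurableTypeR R => _.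
have mpsi : measurable_fun setT psi.
  apply: measurable_fun_pair; first exact: measurableT_comp.
  apply: (@measurable_funD _ _ _ _ (fun y => a * y.2)%R (f \o fst)) => //.
    apply: (@measurable_funM _ _ _ _ (cst a) snd) => //.
  exact: measurableT_comp.
split => // A mA.
have e0 : (0 <= (c * k)^-1)%R by rewrite invr_ge0 ltW.
have e : forall A B, measurable A -> measurable B ->
  mscale (NngNum e0) (pushforward (mu \x leb) psi) (A `*` B) = mu A * leb B.
  move=> m X Y mX mY.
  rewrite /mscale /pushforward /= /product_measure1.
  transitivity (((c * k)^-1)%:E *
     \int[mu]_x ((\1_(phi @^-1` X) x)%:E * (k%:E * leb Y)))%E.
    congr (_ * _); apply: eq_integral => x _ /=.
    have [_ _ <-//] := hk (f x).
    rewrite /xsection indicE /psi.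
    have [xX|xX] := boolP (x \in phi @^-1` X).
      rewrite mul1e; congr (leb _); apply/seteqP; split => t /=.
        by rewrite inE /= => -[].
      by rewrite inE => ?; split => //; move: xX; rewrite inE.
    rewrite mul0e; rewrite (_ : mkset _ = set0) ?measure0 //.
    apply/seteqP; split => t //=; rewrite inE /= => -[Xx _].
    by move: xX; rewrite notin_setE.
  have mpX : measurable (phi @^-1` X).
    by rewrite -[X in measurable X]setTI; exact: mphi.
  rewrite ge0_integralZr //; first last.
  - by rewrite mule_ge0 // lee_fin ltW.
  - exact/measurable_EFinP/measurable_indic.
  rewrite integral_indic // setIT.
  rewrite [Z in _ * (Z * _)](_ : _ = c%:E * mu X); last exact: hphi.
  transitivity (((c * k)^-1%R%:E * (c%:E * k%:E)) * (mu X * leb Y)).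
    by rewrite -!muleA; congr (_ * (_ * _)); exact: muleCA.
  by rewrite -!EFinM mulVf ?mul1e// gt_eqF.
rewrite (product_measure_unique (e mpsi) mA) /= /mscale /= /pushforward muleA -EFinM.
by rewrite divff ?mul1e // gt_eqF.
Qed.

Lemma scales_swap :
  scales (leb \x leb) 1%R (fun y : measurableTypeR R * measurableTypeR R => (y.2, y.1)).
Proof.
set sw := fun y : measurableTypeR R * measurableTypeR R => _.
have msw : measurable_fun setT sw.
  by apply: measurable_fun_pair; [exact: measurable_snd|exact: measurable_fst].
split => // A mA; rewrite mul1e.
have e : forall A B, measurable A -> measurable B ->
  pushforward (leb \x leb) sw (A `*` B) = leb A * leb B.
  move=> X Y mX mY; rewrite /pushforward /=.
  rewrite [X in (_ \x _) X](_ : _ = Y `*` X).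
    by rewrite product_measure1E // muleC.
  by apply/seteqP; split => -[a b] [].
transitivity (pushforward (leb \x leb) sw A) => //.
by apply/esym/product_measure_unique => //; exact: e.
Qed.

Let swap23 (y : measurableTypeR R * measurableTypeR R * measurableTypeR R) :
  measurableTypeR R * measurableTypeR R * measurableTypeR R := ((y.1.1, y.2), y.1.2).

(** The measure leb3 is built as leb2 times a line, so a swap of the last two
    coordinates cuts across its rectangles X * Y; the volume of the preimage of
    such a rectangle is computed by Tonelli instead. *)
Lemma scales_swap23 : scales (@leb3 R) 1%R swap23.
Proof.
have mswap : measurable_fun setT swap23.
  apply: measurable_fun_pair; last exact: measurableT_comp.
  apply: measurable_fun_pair; last exact: measurable_snd.
  exact: measurableT_comp.
split => // A mA; rewrite mul1e.
have e : forall A B, measurable A -> measurable B ->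
  pushforward (@leb3 R) swap23 (A `*` B) = @leb2 R A * leb B.
  move=> X Y mX mY; rewrite /pushforward /leb3.
  have mXY : measurable (swap23 @^-1` (X `*` Y)).
    rewrite -[Z in measurable Z]setTI; apply: mswap => //; exact: measurableX.
  rewrite /product_measure1 /=.
  transitivity (\int[@leb2 R]_y ((leb (xsection X y.1) * (\1_Y y.2)%:E))%E).
    apply: eq_integral => y _; rewrite indicE.
    have [yY|yY] := boolP (y.2 \in Y).
      rewrite mule1; congr (leb _); apply/seteqP; split => t.
        by rewrite /xsection /= !inE => -[].
      by rewrite /xsection /= !inE => Xt; split => //; move: yY; rewrite inE.
    rewrite mule0 [Z in leb Z](_ : _ = set0) ?measure0 //.
    apply/seteqP; split => t //; rewrite /xsection /= inE => -[_ Yy].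
    by move: yY; rewrite notin_setE.
  rewrite (fubini_tonelli1 (fun y => leb (xsection X y.1) * (\1_Y y.2)%:E)).
  - rewrite /fubini_F /=.
    transitivity (\int[leb]_x (leb (xsection X x) * leb Y)).
      apply: eq_integral => x _; rewrite ge0_integralZl //; last first.
      - exact/measurable_EFinP/measurable_indic.
      by rewrite integral_indic // setIT.
    rewrite ge0_integralZr //.
    exact: measurable_fun_xsection.
  - apply: emeasurable_funM.
      apply: (@measurableT_comp _ _ _ _ _ _ (leb \o xsection X) _ fst) => //.
      exact: measurable_fun_xsection.
    apply/measurable_EFinP.
    apply: (@measurableT_comp _ _ _ _ _ _ (\1_Y : _ -> R) _ snd) => //.
  - by move=> y; rewrite mule_ge0.
transitivity (pushforward (@leb3 R) swap23 A) => //.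
by apply/esym/product_measure_unique => //; exact: e.
Qed.
End Scaling.

Lemma lup_decomposition (F : fieldType) n (A : 'M[F]_n.+1) :
  exists (s : 'S_n.+1) (L U : 'M[F]_n.+1), [/\ perm_mx s *m A = L *m U,
    forall i j : 'I_n.+1, (i <= j)%N -> L i j = (i == j)%:R &
    forall i j : 'I_n.+1, (j < i)%N -> U i j = 0].
Proof.
have := cormen_lup_correct A; have := cormen_lup_perm A.
have := @cormen_lup_lower _ _ A; have := @cormen_lup_upper _ _ A.
case: (cormen_lup A) => [[P L] U] hU hL /is_perm_mxP[s eP] eM.
by exists s, L, U; split => //; rewrite -eP.
Qed.

Section Matrices.
Context {R : realType}.
Implicit Types M N : 'M[R]_3.

Lemma sum3 (V : nmodType) (f : 'I_3 -> V) : \sum_i f i = f 0 + f 1 + f 2.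
Proof.
rewrite !big_ord_recl big_ord0 addr0 addrA.
by congr (f _ + f _ + f _); apply: val_inj.
Qed.

Lemma ord3 (P : 'I_3 -> Prop) : P 0 -> P 1 -> P 2 -> forall i, P i.
Proof.
move=> p0 p1 p2 [[|[|[|//]]] h].
- by rewrite (_ : Ordinal h = 0) //; apply: val_inj.
- by rewrite (_ : Ordinal h = 1) //; apply: val_inj.
- by rewrite (_ : Ordinal h = 2) //; apply: val_inj.
Qed.

Lemma det33 M : \det M =
  M 0 0 * (M 1 1 * M 2 2 - M 1 2 * M 2 1) - M 0 1 * (M 1 0 * M 2 2 - M 1 2 * M 2 0)
  + M 0 2 * (M 1 0 * M 2 1 - M 1 1 * M 2 0).
Proof.
pose f a b := M (inord a) (inord b).
have -> : M = \matrix_(i, j) f i j by apply/matrixP => i j; rewrite mxE /f !inord_val.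
rewrite (expand_det_row _ 0) sum3 /cofactor /= !(expand_det_row _ 0) /cofactor.
rewrite !big_ord_recl !big_ord0 /cofactor !det_mx11 !mxE /=.
rewrite !modn_small //= /bump /= !expr0 !expr1 !exprS !expr0.
ring.
Qed.

Definition to_prod (x : 'rV[R]_3) : measurableTypeR R * measurableTypeR R * measurableTypeR R :=
  (x 0 0, x 0 1, x 0 2).

Lemma to_pt3E (y : R * R * R) :
  (to_pt3 y 0 0 = y.1.1) * (to_pt3 y 0 1 = y.1.2) * (to_pt3 y 0 2 = y.2).
Proof. by rewrite !mxE. Qed.

Lemma to_prodK : cancel to_prod to_pt3.
Proof.
by move=> x; apply/rowP => i; move: i; apply: ord3; rewrite !to_pt3E.
Qed.

Lemma to_pt3K : cancel to_pt3 to_prod.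
Proof. by move=> [[a b] c]; rewrite /to_prod !to_pt3E. Qed.

Definition linmap M y := to_prod (to_pt3 y *m M).

Definition volume_scaled M : Prop :=
  M \in unitmx -> scales (@leb3 R) `|\det M|^-1 (linmap M).

Lemma volume_scaledM M N : volume_scaled M -> volume_scaled N ->
  volume_scaled (M *m N).
Proof.
move=> hM hN; rewrite /volume_scaled unitmx_mul => /andP[uM uN].
rewrite det_mulmx normrM invfM.
have -> : linmap (M *m N) = linmap N \o linmap M.
  by apply/funext => y; rewrite /linmap /= to_prodK mulmxA.
by apply: scales_comp; [exact: hM|exact: hN].
Qed.

(** The identity with column j replaced by v, i.e. the linear map that changes
    coordinate j only. *)
Definition column_mx (j : 'I_3) (v : 'I_3 -> R) : 'M[R]_3 :=
  \matrix_(a, b) if b == j then v a else (a == b)%:R.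

Lemma volume_scaled_column2 v : volume_scaled (column_mx 2 v).
Proof.
rewrite /volume_scaled unitmxE (_ : \det _ = v 2); last first.
  by rewrite det33 !mxE /=; ring.
rewrite unitfE => v2.
pose f (y : measurableTypeR R * measurableTypeR R) : R := v 0 * y.1 + v 1 * y.2.
have mf : measurable_fun setT f.
  apply: (@measurable_funD _ _ _ _ (fun y => v 0 * y.1) (fun y => v 1 * y.2)).
    exact: (@measurable_funM _ _ _ _ (cst (v 0)) fst).
  exact: (@measurable_funM _ _ _ _ (cst (v 1)) snd).
have := scales_skew (scales_id (@leb2 R)) mf v2.
rewrite mul1r; congr (scales _ _ _); apply/funext => -[[a b] c] /=.
rewrite /linmap /to_prod !mxE !sum3 !to_pt3E !mxE /= /f /=.
by congr (_, _, _); ring.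
Qed.

Lemma volume_scaled_tperm01 : volume_scaled (tperm_mx 0 1).
Proof.
move=> _.
rewrite det_perm odd_tperm /= expr1 normrN1 invr1.
have h := @scales_skew R _ _ (@leb2 R) _ _ (cst 0) 1 (scales_swap (R := R)).
have := h (measurable_cst _) (oner_neq0 _).
rewrite normr1 invr1 mulr1; congr (scales _ _ _); apply/funext => -[[a b] c] /=.
rewrite /linmap /to_prod !mxE !sum3 !to_pt3E !mxE !permE /=.
by congr (_, _, _); ring.
Qed.

Lemma volume_scaled_tperm12 : volume_scaled (tperm_mx 1 2).
Proof.
move=> _; rewrite det_perm odd_tperm /= expr1 normrN1 invr1.
have := @scales_swap23 R; congr (scales _ _ _); apply/funext => -[[a b] c] /=.
rewrite /linmap /to_prod !mxE !sum3 !to_pt3E !mxE !permE /=.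
by congr (_, _, _); ring.
Qed.

Lemma volume_scaled_perm (s : 'S_3) : volume_scaled (perm_mx s).
Proof.
have id1 : volume_scaled 1%:M.
  move=> _; rewrite det1 normr1 invr1.
  have := scales_id (@leb3 R); congr (scales _ _ _); apply/funext => y.
  by rewrite /linmap mulmx1 to_pt3K.
have t02 : volume_scaled (tperm_mx 0 2).
  have -> : tperm_mx 0 2 = tperm_mx 0 1 *m tperm_mx 1 2 *m tperm_mx 0 1 :> 'M[R]_3.
    rewrite -!perm_mxM; congr perm_mx; apply/permP => i; move: i.
    by apply: ord3; rewrite !permM !permE.
  apply: volume_scaledM; last exact: volume_scaled_tperm01.
  by apply: volume_scaledM; [exact: volume_scaled_tperm01|exact: volume_scaled_tperm12].
have [ts -> _] := prod_tpermP s.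
elim: ts => [|t ts IH]; first by rewrite big_nil perm_mx1.
rewrite big_cons perm_mxM; apply: volume_scaledM => //.
case: t => i j /=.
move: i j; apply: ord3; apply: ord3; rewrite ?tperm1 ?perm_mx1 //.
- exact: volume_scaled_tperm01.
- by rewrite tpermC; exact: volume_scaled_tperm01.
- exact: volume_scaled_tperm12.
- by rewrite tpermC; exact: t02.
- by rewrite tpermC; exact: volume_scaled_tperm12.
Qed.

Lemma volume_scaled_column j v : volume_scaled (column_mx j v).
Proof.
have -> : column_mx j v =
    tperm_mx j 2 *m column_mx 2 (v \o tperm j 2) *m tperm_mx j 2.
  rewrite /tperm_mx -row_permE -[X in _ *m perm_mx X]tpermV -col_permE.
  apply/matrixP => a b; rewrite !mxE /= tpermK.
  have -> : (tperm j 2 b == 2) = (b == j).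
    by rewrite -[X in _ == X](tpermL j 2) (inj_eq perm_inj).
  by rewrite (inj_eq perm_inj).
apply: volume_scaledM; last exact: volume_scaled_perm.
apply: volume_scaledM; [exact: volume_scaled_perm|exact: volume_scaled_column2].
Qed.

(** Permutation matrices and the column matrices generate all matrices by the
    LUP decomposition: each triangular factor is a product of three column
    matrices, in an order that never reads an already changed coordinate. *)
Lemma volume_scaled_unit M : volume_scaled M.
Proof.
have [s [L [U [eM hL hU]]]] := lup_decomposition M.
have -> : M = perm_mx s^-1 *m (L *m U).
  by rewrite -[L *m U]eM mulmxA -perm_mxM mulVg perm_mx1 mul1mx.
have -> : L = column_mx 0 (L^~ 0) *m column_mx 1 (L^~ 1) *m column_mx 2 (L^~ 2).
  apply/matrixP => i j; rewrite mxE sum3 !mxE !sum3 !mxE.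
  move: i j; apply: ord3; apply: ord3 => /=;
    rewrite ?(hL 0 0) ?(hL 0 1) ?(hL 0 2) ?(hL 1 1) ?(hL 1 2) ?(hL 2 2) //=; ring.
have -> : U = column_mx 2 (U^~ 2) *m column_mx 1 (U^~ 1) *m column_mx 0 (U^~ 0).
  apply/matrixP => i j; rewrite mxE sum3 !mxE !sum3 !mxE.
  move: i j; apply: ord3; apply: ord3 => /=;
    rewrite ?(hU 1 0) ?(hU 2 0) ?(hU 2 1) //=; ring.
apply: volume_scaledM; first exact: volume_scaled_perm.
by do !apply: volume_scaledM; exact: volume_scaled_column.
Qed.

End Matrices.

(** * Volume of a simplex *)

Section ReferenceSimplex.
Context {R : realType}.
Notation leb := (@lebesgue_measure R).

Lemma scales_translation (b : 'rV[R]_3) :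
  scales (@leb3 R) 1 (fun y => to_prod (to_pt3 y + b)).
Proof.
have s1 := @lebesgue_affine R 1 (b 0 0) (oner_neq0 _).
have s2 := @scales_skew R _ _ leb _ _ (cst (b 0 1)) 1 s1 (measurable_cst _) (oner_neq0 _).
have := @scales_skew R _ _ (@leb2 R) _ _ (cst (b 0 2)) 1 s2 (measurable_cst _) (oner_neq0 _).
rewrite normr1 invr1 !mulr1; congr (scales _ _ _); apply/funext => -[[x y] z].
by rewrite /to_prod !mxE /= !mul1r.
Qed.

Definition reference_simplex : set (measurableTypeR R * measurableTypeR R * measurableTypeR R) :=
  [set y | [/\ 0 < y.1.1, 0 < y.1.2, 0 < y.2 & y.1.1 + y.1.2 + y.2 < 1]].

Lemma measurable_reference_simplex : measurable reference_simplex.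
Proof.
have m1 : measurable_fun setT (fun y : measurableTypeR R * measurableTypeR R * measurableTypeR R => y.1.1).
  exact: (measurableT_comp measurable_fst).
have m2 : measurable_fun setT (fun y : measurableTypeR R * measurableTypeR R * measurableTypeR R => y.1.2).
  exact: (measurableT_comp measurable_snd).
have m3 : measurable_fun setT (fun y : measurableTypeR R * measurableTypeR R * measurableTypeR R => y.2).
  exact: measurable_snd.
pose f y := [&& 0 < y.1.1, 0 < y.1.2, 0 < y.2 & y.1.1 + y.1.2 + y.2 < 1 :> R].
have -> : reference_simplex = f @^-1` [set true].
  by apply/seteqP; split => y; rewrite /f /=; [case=> -> -> -> ->|case/and4P].
rewrite -[X in measurable X]setTI.
have mf : measurable_fun setT f.
  apply: measurable_and; first exact: measurable_fun_ltr.
  apply: measurable_and; first exact: measurable_fun_ltr.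
  apply: measurable_and; first exact: measurable_fun_ltr.
  apply: measurable_fun_ltr => //.
  by apply: measurable_funD => //; apply: measurable_funD.
exact: mf.
Qed.

(** Equal to 1/6; what matters is that it is positive, finite and the same for
    all simplices. *)
Definition reference_volume : R := fine (leb3 reference_simplex).

Lemma leb3_box (a b : R) : a < b ->
  leb3 (`]a, b[ `*` `]a, b[ `*` `]a, b[) = ((b - a) ^+ 3)%:E.
Proof.
move=> ab; pose I : set (measurableTypeR R) := `]a, b[%classic.
have lI : leb I = (b - a)%:E by rewrite lebesgue_measure_itv /= lte_fin ab.
have mI : measurable I by exact: measurable_itv.
have mII : measurable (I `*` I) by exact: measurableX.
have e2 := @product_measure1E _ _ _ _ _ leb leb _ _ mI mI.
have e3 := @product_measure1E _ _ _ _ _ (@leb2 R) leb _ _ mII mI.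
apply: (etrans e3); apply: (etrans (congr1 (fun z => z * leb I)%E e2)).
transitivity ((b - a)%:E * (b - a)%:E * (b - a)%:E)%E.
  by congr (_ * _ * _)%E; exact: lI.
by rewrite -!EFinM; congr (_%:E); ring.
Qed.

Lemma reference_volumeE : leb3 reference_simplex = reference_volume%:E.
Proof.
rewrite /reference_volume fineK // ge0_fin_numE ?measure_ge0 //.
apply: (@le_lt_trans _ _ (leb3 (`]0, 1[ `*` `]0, 1[ `*` `]0, 1[))).
  apply: le_measure; rewrite ?inE //; first exact: measurable_reference_simplex.
    by apply: measurableX => //; exact: measurableX.
  move=> [[x y] z] [/= x0 y0 z0 xyz]; rewrite !in_itv /=.
  by split; [split|]; apply/andP; split; lra.
by rewrite leb3_box ?ltr01 // ltry.
Qed.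

Lemma reference_volume_gt0 : 0 < reference_volume.
Proof.
have h : 0 < 3^-1 :> R by rewrite invr_gt0.
rewrite -lte_fin -reference_volumeE.
apply: (@lt_le_trans _ _ (leb3 (`]0, 3^-1[ `*` `]0, 3^-1[ `*` `]0, 3^-1[))).
  by rewrite leb3_box // lte_fin subr0 exprn_gt0.
apply: le_measure; rewrite ?inE //; last 2 first.
- exact: measurable_reference_simplex.
- move=> [[x y] z] /=; rewrite !in_itv /= => -[[/andP[? ?] /andP[? ?]] /andP[? ?]].
  by split => //=; lra.
- by apply: measurableX => //; exact: measurableX.
Qed.

(** The rows of A are the edges of the simplex from the vertex a, and
    (x - a) A^-1 are the barycentric coordinates of x at the other vertices. *)
Definition open_simplex (a : 'rV[R]_3) (A : 'M[R]_3) : set 'rV[R]_3 :=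
  [set x | reference_simplex (to_prod ((x - a) *m invmx A))].

Lemma open_simplex_volume a A : A \in unitmx ->
  measurable (to_pt3 @^-1` open_simplex a A : set (measurableTypeR R * measurableTypeR R * measurableTypeR R)) /\
  leb3 (to_pt3 @^-1` open_simplex a A) = (`|\det A| * reference_volume)%:E.
Proof.
move=> uA.
have uV : invmx A \in unitmx by rewrite unitmx_inv.
have [_ mt ht] := scales_translation (- a).
have [_ ml hl] := volume_scaled_unit uV.
have -> : to_pt3 @^-1` open_simplex a A =
    (fun y => to_prod (to_pt3 y - a)) @^-1` (linmap (invmx A) @^-1` reference_simplex).
  by apply/seteqP; split => y; rewrite /open_simplex /linmap /= to_prodK.
have mS : measurable (linmap (invmx A) @^-1` reference_simplex).
  rewrite -[X in measurable X]setTI; apply: ml => //.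
  exact: measurable_reference_simplex.
split; first by rewrite -[X in measurable X]setTI; exact: mt.
rewrite ht // mul1e hl ?reference_volumeE; last exact: measurable_reference_simplex.
by rewrite det_inv normfV invrK EFinM.
Qed.

End ReferenceSimplex.

(** * Integrals over the unit triangle *)

Section Rint.
Context d (T : measurableType d) (R : realType) (mu : {measure set T -> \bar R}).
Variables (D : set T) (mD : measurable D).

Lemma integrable_lincomb (I : Type) (s : seq I) (c : I -> R) (f : I -> T -> R) :
  (forall i, mu.-integrable D (EFin \o f i)) ->
  mu.-integrable D (EFin \o (fun x => \sum_(i <- s) c i * f i x)).
Proof.
move=> fi; elim: s => [|i s IH].
  rewrite (_ : _ \o _ = cst 0%E); first exact: integrable0.
  by apply/funext => x /=; rewrite big_nil.
rewrite (_ : _ \o _ = ((fun x => (c i)%:E * (f i x)%:E) \+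
    (EFin \o (fun x => (\sum_(j <- s) c j * f j x)%R)))%E).
  by apply: integrableD => //; apply: integrableZl => //; exact: fi.
by apply/funext => x /=; rewrite big_cons EFinD EFinM.
Qed.

Lemma Rintegral_lincomb (I : Type) (s : seq I) (c : I -> R) (f : I -> T -> R) :
  (forall i, mu.-integrable D (EFin \o f i)) ->
  \int[mu]_(x in D) (\sum_(i <- s) c i * f i x) =
  \sum_(i <- s) c i * \int[mu]_(x in D) f i x.
Proof.
move=> fi; elim: s => [|i s IH].
  rewrite big_nil (_ : (fun x => _) = cst 0) ?Rintegral_cst ?mul0r //.
  by apply/funext => x /=; rewrite big_nil.
rewrite big_cons -IH -RintegralZl // -RintegralD //.
- by congr Rintegral; apply/funext => x /=; rewrite big_cons.
- rewrite (_ : _ \o _ = (fun x => (c i)%:E * (f i x)%:E)%E).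
    by apply: integrableZl => //; exact: fi.
  by apply/funext => x /=; rewrite EFinM.
- exact: integrable_lincomb.
Qed.
End Rint.

Section Triangle.
Context {R : realType}.
Notation leb := (@lebesgue_measure R).

Lemma integral_poly (P : {poly R}) (a b : R) : a <= b ->
  (\int[leb]_(x in `[a, b]) (P^`().[x])%:E = (P.[b] - P.[a])%:E)%E.
Proof.
rewrite le_eqVlt => /predU1P[->|ab].
  by rewrite set_itv1 integral_set1 subrr.
rewrite (@continuous_FTC2 _ _ (horner P)) //.
- by apply: continuous_subspaceT; exact: continuous_horner.
- split.
  + by move=> x _; exact: derivable_horner.
  + by apply: cvg_at_right_filter; exact: continuous_horner.
  + by apply: cvg_at_left_filter; exact: continuous_horner.
- by move=> x _; rewrite -derivE.
Qed.

Definition unit_triangle : set (measurableTypeR R * measurableTypeR R) :=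
  [set y | [/\ 0 <= y.1, 0 <= y.2 & y.1 + y.2 <= 1]].

Lemma measurable_unit_triangle : measurable unit_triangle.
Proof.
pose f (y : measurableTypeR R * measurableTypeR R) :=
  [&& 0 <= y.1, 0 <= y.2 & y.1 + y.2 <= 1 :> R].
have -> : unit_triangle = f @^-1` [set true].
  by apply/seteqP; split => y; rewrite /f /=; [case=> -> -> ->|case/and3P].
rewrite -[X in measurable X]setTI.
have mf : measurable_fun setT f.
  apply: measurable_and; first exact: measurable_fun_ler.
  apply: measurable_and; first exact: measurable_fun_ler.
  by apply: measurable_fun_ler => //; apply: measurable_funD.
exact: mf.
Qed.

Definition monomial i j (y : measurableTypeR R * measurableTypeR R) : R := y.1 ^+ i * y.2 ^+ j.

Lemma measurable_monomial i j : measurable_fun setT (monomial i j).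
Proof.
by apply: measurable_funM; apply: measurable_funX.
Qed.

(** Integrating y^i z^j over 0 <= z <= 1 - y leaves y^i (1 - y)^(j+1) / (j+1),
    of which P is a primitive. *)
Lemma integral_monomial i j (P : {poly R}) :
  (forall y, P^`().[y] = y ^+ i * ((1 - y) ^+ j.+1 / j.+1%:R)) ->
  (\int[@leb2 R]_(y in unit_triangle) (monomial i j y)%:E = (P.[1] - P.[0])%:E)%E.
Proof.
move=> PE.
rewrite integral_mkcond.
set g := (X in (\int[_]_x X x)%E).
have mg : measurable_fun setT g.
  apply: (measurable_restrictT _ measurable_unit_triangle).1.
  by apply/measurable_EFinP; apply: measurable_funTS; exact: measurable_monomial.
have g0 y : (0 <= g y)%E.
  rewrite /g patchE; case: ifPn => // /set_mem [y1 y2 _].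
  by rewrite lee_fin /monomial mulr_ge0 // exprn_ge0.
rewrite (fubini_tonelli1 g) // /fubini_F.
rewrite -integral_poly ?ler01 // [RHS]integral_mkcond.
apply: eq_integral => y _.
rewrite [RHS]patchE.
case: ifPn => [|yn]; last first.
  apply: integral0_eq => z _; rewrite /g patchE; case: ifPn => // /set_mem [/= y0 z0 yz].
  by case/negP: yn; apply/mem_set; rewrite /= in_itv /=; apply/andP; split; lra.
rewrite inE /= in_itv /= => /andP[y0 y1].
transitivity (\int[leb]_(z in `[0%R, (1 - y)%R])
   ((y ^+ i *: 'X^(j.+1) * (j.+1%:R^-1)%:P)^`().[z])%:E)%E.
  rewrite [RHS]integral_mkcond; apply: eq_integral => z _.
  rewrite /g !patchE.
  have -> : ((y, z) \in unit_triangle) = (z \in (`[0%R, (1 - y)%R]%classic : set (measurableTypeR R))).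
    apply/idP/idP => /set_mem.
      by case=> /= _ z0 yz; apply/mem_set; rewrite /= in_itv /=; apply/andP; split; lra.
    by rewrite /= in_itv /= => /andP[? ?]; apply/mem_set; split => //=; lra.
  case: ifP => // _; congr (_%:E); rewrite /monomial /=.
  rewrite derivM derivC mulr0 addr0 derivZ derivXn.
  rewrite !hornerE /= hornerMn hornerXn -mulrA -[in RHS]mulr_natr mulfK //.
rewrite integral_poly ?subr_ge0 // PE; congr (_%:E).
by rewrite !hornerE /= expr0n /=; ring.
Qed.

(** The primitives of all monomials of degree at most two have this form. *)
Lemma integral_monomial_quartic i j (c1 c2 c3 c4 : R) :
  (forall y, c1 + 2 * c2 * y + 3 * c3 * y ^+ 2 + 4 * c4 * y ^+ 3
             = y ^+ i * ((1 - y) ^+ j.+1 / j.+1%:R)) ->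
  (\int[@leb2 R]_(y in unit_triangle) (monomial i j y)%:E
     = (c1 + c2 + c3 + c4)%:E)%E.
Proof.
move=> h.
rewrite (@integral_monomial i j (c1 *: 'X + c2 *: 'X^2 + c3 *: 'X^3 + c4 *: 'X^4)).
  by congr (_%:E); rewrite !hornerE /=; ring.
by move=> y; rewrite -h !derivD !derivZ !derivXn derivX !hornerE /= ?hornerMn ?hornerXn /=; ring.
Qed.

Lemma integral_monomial00 :
  (\int[@leb2 R]_(y in unit_triangle) (monomial 0 0 y)%:E = (2^-1)%:E)%E.
Proof.
rewrite (@integral_monomial_quartic _ _ 1 (- 2^-1) 0 0); first by congr (_%:E); field.
by move=> y; field.
Qed.

Lemma integral_monomial10 :
  (\int[@leb2 R]_(y in unit_triangle) (monomial 1 0 y)%:E = (6^-1)%:E)%E.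
Proof.
rewrite (@integral_monomial_quartic _ _ 0 (2^-1) (- 3^-1) 0); first by congr (_%:E); field.
by move=> y; field.
Qed.

Lemma integral_monomial01 :
  (\int[@leb2 R]_(y in unit_triangle) (monomial 0 1 y)%:E = (6^-1)%:E)%E.
Proof.
rewrite (@integral_monomial_quartic _ _ (2^-1) (- 2^-1) (6^-1) 0); first by congr (_%:E); field.
by move=> y; field.
Qed.

Lemma integral_monomial20 :
  (\int[@leb2 R]_(y in unit_triangle) (monomial 2 0 y)%:E = (12^-1)%:E)%E.
Proof.
rewrite (@integral_monomial_quartic _ _ 0 0 (3^-1) (- 4^-1)); first by congr (_%:E); field.
by move=> y; field.
Qed.

Lemma integral_monomial11 :
  (\int[@leb2 R]_(y in unit_triangle) (monomial 1 1 y)%:E = (24^-1)%:E)%E.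
Proof.
rewrite (@integral_monomial_quartic _ _ 0 (4^-1) (- 3^-1) (8^-1)); first by congr (_%:E); field.
by move=> y; field.
Qed.

Lemma integral_monomial02 :
  (\int[@leb2 R]_(y in unit_triangle) (monomial 0 2 y)%:E = (12^-1)%:E)%E.
Proof.
rewrite (@integral_monomial_quartic _ _ (3^-1) (- 2^-1) (3^-1) (- 12^-1)); first by congr (_%:E); field.
by move=> y; field.
Qed.

Lemma integrable_monomial (ij : nat * nat) :
  (@leb2 R).-integrable unit_triangle (EFin \o monomial ij.1 ij.2).
Proof.
case: ij => i j /=.
have mm k l : measurable_fun unit_triangle (EFin \o monomial k l).
  by apply/measurable_EFinP; apply: measurable_funTS; exact: measurable_monomial.
apply: (@le_integrable _ _ _ _ _ measurable_unit_triangle _ (EFin \o monomial 0 0)) => //.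
  move=> y [y1 y2 y12] /=; rewrite lee_fin /monomial !expr0 mulr1 normr1.
  rewrite ger0_norm ?mulr_ge0 ?exprn_ge0 //.
  by rewrite mulr_ile1 ?exprn_ge0 // exprn_ile1 //; lra.
apply/integrableP; split => //.
rewrite (eq_integral (EFin \o monomial 0 0)) /=.
  by rewrite integral_monomial00 ltry.
by move=> y _; rewrite /= /monomial !expr0 mulr1 normr1.
Qed.

(** The affine function with values f 0, f 1, f 2 at the vertices (0, 0),
    (1, 0), (0, 1) of the unit triangle. *)
Definition affine2 (f : 'I_3 -> R) (y : measurableTypeR R * measurableTypeR R) : R :=
  f 0 + y.1 * (f 1 - f 0) + y.2 * (f 2 - f 0).

Let degrees : seq (nat * nat) := [:: (0, 0); (1, 0); (0, 1); (2, 0); (1, 1); (0, 2)]%N.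

Let coef (f g : 'I_3 -> R) (ij : nat * nat) : R :=
  let f1 := f 1 - f 0 in let f2 := f 2 - f 0 in
  let g1 := g 1 - g 0 in let g2 := g 2 - g 0 in
  match ij with
  | (0, 0)%N => f 0 * g 0 | (1, 0)%N => f 0 * g1 + f1 * g 0
  | (0, 1)%N => f 0 * g2 + f2 * g 0
  | (2, 0)%N => f1 * g1 | (1, 1)%N => f1 * g2 + f2 * g1 | (0, 2)%N => f2 * g2
  | _ => 0
  end.

Let affine2_mul f g y : affine2 f y * affine2 g y =
  \sum_(ij <- degrees) coef f g ij * monomial ij.1 ij.2 y.
Proof.
rewrite /degrees !big_cons big_nil /coef /monomial /affine2 /=; ring.
Qed.

Lemma integrable_affine2_mul f g :
  (@leb2 R).-integrable unit_triangle (EFin \o (fun y => affine2 f y * affine2 g y)).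
Proof.
rewrite (_ : (fun y => _) = fun y => \sum_(ij <- degrees) coef f g ij * monomial ij.1 ij.2 y).
  apply: integrable_lincomb; first exact: measurable_unit_triangle.
  exact: integrable_monomial.
by apply/funext => y; exact: affine2_mul.
Qed.

(** The mass matrix of a triangle: 1/12 on the diagonal and 1/24 off it. *)
Lemma Rintegral_affine2_mul f g :
  \int[@leb2 R]_(y in unit_triangle) (affine2 f y * affine2 g y) =
  (\sum_i f i * g i + (\sum_i f i) * (\sum_i g i)) / 24.
Proof.
rewrite (_ : (fun y => _) = fun y => \sum_(ij <- degrees) coef f g ij * monomial ij.1 ij.2 y).
  rewrite Rintegral_lincomb; [|exact: measurable_unit_triangle|exact: integrable_monomial].
  rewrite /degrees !big_cons big_nil /Rintegral.
  rewrite integral_monomial00 integral_monomial10 integral_monomial01.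
  rewrite integral_monomial20 integral_monomial11 integral_monomial02 /=.
  by rewrite !sum3; field.
by apply/funext => y; exact: affine2_mul.
Qed.

End Triangle.

(** * Affine functions *)

Section Affine.
Context {R : realType}.
Implicit Types u v : pt3 R.

Lemma frob_row u v : frob u v = \sum_j u 0 j * v 0 j.
Proof. by rewrite /frob big_ord_recl big_ord0 addr0. Qed.

Lemma frobC m n (A B : 'M[R]_(m, n)) : frob A B = frob B A.
Proof. by apply: eq_bigr => i _; apply: eq_bigr => j _; rewrite mulrC. Qed.

Lemma frobDl m n (A B C : 'M[R]_(m, n)) : frob (A + B) C = frob A C + frob B C.
Proof.
rewrite /frob -big_split; apply: eq_bigr => i _; rewrite -big_split.
by apply: eq_bigr => j _; rewrite mxE mulrDl.
Qed.

Lemma frobZl m n c (A B : 'M[R]_(m, n)) : frob (c *: A) B = c * frob A B.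
Proof.
rewrite /frob mulr_sumr; apply: eq_bigr => i _; rewrite mulr_sumr.
by apply: eq_bigr => j _; rewrite mxE mulrA.
Qed.

Lemma frobDr m n (A B C : 'M[R]_(m, n)) : frob C (A + B) = frob C A + frob C B.
Proof. by rewrite frobC frobDl !(frobC C). Qed.

Lemma frobZr m n c (A B : 'M[R]_(m, n)) : frob B (c *: A) = c * frob B A.
Proof. by rewrite frobC frobZl frobC. Qed.

Lemma frobNl m n (A B : 'M[R]_(m, n)) : frob (- A) B = - frob A B.
Proof. by rewrite -scaleN1r frobZl mulN1r. Qed.

Lemma frobNr m n (A B : 'M[R]_(m, n)) : frob A (- B) = - frob A B.
Proof. by rewrite frobC frobNl frobC. Qed.

Lemma frob0l m n (B : 'M[R]_(m, n)) : frob 0 B = 0.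
Proof. by rewrite -(scale0r 0) frobZl mul0r. Qed.

Lemma frob0r m n (B : 'M[R]_(m, n)) : frob B 0 = 0.
Proof. by rewrite frobC frob0l. Qed.

Lemma frob_suml m n (I : finType) (P : pred I) (f : I -> 'M[R]_(m, n)) B :
  frob (\sum_(i | P i) f i) B = \sum_(i | P i) frob (f i) B.
Proof.
by elim/big_ind2 : _ => [|_ A _ C <- <-|//]; rewrite ?frob0l ?frobDl.
Qed.

Lemma frob_sumr m n (I : finType) (P : pred I) (f : I -> 'M[R]_(m, n)) B :
  frob B (\sum_(i | P i) f i) = \sum_(i | P i) frob B (f i).
Proof.
by elim/big_ind2 : _ => [|_ A _ C <- <-|//]; rewrite ?frob0r ?frobDr.
Qed.

Lemma frob_ge0 m n (A : 'M[R]_(m, n)) : 0 <= frob A A.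
Proof. by apply: sumr_ge0 => i _; apply: sumr_ge0 => j _; rewrite -expr2 sqr_ge0. Qed.

Lemma frob_unit n (v : 'rV[R]_n) : enorm v = 1 -> frob v v = 1.
Proof.
rewrite /enorm => /(congr1 (fun z => z ^+ 2)).
by rewrite sqr_sqrtr ?frob_ge0 ?expr1n.
Qed.

Lemma frob_eq0 m n (A : 'M[R]_(m, n)) : frob A A = 0 -> A = 0.
Proof.
move=> /eqP; rewrite psumr_eq0 => [/allP h|i _]; last first.
  by apply: sumr_ge0 => j _; rewrite -expr2 sqr_ge0.
apply/matrixP => i j; rewrite mxE.
have := h i (mem_index_enum _); rewrite psumr_eq0 => [/allP /(_ j (mem_index_enum _))|k _].
  by rewrite mulf_eq0 orbb => /eqP.
by rewrite -expr2 sqr_ge0.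
Qed.

(** A finite difference, which is the gradient of an affine function but is
    linear in f without any hypothesis on f. *)
Definition slope (f : pt3 R -> R) : pt3 R := \row_j (f (delta_mx 0 j) - f 0).

Definition affine (f : pt3 R -> R) := forall x, f x = f 0 + frob (slope f) x.

Lemma affineP (c : R) (v : pt3 R) f : (forall x, f x = c + frob v x) ->
  [/\ affine f, slope f = v & f 0 = c].
Proof.
move=> h.
have f0 : f 0 = c by rewrite h frob0r addr0.
have s : slope f = v.
  apply/rowP => j; rewrite mxE !h frob0r addr0 addrAC subrr add0r.
  rewrite frob_row (bigD1 j) //= big1 ?addr0 ?mxE ?eqxx ?mulr1 // => i ij.
  by rewrite mxE (negbTE ij) andbF mulr0.
by split => // x; rewrite s f0.
Qed.

Lemma affine_combination (I : finType) (w : I -> R) (x : I -> pt3 R) f :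
  affine f -> \sum_i w i = 1 -> f (\sum_i w i *: x i) = \sum_i w i * f (x i).
Proof.
move=> hf w1; rewrite hf frob_sumr -[f 0]mul1r -w1 mulr_suml -big_split.
by apply: eq_bigr => i _; rewrite frobZr [in RHS]hf mulrDr.
Qed.

Lemma affineD f g (a : R) : affine f -> affine g ->
  affine (fun x => a * f x + g x) /\
  slope (fun x => a * f x + g x) = a *: slope f + slope g.
Proof.
move=> hf hg.
have h x : a * f x + g x = a * f 0 + g 0 + frob (a *: slope f + slope g) x.
  by rewrite hf hg frobDl frobZl; ring.
by case: (affineP h).
Qed.

Lemma polynomial_le1P f : polynomial_le 1 f <-> affine f.
Proof.
split=> [[c h]|h].
  suff e x : f x = c 0%N 0%N 0%N + frob (\row_j [:: c 1%N 0%N 0%N; c 0%N 1%N 0%N; c 0%N 0%N 1%N]`_j) x.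
    by case: (affineP e).
  rewrite h frob_row sum3 !mxE /=.
  rewrite !big_ord_recl !big_ord0 /=.
  do ! rewrite big_mkcond !big_ord_recl !big_ord0 /=.
  rewrite /bump /= !expr0 !expr1; ring.
pose c (i j l : nat) : R := match i, j, l with
  | 0%N, 0%N, 0%N => f 0 | 1%N, 0%N, 0%N => slope f 0 0
  | 0%N, 1%N, 0%N => slope f 0 1 | 0%N, 0%N, 1%N => slope f 0 2 | _, _, _ => 0
  end.
exists c.
move=> x; rewrite h frob_row sum3.
rewrite !big_ord_recl !big_ord0 /=.
do ! rewrite big_mkcond !big_ord_recl !big_ord0 /=.
rewrite /bump /= !expr0 !expr1; ring.
Qed.

Lemma polynomial_le0P (f : pt3 R -> R) : polynomial_le 0 f <-> forall x, f x = f 0.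
Proof.
split=> [[c h] x|h].
  rewrite !h; do ! rewrite big_mkcond !big_ord_recl !big_ord0 /=.
  by rewrite !expr0.
exists (fun _ _ _ => f 0) => x.
rewrite h; do ! rewrite big_mkcond !big_ord_recl !big_ord0 /=.
by rewrite !expr0; ring.
Qed.

Lemma constant_affine (f : pt3 R -> R) : (forall x, f x = f 0) -> affine f /\ slope f = 0.
Proof.
move=> h; have e x : f x = f 0 + frob 0 x by rewrite frob0l addr0.
by case: (affineP e).
Qed.

Lemma affine_cst (c : R) : affine (fun=> c).
Proof. by have [|//] := @constant_affine (fun=> c). Qed.

Lemma partial_affine j f x : affine f -> partial j f x = slope f 0 j.
Proof.
move=> hf; rewrite /partial /derive.
apply: cvg_lim => //.
apply: (@cvg_trans _ (nbhs (slope f 0 j))); last exact: cvg_id.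
apply: cvg_near_cst.
near=> h.
have h0 : h != 0 by near: h; exact: nbhs_dnbhs_neq.
rewrite /= hf [in X in _ - X]hf frobDr frobZr.
have -> : frob (slope f) (delta_mx 0 j) = slope f 0 j.
  rewrite frob_row (bigD1 j) //= big1 ?addr0 ?mxE ?eqxx ?mulr1 // => i ij.
  by rewrite !mxE (negbTE ij) andbF mulr0.
rewrite /GRing.scale /=; field; exact: h0.
Unshelve. all: by end_near.
Qed.

End Affine.

(** * Barycentric coordinates *)

Section Barycentric.
Context {R : realType} (n : nat) (x : 'I_n -> pt3 R).
Implicit Types (T : {set 'I_n}) (lam : 'I_n -> pt3 R -> R) (y : pt3 R).

(** The coordinates are defined on the whole space, and indexed by all nodes so
    that sums need no enumeration of the vertices of the cell. *)
Definition barycentric T lam : Prop :=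
  [/\ forall i, affine (lam i), forall i y, i \notin T -> lam i y = 0,
      forall y, \sum_i lam i y = 1 & forall y, \sum_i lam i y *: x i = y].

Lemma sum_if_eq (V : nmodType) (J : finType) (k : J -> 'I_n) (z : J -> V) :
  \sum_i \sum_(m | k m == i) z m = \sum_m z m.
Proof.
by rewrite (partition_big k predT) //.
Qed.

(** The matrix X with rows (1, x_k) is invertible by affine independence, and
    the coordinates of y are (1, y) X^-1. *)
Lemma barycentric_exists T : #|T| = 4%N -> affinely_independent x T ->
  exists lam, barycentric T lam.
Proof.
move=> T4 aff.
pose k (m : 'I_4) : 'I_n := enum_val (cast_ord (esym T4) m).
have kT m : k m \in T by exact: enum_valP.
have kI : injective k by move=> a b /enum_val_inj/cast_ord_inj.
pose h y : 'rV[R]_4 := \row_c oapp (fun j => y 0 j) 1 (unlift 0 c).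
pose X : 'M[R]_4 := \matrix_(m, c) h (x (k m)) 0 c.
have hX (v : 'rV[R]_4) c : (v *m X) 0 c = \sum_m v 0 m * h (x (k m)) 0 c.
  by rewrite mxE; apply: eq_bigr => m _; rewrite [X in _ * X]mxE.
have h0 y : h y 0 0 = 1 by rewrite mxE unlift_none.
have h1 y j : h y 0 (lift 0 j) = y 0 j by rewrite mxE liftK.
have wx (z : 'I_4 -> R) : \sum_i (\sum_(m | k m == i) z m) *: x i = \sum_m z m *: x (k m).
  rewrite -[RHS](sum_if_eq k); apply: eq_bigr => i _; rewrite scaler_suml.
  by apply: eq_bigr => m /eqP ->.
have uX : X \in unitmx.
  rewrite -row_free_unit; apply: inj_row_free => v vX.
  pose w i := \sum_(m | k m == i) v 0 m.
  have w0 : forall i, w i = 0.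
    apply: aff => [i iT||].
    - by rewrite /w big1 // => m /eqP e; rewrite -e kT in iT.
    - rewrite /w sum_if_eq.
      transitivity ((v *m X) 0 0); last by rewrite vX mxE.
      by rewrite hX; apply: eq_bigr => m _; rewrite h0 mulr1.
    - rewrite wx; apply/rowP => j.
      transitivity ((v *m X) 0 (lift 0 j)); last by rewrite vX !mxE.
      by rewrite hX summxE; apply: eq_bigr => m _; rewrite h1 mxE.
  apply/rowP => m; rewrite mxE -[RHS](w0 (k m)) /w (big_pred1 m) // => m'.
  by rewrite (inj_eq kI).
pose z y := h y *m invmx X.
have zX y : z y *m X = h y by rewrite mulmxKV.
exists (fun i y => \sum_(m | k m == i) z y 0 m); split.
- move=> i.
  pose v : pt3 R := \row_j \sum_(m | k m == i) invmx X (lift 0 j) m.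
  suff e y : \sum_(m | k m == i) z y 0 m = \sum_(m | k m == i) invmx X 0 m + frob v y.
    by case: (affineP e).
  rewrite frob_row.
  transitivity (\sum_(m | k m == i) invmx X 0 m
     + \sum_j \sum_(m | k m == i) invmx X (lift 0 j) m * y 0 j).
    rewrite exchange_big -big_split; apply: eq_bigr => m _ /=.
    rewrite mxE big_ord_recl h0 mul1r; congr (_ + _).
    by apply: eq_bigr => j _; rewrite h1 mulrC.
  by congr (_ + _); apply: eq_bigr => j _; rewrite mxE mulr_suml.
- by move=> i y iT; rewrite big1 // => m /eqP e; rewrite -e kT in iT.
- move=> y; rewrite sum_if_eq -(h0 y) -zX hX.
  by apply: eq_bigr => m _; rewrite h0 mulr1.
- move=> y; rewrite wx; apply/rowP => j; rewrite -[RHS](h1 y) -zX hX summxE.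
  by apply: eq_bigr => m _; rewrite h1 mxE.
Qed.

Section Coordinates.
Variables (T : {set 'I_n}) (lam : 'I_n -> pt3 R -> R).
Hypothesis aff : affinely_independent x T.
Hypothesis barT : barycentric T lam.

Lemma barycentric_unique (w : 'I_n -> R) : (forall i, i \notin T -> w i = 0) ->
  \sum_i w i = 1 -> forall i, lam i (\sum_j w j *: x j) = w i.
Proof.
case: barT => _ l0 l1 lx w0 w1 i.
set y := \sum_j _.
apply/eqP; rewrite -subr_eq0; apply/eqP.
apply: (aff (w := fun i => lam i y - w i)).
- by move=> j jT; rewrite l0 // w0 // subrr.
- by rewrite sumrB l1 w1 subrr.
- rewrite (eq_bigr (fun j => lam j y *: x j - w j *: x j)).
    by rewrite sumrB lx subrr.
  by move=> j _; rewrite scalerBl.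
Qed.

Lemma barycentric_vertex i j : j \in T -> lam i (x j) = (i == j)%:R.
Proof.
move=> jT.
have -> : x j = \sum_k (k == j)%:R *: x k.
  rewrite (bigD1 j) //= eqxx scale1r big1 ?addr0 // => k /negbTE ->.
  by rewrite scale0r.
rewrite (barycentric_unique (w := fun k => (k == j)%:R)) //.
  by move=> k kT; case: eqP kT jT => // -> /negbTE ->.
by rewrite (bigD1 j) //= eqxx big1 ?addr0 // => k /negbTE ->.
Qed.

Lemma hullP (A : {set 'I_n}) y : A \subset T ->
  hull x A y <-> (forall i, 0 <= lam i y) /\ (forall i, i \notin A -> lam i y = 0).
Proof.
move=> AT; case: barT => _ l0 l1 lx; split.
- case=> w [w0 wA w1 ->].
  have e : forall i, lam i (\sum_j w j *: x j) = w i.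
    by apply: barycentric_unique => // i iT; apply: wA; apply: contra iT => /(fintype.subsetP AT).
  by split => i; rewrite e //; exact: wA.
- by case=> h0 hA; exists (fun i => lam i y); split.
Qed.

Lemma lam_continuous i y : lam i z @[z --> y] --> lam i y.
Proof.
case: barT => la _ _ _.
pose c j (z : pt3 R) : R := slope (lam i) 0 j * z 0 j.
have cc j : c j z @[z --> y] --> c j y.
  have h : (fun z : pt3 R => z 0 j) @ nbhs y --> y 0 j by exact: coord_continuous.
  exact: (cvgMl_tmp h).
rewrite (_ : lam i = fun z => lam i 0 + (c 0 z + c 1 z + c 2 z)); last first.
  by apply/funext => z; rewrite la frob_row sum3.
exact: (cvgD (cvg_cst _) (cvgD (cvgD (cc 0) (cc 1)) (cc 2))).
Qed.

(** If a coordinate vanishes at y, then moving away from the corresponding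
    vertex makes it negative at once, so y is not an interior point. *)
Lemma interior_hull : (hull x T)° =
  [set y | forall i, i \in T -> 0 < lam i y].
Proof.
case: (barT) => la l0 l1 lx; apply/seteqP; split => y.
- move=> yT i iT.
  have [yp _] := (hullP y (subxx T)).1 (interior_subset yT).
  rewrite lt_neqAle yp andbT; apply/negP => /eqP yi.
  pose g (t : R) := y + t *: (y - x i).
  have gc : g t @[t --> 0] --> y.
    have -> : y = g 0 by rewrite /g scale0r addr0.
    apply: cvgD; first exact: cvg_cst.
    by apply: cvgZl; exact: cvg_id.
  have : \forall t \near (0:R), hull x T (g t) by exact: gc.
  move=> /nbhs_ballP[e /= e0 he].
  have /he : ball (0:R) e (e / 2).
    by rewrite /ball /= sub0r normrN gtr0_norm; [rewrite gtr_pMr // invf_lt1 // ltr1n|rewrite divr_gt0].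
  move=> /(hullP _ (subxx T)) [/(_ i) + _].
  rewrite /g la frobDr frobZr frobDr frobNr addrA.
  have := la i y; rewrite -yi => e1.
  have := la i (x i); rewrite barycentric_vertex // eqxx mulr1n => e2.
  have : 0 < e / 2 by rewrite divr_gt0.
  have pq : frob (slope (lam i)) y - frob (slope (lam i)) (x i) = - 1 by lra.
  by rewrite pq -e1 mulrN1 add0r => e20 h; lra.
- move: (y : pt3 R) => {}y yp.
  have near_pos i : \forall z \near y, i \in T -> 0 < lam i z.
    have [iT|_] := boolP (i \in T); last by near=> z.
    have h : \forall z \near nbhs y, 0 < lam i z.
      exact: (cvgr_gt _ (@lam_continuous i y) _ (yp i iT)).
    by near=> z => _; near: z.
  have fF : Filter (nbhs y) by exact: nbhs_filter.
  have all_pos : \forall z \near nbhs y, forall i, i \in T -> 0 < lam i z.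
    exact: filter_forall.
  suff : nbhs y (hull x T) by [].
  refine (@filterS _ _ fF _ _ _ all_pos) => z zp.
  apply/hullP => //; split => i; last exact: l0.
  by have [iT|iT] := boolP (i \in T); [exact/ltW/zp|rewrite l0].
Unshelve. all: by end_near.
Qed.

End Coordinates.
End Barycentric.

(** * Faces of a simplex *)

Section Cross.
Context {R : realType}.
Implicit Types u v : pt3 R.

Lemma ord3_add : ((0 + 1 = 1 :> 'I_3)%R * (0 + 2 = 2 :> 'I_3)%R *
  (1 + 1 = 2 :> 'I_3)%R * (1 + 2 = 0 :> 'I_3)%R * (2 + 1 = 0 :> 'I_3)%R *
  (2 + 2 = 1 :> 'I_3)%R)%type.
Proof. by do !split; apply: val_inj. Qed.

Lemma crossE u v :
  [/\ cross u v 0 0 = u 0 1 * v 0 2 - u 0 2 * v 0 1,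
      cross u v 0 1 = u 0 2 * v 0 0 - u 0 0 * v 0 2 &
      cross u v 0 2 = u 0 0 * v 0 1 - u 0 1 * v 0 0].
Proof. by rewrite !mxE !ord3_add. Qed.

Lemma frob_crossl u v : frob (cross u v) u = 0.
Proof. by rewrite frob_row sum3; have [-> -> ->] := crossE u v; ring. Qed.

Lemma frob_crossr u v : frob (cross u v) v = 0.
Proof. by rewrite frob_row sum3; have [-> -> ->] := crossE u v; ring. Qed.

End Cross.

Section Flags.
Context {R : realType} (n : nat) (x : 'I_n -> pt3 R).
Implicit Types (T F : {set 'I_n}).

(** The vertices of a face in the order in which the parametrization behind
    [face_integral] lists them. *)
Definition fnode F (m : 'I_3) : pt3 R := [seq x i | i <- enum F]`_m.

Lemma face_enum F : #|F| = 3%N -> exists k : 'I_3 -> 'I_n,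
  [/\ injective k, forall i, i \in F -> exists m, i = k m,
      forall m, k m \in F, forall m, fnode F m = x (k m) &
      forall (V : nmodType) (f : 'I_n -> V), \sum_(i in F) f i = \sum_m f (k m)].
Proof.
move=> F3.
pose k m := enum_val (cast_ord (esym F3) m).
exists k; split.
- by move=> a b /enum_val_inj/cast_ord_inj.
- move=> i iF; exists (cast_ord F3 (enum_rank_in iF i)).
  by rewrite /k cast_ordK enum_rankK_in.
- by move=> m; exact: enum_valP.
- move=> m; rewrite /fnode /k.
  have i0 : 'I_n by exact: (k 0).
  rewrite (nth_map i0); last by rewrite -cardE F3.
  by rewrite (enum_val_nth i0).
- move=> V f; rewrite (reindex_onto k (fun i => odflt 0 [pick m | k m == i])) /=.
    apply: eq_bigl => m; rewrite enum_valP /=.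
    case: pickP => [m' /eqP /enum_val_inj/cast_ord_inj -> |/(_ m)]; last by rewrite eqxx.
    by rewrite eqxx.
  move=> i iF; case: pickP => [m /eqP //|/(_ (cast_ord F3 (enum_rank_in iF i)))].
  by rewrite /k cast_ordK enum_rankK_in // eqxx.
Qed.

Variables (T F : {set 'I_n}) (i : 'I_n) (lam : 'I_n -> pt3 R -> R).
Hypotheses (F3 : #|F| = 3%N) (iF : i \notin F) (TF : T = (i |: F)%SET).
Hypothesis aff : affinely_independent x T.
Hypothesis barT : barycentric x T lam.

Let a := fnode F.
Definition face_cross : pt3 R := cross (fnode F 1 - fnode F 0) (fnode F 2 - fnode F 0).
Definition apex_det : R := frob face_cross (x i - fnode F 0).

Let edges : 'M[R]_3 :=
  \matrix_(r, c) [:: a 1 - a 0; a 2 - a 0; x i - a 0]`_r 0 c.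

Let det_edges : \det edges = apex_det.
Proof.
rewrite det33 /apex_det frob_row sum3 /face_cross.
by have [-> -> ->] := crossE (a 1 - a 0) (a 2 - a 0); rewrite !mxE /=; ring.
Qed.

Lemma slope_sub j y z : frob (y - z) (slope (lam j)) = lam j y - lam j z.
Proof.
case: barT => la _ _ _.
by rewrite la [lam j z]la frobC frobDr frobNr; ring.
Qed.

Lemma edges_slopes : exists k : 'I_3 -> 'I_n,
  [/\ injective k, forall m, k m \in F, forall i, i \in F -> exists m, i = k m,
   forall m, a m = x (k m) /\
     forall (V : nmodType) (f : 'I_n -> V), \sum_(i in F) f i = \sum_m f (k m) &
   edges *m (\matrix_(c, r) [:: slope (lam (k 1)); slope (lam (k 2)); slope (lam i)]`_r 0 c)
    = 1%:M].
Proof.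
have [k [kI Fk kF ak sF]] := face_enum F3.
exists k; split => //.
have iT : i \in T by rewrite TF setU11.
have kT m : k m \in T by rewrite TF setU1r.
have ik m : (k m == i) = false.
  by apply/negbTE; apply: contraNneq iF => <-.
have ki m : (i == k m) = false by rewrite eq_sym ik.
have lx j l : l \in T -> lam j (x l) = (j == l)%:R.
  by move=> lT; rewrite (barycentric_vertex aff barT).
have e0 m1 m2 : (k m1 == k m2) = (m1 == m2) by rewrite (inj_eq kI).
apply/matrixP => r c; rewrite mxE.
transitivity (frob ([:: a 1 - a 0; a 2 - a 0; x i - a 0]`_r)
   ([:: slope (lam (k 1)); slope (lam (k 2)); slope (lam i)]`_c)).
  by rewrite frob_row; apply: eq_bigr => j _; rewrite !mxE.
rewrite [RHS]mxE /a !ak.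
move: r c; apply: ord3; apply: ord3 => /=;
  rewrite slope_sub !lx // ?e0 ?ik ?ki ?eqxx ?subr0 //=.
Qed.

Let unit_edges : edges \in unitmx.
Proof. by have [k [_ _ _ _ /mulmx1_unit[]]] := edges_slopes. Qed.

Lemma apex_det_neq0 : apex_det != 0.
Proof. by have := unit_edges; rewrite unitmxE unitfE det_edges. Qed.

Lemma edges_inj (v : pt3 R) : frob v (a 1 - a 0) = 0 -> frob v (a 2 - a 0) = 0 ->
  frob v (x i - a 0) = 0 -> v = 0.
Proof.
move=> h1 h2 h3.
suff e : edges *m v^T = 0.
  by apply: trmx_inj; rewrite trmx0 -[LHS](mulKmx unit_edges) e mulmx0.
apply/matrixP => r c; rewrite mxE [RHS]mxE (ord1 c).
transitivity (frob v ([:: a 1 - a 0; a 2 - a 0; x i - a 0]`_r)).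
  by rewrite frob_row; apply: eq_bigr => j _; rewrite !mxE mulrC.
by move: r; apply: ord3.
Qed.

(** The columns of the inverse edge matrix are the gradients of the
    barycentric coordinates, which turns one description into the other. *)
Lemma interior_open_simplex : (hull x T)° = open_simplex (a 0) edges.
Proof.
have [k [kI kF Fk ak eB]] := edges_slopes.
have [la l0 l1 _] := barT.
have iV : invmx edges = \matrix_(c, r) [:: slope (lam (k 1)); slope (lam (k 2)); slope (lam i)]`_r 0 c.
  by rewrite -[RHS]mul1mx -(mulVmx unit_edges) -mulmxA eB mulmx1.
have kT m : k m \in T by rewrite TF setU1r.
have iT : i \in T by rewrite TF setU11.
have ik m : (k m == i) = false.
  by apply/negbTE; apply: contraNneq iF => <-.
have ki m : (i == k m) = false by rewrite eq_sym ik.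
pose q (r : 'I_3) := if r == 2 then i else k (r + 1).
have coord y r : ((y - a 0) *m invmx edges) 0 r = lam (q r) y.
  rewrite iV mxE.
  transitivity (frob (y - a 0)
      ([:: slope (lam (k 1)); slope (lam (k 2)); slope (lam i)]`_r)).
    by rewrite frob_row; apply: eq_bigr => j _; rewrite !mxE.
  have lk j : j != k 0 -> frob (y - a 0) (slope (lam j)) = lam j y.
    move=> jk; rewrite slope_sub (ak _).1 (barycentric_vertex aff barT) //.
    by rewrite (negbTE jk) subr0.
  by move: r; apply: ord3; rewrite /q /= ?ord3_add; apply: lk;
    rewrite ?(inj_eq kI) ?ki.
have sumT y : lam i y + (lam (k 0) y + lam (k 1) y + lam (k 2) y) = 1.
  rewrite -(sum3 (fun m => lam (k m) y)) -((ak 0).2 _ (fun j => lam j y)) -[RHS](l1 y).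
  rewrite [RHS](bigID (mem T)) /= [X in _ = _ + X]big1 ?addr0.
    by rewrite TF big_setU1.
  by move=> j jT; rewrite l0.
rewrite (interior_hull aff barT); apply/seteqP; split => y /=.
  move=> h; rewrite /open_simplex /= /reference_simplex /=.
  rewrite !coord /q /=; split; [exact: h|exact: h|exact: h|].
  have := sumT y; have := h _ (kT 0).
  rewrite !ord3_add.
  by move=> h1 h2; lra.
rewrite /open_simplex /= /reference_simplex /= !coord /q /=.
rewrite !ord3_add => -[h1 h2 h3 h4] j.
rewrite TF => /setU1P[->//|/Fk[m ->]].
move: m; apply: ord3 => //.
by have := sumT y; lra.
Qed.

Lemma flag_volume :
  measurable (to_pt3 @^-1` (hull x T)° : set (measurableTypeR R * measurableTypeR R * measurableTypeR R)) /\
  leb3 (to_pt3 @^-1` (hull x T)°) = (`|apex_det| * reference_volume)%:E.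
Proof.
rewrite interior_open_simplex -det_edges; apply: open_simplex_volume.
exact: unit_edges.
Qed.

Variable nu : pt3 R.
Hypothesis nu1 : enorm nu = 1.
Hypothesis nuF : forall j k, j \in F -> k \in F -> frob nu (x j - x k) = 0.

(** [outward_normal] in terms of vertex sets alone. *)
Definition away (T' F' : {set 'I_n}) : pt3 R :=
  if frob nu ((#|T'|%:R)^-1 *: (\sum_(i in T') x i) - (#|F'|%:R)^-1 *: (\sum_(i in F') x i)) < 0
  then nu else - nu.

Let nn : frob nu nu = 1.
Proof. exact: frob_unit. Qed.

Let nua m : frob nu (a m - a 0) = 0.
Proof.
by have [k [_ _ kF ak _]] := face_enum F3; rewrite /a !ak nuF.
Qed.

Let s := frob nu (x i - a 0).

Lemma height_neq0 : s != 0.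
Proof.
apply/eqP => s0; have n0 := edges_inj (nua 1) (nua 2) s0.
by move: nn; rewrite n0 frob0l => /eqP; rewrite eq_sym oner_eq0.
Qed.

Lemma awayE : away T F = if s < 0 then nu else - nu.
Proof.
have [k [_ _ _ ak sF]] := face_enum F3.
rewrite /away; suff -> : frob nu ((#|T|%:R)^-1 *: (\sum_(i in T) x i)
    - (#|F|%:R)^-1 *: (\sum_(i in F) x i)) = s / 4.
  by rewrite pmulr_llt0 // invr_gt0.
rewrite TF cardsU1 iF F3 big_setU1 //= sF sum3 -!ak.
have n1 := nua 1; have n2 := nua 2; move: n1 n2; rewrite /s.
rewrite /a !(frobDr, frobNr, frobZr) => n1 n2.
have -> : frob nu (fnode F 1) = frob nu (fnode F 0) by lra.
have -> : frob nu (fnode F 2) = frob nu (fnode F 0) by lra.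
by rewrite /= add1n; field.
Qed.

Lemma slope_apexE : slope (lam i) = s^-1 *: nu.
Proof.
have [k [kI kF Fk ak _]] := edges_slopes.
have iT : i \in T by rewrite TF setU11.
have kT m : k m \in T by rewrite TF setU1r.
have ki m : (i == k m) = false.
  by apply/negbTE; apply: contraNneq iF => ->.
have lk m : frob (slope (lam i)) (a m - a 0) = 0.
  by rewrite frobC slope_sub !(ak _).1 !(barycentric_vertex aff barT) // !ki subrr.
have li : frob (slope (lam i)) (x i - a 0) = 1.
  by rewrite frobC slope_sub (ak _).1 !(barycentric_vertex aff barT) // ki eqxx subr0.
apply/eqP; rewrite -subr_eq0; apply/eqP; apply: edges_inj.
- by rewrite frobDl frobNl frobZl lk nua mulr0 subr0.
- by rewrite frobDl frobNl frobZl lk nua mulr0 subr0.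
- by rewrite frobDl frobNl frobZl li -/s mulVf ?height_neq0 // subrr.
Qed.

(** The gradient of the coordinate of the apex is nu / s with s the signed
    height of the cell over F, and the volume is reference_volume * |s| times
    the length of the cross product of the edges of F.  Hence the product of
    volume and gradient sees the cell only through the side of F on which it
    lies; this is what makes face terms of adjacent cells comparable. *)
Lemma volume_slope_apex :
  (`|apex_det| * reference_volume) *: slope (lam i) =
  - ((reference_volume * enorm face_cross) *: away T F).
Proof.
have s0 := height_neq0.
have cE : face_cross = (apex_det / s) *: nu.
  apply/eqP; rewrite -subr_eq0; apply/eqP; apply: edges_inj.
  - by rewrite frobDl frobNl frobZl nua /face_cross frob_crossl mulr0 subr0.
  - by rewrite frobDl frobNl frobZl nua /face_cross frob_crossr mulr0 subr0.
  - by rewrite frobDl frobNl frobZl -/s -/apex_det divfK // subrr.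
have ce : enorm face_cross = `|apex_det| / `|s|.
  by rewrite cE /enorm frobZl frobZr nn mulr1 -expr2 sqrtr_sqr normrM normfV.
rewrite slope_apexE awayE ce scalerA.
case: ltrP => sl.
  rewrite (ltr0_norm sl) -scaleNr; congr (_ *: _); field; exact: s0.
have sn : 0 < s by rewrite lt_neqAle eq_sym s0.
rewrite (gtr0_norm sn) scalerN opprK; congr (_ *: _); field; exact: s0.
Qed.

Lemma face_cross_gt0 : 0 < enorm face_cross.
Proof.
rewrite lt_neqAle sqrtr_ge0 andbT eq_sym.
apply/eqP => /(congr1 (fun z => z ^+ 2)); rewrite sqr_sqrtr ?frob_ge0 // expr0n /=.
by move/frob_eq0 => c0; move: apex_det_neq0; rewrite /apex_det c0 frob0l eqxx.
Qed.

End Flags.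

Section TwoFlags.
Context {R : realType} (n : nat) (x : 'I_n -> pt3 R).
Variables (T1 T2 F : {set 'I_n}) (i1 i2 : 'I_n) (lam : 'I_n -> pt3 R -> R).
Hypotheses (F3 : #|F| = 3%N) (i1F : i1 \notin F) (i2F : i2 \notin F).
Hypotheses (T1F : T1 = (i1 |: F)%SET) (T2F : T2 = (i2 |: F)%SET).
Hypotheses (aff1 : affinely_independent x T1) (aff2 : affinely_independent x T2).
Hypothesis barT : barycentric x T1 lam.
Hypothesis T12 : T1 != T2.
Hypothesis hullI : hull x T1 `&` hull x T2 = hull x (T1 :&: T2)%SET.
Variable nu : pt3 R.
Hypothesis nu1 : enorm nu = 1.
Hypothesis nuF : forall j k, j \in F -> k \in F -> frob nu (x j - x k) = 0.

(** If both cells lay on the same side of F, the points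
    y = (1 - e) m + e x_i2, with m the barycenter of F and e small, would belong
    to both cells: their coordinates in T1 at the vertices of F are close to
    1/3, and the one at i1 is e t2 / t1 > 0.  But the cells meet in F only. *)
Lemma away_opposite : away x nu T1 F = - away x nu T2 F.
Proof.
have [lam2 bar2] : exists l, barycentric x T2 l.
  by apply: barycentric_exists => //; rewrite T2F cardsU1 i2F F3.
have s1 := height_neq0 F3 i1F T1F aff1 barT nu1 nuF.
have s2 := height_neq0 F3 i2F T2F aff2 bar2 nu1 nuF.
rewrite (awayE F3 i1F T1F nuF) (awayE F3 i2F T2F nuF).
set t1 := frob nu (x i1 - _) in s1 *; set t2 := frob nu (x i2 - _) in s2 *.
suff : ~ (0 < t2 / t1).
  case: (ltrP t1 0) => h1; case: (ltrP t2 0) => h2; rewrite ?opprK // => -[].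
    by rewrite nmulr_rgt0 // invr_lt0.
  by rewrite divr_gt0 // lt_neqAle eq_sym ?s1 ?s2.
move=> tpos.
have [k [kI kF Fk ak sF]] := face_enum x F3.
have i1T : i1 \in T1 by rewrite T1F setU11.
have kT m : k m \in T1 by rewrite T1F setU1r.
have G := slope_apexE F3 i1F T1F aff1 barT nu1 nuF.
have l2 : lam i1 (x i2) = t2 / t1.
  have := slope_sub barT i1 (x i2) (fnode x F 0).
  rewrite G frobZr [frob (_ - _) nu]frobC -/t1 -/t2 mulrC ak (barycentric_vertex aff1 barT i1 (kT 0)).
  rewrite (_ : (i1 == k 0) = false) ?subr0 => [-> //|].
  by apply/negbTE; apply: contraNneq i1F => ->.
(* e is so small that e |lam j (x i2) - 1/3| <= 1/3 for all j in F *)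
pose K := \sum_(j in F) `|lam j (x i2) - 3^-1|.
have K0 : 0 <= K by apply: sumr_ge0.
pose e := (3 * (K + 1))^-1.
have e0 : 0 < e by rewrite invr_gt0 mulr_gt0 // ltr_wpDl.
have e1 : e * (3 * (K + 1)) = 1 by rewrite mulVf // gt_eqF // mulr_gt0 // ltr_wpDl.
pose w j : R := if j == i2 then e else if j \in F then (1 - e) / 3 else 0.
have w1 : \sum_j w j = 1.
  rewrite (bigD1 i2) //= {1}/w eqxx (eq_bigr (fun j => if j \in F then (1 - e) / 3 else 0)).
    rewrite -big_mkcondr /= (eq_bigl (mem F)).
      by rewrite sF sum3; field.
    by move=> j /=; case: eqP => // ->; rewrite (negbTE i2F).
  by move=> j /negbTE ji; rewrite /w ji.
have lw j : lam j (\sum_l w l *: x l) = \sum_l w l * lam j (x l).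
  by have [la _ _ _] := barT; apply: affine_combination.
have lwE j : lam j (\sum_l w l *: x l)
    = e * lam j (x i2) + (1 - e) / 3 * (j \in F)%:R.
  rewrite lw (bigD1 i2) //= {1}/w eqxx; congr (_ + _).
  rewrite (eq_bigr (fun l => if l \in F then (1 - e) / 3 * (j == l)%:R else 0)); last first.
    move=> l /negbTE li; rewrite /w li; case: ifP => lF; last by rewrite mul0r.
    by rewrite (barycentric_vertex aff1 barT) // T1F setU1r.
  rewrite -big_mkcondr /= (eq_bigl (mem F)); last first.
    by move=> l /=; case: eqP => // ->; rewrite (negbTE i2F).
  rewrite -mulr_sumr; congr (_ * _).
  have [jF|jF] := boolP (j \in F).
    by rewrite (bigD1 j) //= eqxx big1 ?addr0 // => l /andP[_ /negbTE]; rewrite eq_sym => ->.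
  by rewrite big1 // => l lF; rewrite (_ : (j == l) = false) //; apply: contraNF jF => /eqP ->.
have e3 : e <= 1 by nra.
set y := \sum_l w l *: x l in lw lwE.
have yI : (hull x T1 `&` hull x T2) y.
  split.
    apply/(hullP aff1 barT y (fintype.subxx T1)); split => j; last first.
      by have [_ l0 _ _] := barT => /l0 ->.
    have [jT|jT] := boolP (j \in T1); last by have [_ l0 _ _] := barT; rewrite l0.
    rewrite lwE; move: jT; rewrite T1F => /setU1P[->|jF].
      by rewrite l2 (negbTE i1F) mulr0 addr0 ltW // mulr_gt0.
    rewrite jF mulr1.
    have : `|lam j (x i2) - 3^-1| <= K.
      by rewrite /K (bigD1 j) //= lerDl sumr_ge0.
    by rewrite ler_norml => /andP[h _]; nra.
  exists w; split => //.
  - move=> j; rewrite /w; case: ifP => // _; first exact: ltW.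
    by case: ifP => // _; rewrite divr_ge0 // subr_ge0.
  - move=> j; rewrite T2F !inE negb_or => /andP[/negbTE j2 /negbTE jF].
    by rewrite /w j2 jF.
move: yI; rewrite hullI => /(hullP aff1 barT y (subsetIl T1 T2)) [_ /(_ i1)].
rewrite inE i1T /= T2F !inE (negbTE i1F) orbF lwE l2 (negbTE i1F) mulr0 addr0.
have -> : (i1 == i2) = false.
  by apply: contraNF T12 => /eqP ii; rewrite T1F T2F ii.
move=> /(_ isT) /eqP; rewrite mulf_eq0 => /orP[] /eqP h; lra.
Qed.

End TwoFlags.

(** * Integrals over faces *)

Section FaceIntegrals.
Context {R : realType} (M : mesh R).
Implicit Types (F : {set 'I_(nvert M)}) (u v : pt3 R -> R).

Notation area2 F := (enorm (face_cross (@node R M) F)).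

Let param F (y : R * R) : pt3 R :=
  fnode (@node R M) F 0 + y.1 *: (fnode (@node R M) F 1 - fnode (@node R M) F 0)
  + y.2 *: (fnode (@node R M) F 2 - fnode (@node R M) F 0).

Let affine_param F u y : affine u ->
  u (param F y) = affine2 (fun m => u (fnode (@node R M) F m)) y.
Proof.
move=> hu; rewrite /affine2 /param !(hu (fnode _ _ _)) hu.
by rewrite !(frobDr, frobZr, frobNr); ring.
Qed.

Lemma face_integralE F f : face_integral F f =
  area2 F * \int[@leb2 R]_(y in unit_triangle) f (param F y).
Proof. by []. Qed.

(** The L2 product on a triangle of the affine functions with given vertex
    values, divided by twice the area. *)
Definition face_form (f g : 'I_3 -> R) : R :=
  (\sum_i f i * g i + (\sum_i f i) * (\sum_i g i)) / 24.

Lemma face_integral_sum F (J : finType) (u v : J -> pt3 R -> R) :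
  (forall j, affine (u j)) -> (forall j, affine (v j)) ->
  face_integral F (fun x => \sum_j u j x * v j x) =
  area2 F * \sum_j face_form (fun m => u j (fnode (@node R M) F m))
                             (fun m => v j (fnode (@node R M) F m)).
Proof.
move=> hu hv; rewrite face_integralE; congr (_ * _).
pose f j y := u j (param F y) * v j (param F y).
have fi j : (@leb2 R).-integrable unit_triangle (EFin \o f j).
  rewrite (_ : f j = fun y => affine2 (fun m => u j (fnode (@node R M) F m)) y *
      affine2 (fun m => v j (fnode (@node R M) F m)) y).
    exact: integrable_affine2_mul.
  by apply/funext => y; rewrite /f !affine_param.
transitivity (\int[@leb2 R]_(y in unit_triangle) (\sum_j 1 * f j y)).
  by apply: eq_Rintegral => y _; apply: eq_bigr => j _; rewrite mul1r.
rewrite Rintegral_lincomb //; last exact: measurable_unit_triangle.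
apply: eq_bigr => j _; rewrite mul1r /face_form -Rintegral_affine2_mul.
by apply: eq_Rintegral => y _; rewrite /f !affine_param.
Qed.

Lemma face_integral_mul F u v : affine u -> affine v ->
  face_integral F (fun x => u x * v x) =
  area2 F * face_form (fun m => u (fnode (@node R M) F m))
                      (fun m => v (fnode (@node R M) F m)).
Proof.
move=> hu hv.
have := @face_integral_sum F 'I_1 (fun=> u) (fun=> v) (fun=> hu) (fun=> hv).
rewrite big_ord1 => <-; congr face_integral.
by apply/funext => y; rewrite big_ord1.
Qed.

Definition face_mean F u : R := (\sum_m u (fnode (@node R M) F m)) / 3.

(** The defining equation of Q0 F u at c reduces to d (mean of u - c) = 0 for
    all d, so c is unique and the choice in Q0 is determined. *)
Lemma Q0_affine F u : 0 < area2 F -> affine u -> Q0 F u = face_mean F u.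
Proof.
move=> aF hu; rewrite /Q0.
have -> : [set c | forall d : R, face_integral F (fun x => (u x - c) * d) = 0]
    = [set face_mean F u].
  have e c d : face_integral F (fun x => (u x - c) * d)
      = area2 F * (d * (3 * (face_mean F u - c)) / 6).
    have [h1 _] := @affineD R u (fun=> - c) 1 hu (affine_cst _).
    have -> : (fun x => (u x - c) * d) = (fun x => (1 * u x + - c) * (fun=> d) x).
      by apply/funext => x; rewrite mul1r.
    rewrite face_integral_mul //; last exact: (affine_cst _).
    by congr (_ * _); rewrite /face_form /face_mean !sum3; field.
  apply/seteqP; split => c /=.
    move=> /(_ 1); rewrite e => /eqP; rewrite mulf_eq0 gt_eqF //= => /eqP; lra.
  by move=> -> d; rewrite e subrr !(mulr0, mul0r).
by case: xgetP => // /(_ (face_mean F u)) /(_ erefl).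
Qed.

Lemma face_form_ge0 (f : 'I_3 -> R) : 0 <= face_form f f.
Proof.
rewrite /face_form divr_ge0 // addr_ge0 //.
  by apply: sumr_ge0 => i _; rewrite -expr2 sqr_ge0.
by rewrite -expr2 sqr_ge0.
Qed.

(** The form is a sum of squares with positive weights. *)
Lemma face_form_eq0 (f : 'I_3 -> R) : face_form f f = 0 -> forall m, f m = 0.
Proof.
rewrite /face_form !sum3 => h.
have h0 : 0 <= f 0 * f 0 by rewrite -expr2 sqr_ge0.
have h1 : 0 <= f 1 * f 1 by rewrite -expr2 sqr_ge0.
have h2 : 0 <= f 2 * f 2 by rewrite -expr2 sqr_ge0.
have h3 : 0 <= (f 0 + f 1 + f 2) * (f 0 + f 1 + f 2) by rewrite -expr2 sqr_ge0.
have z t : t * t = 0 :> R -> t = 0 by move=> /eqP; rewrite mulf_eq0 orbb => /eqP.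
by apply: ord3; apply: z; lra.
Qed.

Lemma face_formDl (f g h : 'I_3 -> R) (c : R) :
  face_form (fun m => c * f m + g m) h = c * face_form f h + face_form g h.
Proof. by rewrite /face_form !sum3; ring. Qed.

Lemma face_formC (f g : 'I_3 -> R) : face_form f g = face_form g f.
Proof. by rewrite /face_form !sum3; ring. Qed.

End FaceIntegrals.

(** * Finite-dimensional linear systems *)

Section Galerkin.
Context {R : realType} (V : lmodType R) (W : set V) (N : nat).
Variables (D : V -> 'rV[R]_N) (B : V -> V -> R) (L : V -> R).
Hypothesis W0 : W 0.
Hypothesis Wlin : forall a u v, W u -> W v -> W (a *: u + v).
Hypothesis Dlin : forall a u v, D (a *: u + v) = a *: D u + D v.
Hypothesis Dinj : forall u, W u -> D u = 0 -> u = 0.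
Hypothesis Bl : forall a u v w, W u -> W v -> W w -> B (a *: u + v) w = a * B u w + B v w.
Hypothesis Br : forall a u v w, W u -> W v -> W w -> B w (a *: u + v) = a * B w u + B w v.
Hypothesis Ll : forall a u v, W u -> W v -> L (a *: u + v) = a * L u + L v.
Hypothesis nondeg : forall u, W u -> (forall v, W v -> B u v = 0) -> u = 0.

Let Wsum (I : Type) (s : seq I) (c : I -> R) (e : I -> V) :
  (forall i, W (e i)) -> W (\sum_(i <- s) c i *: e i).
Proof.
move=> We; elim: s => [|i s IH]; first by rewrite big_nil.
by rewrite big_cons; exact: Wlin.
Qed.

Let sum_lin (f : V -> R) (I : Type) (s : seq I) (c : I -> R) (e : I -> V) :
  (forall a u v, W u -> W v -> f (a *: u + v) = a * f u + f v) ->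
  (forall i, W (e i)) ->
  f (\sum_(i <- s) c i *: e i) = \sum_(i <- s) c i * f (e i).
Proof.
move=> fl We; elim: s => [|i s IH].
  rewrite !big_nil; have := fl 1 0 0 W0 W0; rewrite scaler0 addr0 mul1r; lra.
by rewrite !big_cons fl ?IH //; exact: Wsum.
Qed.

Let D0 : D 0 = 0.
Proof.
have := Dlin (-1) 0 0; rewrite scaler0 addr0 scaleN1r addNr => ->//.
Qed.

Let Dsum (I : Type) (s : seq I) (c : I -> R) (e : I -> V) :
  D (\sum_(i <- s) c i *: e i) = \sum_(i <- s) c i *: D (e i).
Proof.
elim: s => [|i s IH]; first by rewrite !big_nil.
by rewrite !big_cons Dlin IH.
Qed.

(* maximal rank of the matrix of images under D gives the basis *)
Let finite_basis : exists k (e : 'I_k -> V), [/\ forall i, W (e i),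
  row_free (\matrix_(i < k) D (e i)) &
  forall w, W w -> exists c : 'I_k -> R, w = \sum_i c i *: e i].
Proof.
pose P k := `[< exists e : 'I_k -> V, (forall i, W (e i)) /\ row_free (\matrix_(i < k) D (e i)) >].
have P0 : exists k, P k.
  exists 0%N; apply/asboolP; exists (fun=> 0); split => //.
  by apply/row_freeP; exists 0; apply/matrixP => -[].
have Pb k : P k -> (k <= N)%N.
  by move=> /asboolP[e [_ /eqP <-]]; exact: rank_leq_col.
case: (ex_maxnP P0 Pb) => k /asboolP[e [We free]] kmax.
exists k, e; split => // w Ww.
set K := \matrix_(i < k) D (e i) in free.
have wK : (D w <= K)%MS.
  apply/negPn/negP => nwK.
  have /kmax : P (1 + k)%N.
    apply/asboolP; exists (fun i : 'I_(1 + k) => match fintype.split i with inl _ => w | inr j => e j end).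
    split; first by move=> i; case: fintype.split.
    have -> : \matrix_(i < 1 + k) D (match fintype.split i with inl _ => w | inr j => e j end)
        = col_mx (D w) K.
      apply/matrixP => i j; rewrite !mxE; case: fintype.split => m; last by rewrite mxE.
      by rewrite ord1.
    rewrite /row_free eqn_leq rank_leq_row /=.
    apply: (@leq_ltn_trans (\rank K)); first by rewrite (eqP free).
    apply: rank_ltmx; rewrite ltmxE col_mx_sub (negbTE nwK) andbT.
    by rewrite -addsmxE addsmxSr.
  by rewrite ltnn.
have [c cE] := submxP wK.
exists (c 0); apply/eqP; rewrite -subr_eq0; apply/eqP; apply: Dinj.
  rewrite -scaleN1r addrC; apply: Wlin => //.
  exact: Wsum.
rewrite -scaleN1r addrC Dlin Dsum scaleN1r cE addrC.
rewrite mulmx_sum_row (eq_bigr (fun i => c 0 i *: D (e i))) ?subrr // => i _.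
by rewrite rowK.
Qed.

(** A square linear system with trivial kernel is solvable.  The space W is
    only given as a set of functions; the injective linear map D into R^N bounds
    the number of independent elements, so that a maximal independent family
    exists and is a basis, and on a basis the form B becomes an invertible
    matrix. *)
Lemma galerkin : exists2 u, W u & forall v, W v -> B u v = L v.
Proof.
have [k [e [We free span]]] := finite_basis.
pose G : 'M[R]_k := \matrix_(i, j) B (e i) (e j).
have GE (c : 'rV[R]_k) j : (c *m G) 0 j = B (\sum_i c 0 i *: e i) (e j).
  rewrite mxE (sum_lin (f := B^~ (e j))) //; last by move=> *; exact: Bl.
  by apply: eq_bigr => i _; rewrite mxE.
have uG : G \in unitmx.
  rewrite -row_free_unit; apply: inj_row_free => c cG.
  have z : \sum_i c 0 i *: e i = 0.
    apply: nondeg; first exact: Wsum.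
    move=> v /span[d ->].
    rewrite (sum_lin (f := B _)) //; last by move=> *; apply: Br => //; exact: Wsum.
    by rewrite big1 // => j _; rewrite -GE cG mxE mulr0.
  have := congr1 D z; rewrite D0 Dsum => cD.
  apply: (row_free_inj free); rewrite mul0mx -cD mulmx_sum_row.
  by apply: eq_bigr => i _; rewrite rowK.
pose c := (\row_j L (e j)) *m invmx G.
exists (\sum_i c 0 i *: e i); first exact: Wsum.
move=> v /span[d ->].
rewrite (sum_lin (f := B _)) //; last by move=> *; apply: Br => //; exact: Wsum.
rewrite (sum_lin (f := L)) //; apply: eq_bigr => j _.
by rewrite -GE mulmxKV // mxE.
Qed.

End Galerkin.

(** * Geometry of the mesh and the face basis *)

Section MeshGeometry.
Context {R : realType} (Omega : set (pt3 R)) (M : mesh R).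
Hypothesis hM : is_mesh Omega M.
Implicit Types (T : cell M) (F : {set 'I_(nvert M)}).

Lemma cell_card T : #|val T| = 4%N.
Proof. by case: hM => _ h _ _; have [] := h _ (valP T). Qed.

Lemma cell_affine T : affinely_independent (@node R M) (val T).
Proof. by case: hM => _ h _ _; have [] := h _ (valP T). Qed.
Arguments cell_affine T : clear implicits.

(** One choice of barycentric coordinates for each cell, fixed once for all
    statements about the mesh. *)
Definition barycentric_family (lam : cell M -> 'I_(nvert M) -> pt3 R -> R) :=
  forall T, barycentric (@node R M) (val T) (lam T).

Lemma barycentric_family_exists : exists lam, barycentric_family lam.
Proof.
have ex T := barycentric_exists (cell_card T) (cell_affine T).
by exists (fun T => projT1 (cid (ex T))) => T; exact: (projT2 (cid (ex T))).
Qed.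

Lemma cells_hullI T T' :
  elem T `&` elem T' = hull (@node R M) (val T :&: val T')%SET.
Proof. by case: hM => _ _ h _; apply: h; exact: valP. Qed.

Lemma face_card F : F \in faces M -> #|F| = 3%N.
Proof. by rewrite inE => /andP[/eqP]. Qed.

Lemma face_cell F : F \in faces M -> exists T, F \subset val T.
Proof.
rewrite inE => /andP[_ /existsP[T /andP[cT FT]]].
by exists (exist _ T cT).
Qed.

Lemma faceP F T : F \in faces M -> F \subset val T ->
  exists i, [/\ i \notin F, val T = (i |: F)%SET & (val T :\: F)%SET = [set i]%SET].
Proof.
move=> /face_card F3 FT.
have /eqP/cards1P[i e] : #|(val T :\: F)%SET| = 1%N.
  by rewrite cardsD (finset.setIidPr FT) cell_card F3.
exists i; have : i \in (val T :\: F)%SET by rewrite e finset.set11.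
rewrite inE => /andP[iF iT]; split => //.
by rewrite -(finset.setID (val T) F) (finset.setIidPr FT) e finset.setUC.
Qed.

Lemma cell_face T i : i \in val T ->
  [/\ (val T :\ i)%SET \in faces M, (val T :\ i)%SET \subset val T,
      i \notin (val T :\ i)%SET & val T = (i |: (val T :\ i))%SET].
Proof.
move=> iT; split.
- have := cardsD1 i (val T); rewrite iT cell_card add1n => -[T3].
  rewrite inE -T3 eqxx /=.
  by apply/existsP; exists (val T); rewrite (valP T) finset.subD1set.
- exact: finset.subD1set.
- by rewrite finset.setD11.
- by rewrite finset.setD1K.
Qed.

Lemma cell_vertex T : exists i, i \in val T.
Proof. by apply/finset.set0Pn; rewrite -card_gt0 cell_card. Qed.

Variable lam : cell M -> 'I_(nvert M) -> pt3 R -> R.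
Hypothesis lamP : barycentric_family lam.

Definition interior_pts T : set (measurableTypeR R * measurableTypeR R * measurableTypeR R) :=
  to_pt3 @^-1` (elem T)°.

Definition vol T : R := fine (leb3 (interior_pts T)).

Lemma interior_pts_measure T :
  [/\ measurable (interior_pts T), leb3 (interior_pts T) = (vol T)%:E & 0 < vol T].
Proof.
have [i iT] := cell_vertex T.
have [Ff FT iF TF] := cell_face iT.
have F3 := face_card Ff.
have [mE vE] := flag_volume F3 iF TF (cell_affine T) (lamP T).
have d0 := apex_det_neq0 F3 iF TF (cell_affine T) (lamP T).
rewrite /vol [interior_pts T]/interior_pts; split => //; rewrite vE //=.
by rewrite mulr_gt0 ?normr_gt0 // reference_volume_gt0.
Qed.

Lemma interior_elem T : (elem T)° = [set y | forall i, i \in val T -> 0 < lam T i y].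
Proof. exact: (interior_hull (cell_affine T) (lamP T)). Qed.

(** Two cells meet in the hull of their common vertices, on which some
    coordinate of each of them vanishes if they differ. *)
Lemma interiors_disjoint T T' y : (elem T)° y -> (elem T')° y -> T = T'.
Proof.
move=> yT yT'; apply: val_inj; apply/eqP; rewrite eqEcard !cell_card leqnn andbT.
apply/fintype.subsetP => i iT; apply: contraT => iT'.
have : (elem T `&` elem T') y by split; exact: interior_subset.
rewrite cells_hullI => /(hullP (cell_affine T) (lamP T) y (finset.subsetIl _ _)) [_ /(_ i)].
rewrite inE (negbTE iT') andbF => /(_ isT) li.
by move: yT; rewrite interior_elem => /(_ i iT); rewrite li ltxx.
Qed.

(** Twice the area of the face. *)
Definition area F : R := enorm (face_cross (@node R M) F).

Lemma area_gt0 F : F \in faces M -> 0 < area F.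
Proof.
move=> Ff; have [T FT] := face_cell Ff.
have [i [iF TF _]] := faceP Ff FT.
exact: (face_cross_gt0 (face_card Ff) iF TF (cell_affine T) (lamP T)).
Qed.

(** The Crouzeix-Raviart basis function of F: on a cell with F as a face the
    sum has one term, the barycentric coordinate of the vertex opposite to F. *)
Definition face_basis F : broken M R := fun T x =>
  if F \subset val T then 1 - 3 * \sum_(i in (val T :\: F)%SET) lam T i x else 0.

Lemma face_basisE F T i : F \in faces M -> F \subset val T -> i \notin F ->
  val T = (i |: F)%SET -> face_basis F T = fun x => - 3 * lam T i x + 1.
Proof.
move=> Ff FT iF TF; apply/funext => x; rewrite /face_basis FT.
by have [j [jF TF' ->]] := faceP Ff FT; rewrite big_set1; have -> : j = i;
  [have : j \in val T by [rewrite TF' finset.setU11]; rewrite TF => /finset.setU1P[//|/idPn]; rewrite jF|ring].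
Qed.

Lemma face_basis_affine F T : F \in faces M -> affine (face_basis F T).
Proof.
move=> Ff; have [FT|FT] := boolP (F \subset val T); last first.
  by rewrite /face_basis (negbTE FT); exact: affine_cst.
have [i [iF TF _]] := faceP Ff FT.
have [la _ _ _] := lamP T.
rewrite (face_basisE Ff FT iF TF).
by have [] := affineD (- 3) (la i) (affine_cst 1).
Qed.

Variable nF : {set 'I_(nvert M)} -> pt3 R.
Hypothesis hnF : unit_normals nF.

Lemma outwardE T F : outward_normal nF T F = away (@node R M) (nF F) (val T) F.
Proof. by []. Qed.

Lemma face_basis_slope F T : F \in faces M -> F \subset val T ->
  vol T *: slope (face_basis F T) =
  (3 * reference_volume * area F) *: outward_normal nF T F.
Proof.
move=> Ff FT; have [i [iF TF _]] := faceP Ff FT.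
have [la _ _ _] := lamP T.
rewrite (face_basisE Ff FT iF TF).
have [_ ->] := affineD (- 3) (la i) (affine_cst 1).
have -> : slope (fun=> 1) = 0 :> pt3 R by apply/rowP => j; rewrite !mxE subrr.
have [n1 n2] := hnF Ff.
have [mE vE] := flag_volume (face_card Ff) iF TF (cell_affine T) (lamP T).
have -> : vol T = `|apex_det (@node R M) F i| * reference_volume.
  by rewrite /vol /interior_pts /elem vE.
have h := volume_slope_apex (face_card Ff) iF TF (cell_affine T) (lamP T) n1 n2.
rewrite addr0.
transitivity (- 3 *: ((`|apex_det (@node R M) F i| * reference_volume) *: slope (lam T i))).
  by rewrite [LHS]scalerA [RHS]scalerA [X in X *: _ = _]mulrC.
rewrite h -/(area F) -outwardE scalerN -scaleNr opprK scalerA mulrA //.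
Qed.

Lemma face_basis_slope0 F T : ~~ (F \subset val T) -> slope (face_basis F T) = 0.
Proof. by move=> /negbTE FT; rewrite /face_basis FT; apply/rowP => j; rewrite !mxE subrr. Qed.

(** Duality with the face means.  The opposite vertex i of F belongs to a face
    F' of the same cell unless F' = F, and 1 - 3 lam_i has vertex values 1 on F
    and -2 at i, which add up to 0 on F'. *)
Lemma face_basis_mean F F' T : F \in faces M -> F' \in faces M -> F' \subset val T ->
  face_mean F' (face_basis F T) = (F == F')%:R.
Proof.
move=> Ff F'f F'T.
have [k [kI kF Fk kE sF]] := face_enum (@node R M) (face_card F'f).
have [FT|FT] := boolP (F \subset val T); last first.
  rewrite /face_basis /face_mean (negbTE FT) big1 // mul0r.
  by have -> : (F == F') = false by apply: contraNF FT => /eqP ->.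
have [i [iF TF _]] := faceP Ff FT.
rewrite (face_basisE Ff FT iF TF) /face_mean.
under eq_bigr => m _ do rewrite kE (barycentric_vertex (cell_affine T) (lamP T) i (fintype.subsetP F'T _ (Fk m))).
have -> : \sum_m (- 3 * (i == k m)%:R + 1) = \sum_(j in F') (- 3 * (i == j)%:R + 1) :> R.
  by rewrite sF.
rewrite big_split -mulr_sumr /= sumr_const (face_card F'f).
have [iF'|iF'] := boolP (i \in F').
  rewrite (bigD1 i) //= eqxx big1; last by move=> j /andP[_ /negbTE]; rewrite eq_sym => ->.
  have -> : (F == F') = false by apply: contraNF iF => /eqP ->.
  by rewrite /= mulr1n mulr0n; field.
rewrite big1; last by move=> j jF'; case: eqP jF' iF' => // -> ->.
have -> : F == F'.
  rewrite eq_sym eqEcard !face_card // leqnn andbT.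
  apply/fintype.subsetP => j jF'; have := fintype.subsetP F'T _ jF'.
  by rewrite TF => /finset.setU1P[ji|//]; rewrite ji (negbTE iF') in jF'.
by rewrite /= mulr1n; field.
Qed.

Lemma outward_opposite F T T' : F \in faces M -> F \subset val T -> F \subset val T' ->
  T != T' -> outward_normal nF T F = - outward_normal nF T' F.
Proof.
move=> Ff FT FT' TT'.
have [i [iF TF _]] := faceP Ff FT; have [i' [iF' TF' _]] := faceP Ff FT'.
have [n1 n2] := hnF Ff.
rewrite !outwardE.
apply: (away_opposite (face_card Ff) iF iF' TF TF' (cell_affine T) (cell_affine T') (lamP T)) => //.
exact: cells_hullI.
Qed.

Lemma outward_sq F T : F \in faces M -> exists e : R, [/\ e * e = 1,
  outward_normal nF T F = e *: nF F & frob (nF F) (outward_normal nF T F) = e].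
Proof.
move=> Ff; have [n1 _] := hnF Ff.
have nn := frob_unit n1.
rewrite /outward_normal; case: ifP => _.
  by exists 1; rewrite scale1r mul1r.
by exists (-1); rewrite scaleN1r frobNr nn mulrNN mul1r.
Qed.

End MeshGeometry.

(** * Integrals over the domain *)

Section DomainIntegrals.
Context {R : realType} (Omega : set (pt3 R)) (M : mesh R).
Hypothesis hM : is_mesh Omega M.
Hypothesis hO : Omega = (closure Omega)°.
Variable lam : cell M -> 'I_(nvert M) -> pt3 R -> R.
Hypothesis lamP : barycentric_family lam.
Implicit Types (T : cell M).

Lemma interior_elem_sub T : (elem T)° `<=` Omega.
Proof.
rewrite hO; apply: interiorS.
by case: hM => _ _ _ -> y Ty; exists (val T) => //=; exact: (valP T).
Qed.

Definition inner T : set (pt3 R) := (elem T)°.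

Lemma glued_sum m n (w : broken M 'M[R]_(m, n)) y :
  glued w y = \sum_T (if y \in inner T then w T y else 0).
Proof.
rewrite /glued; apply: eq_bigr => T _; rewrite patchE; case: ifP => // _.
by apply/matrixP => i j; rewrite !mxE.
Qed.

Lemma glued_elem m n (w : broken M 'M[R]_(m, n)) T y : (elem T)° y -> glued w y = w T y.
Proof.
move=> yT; rewrite glued_sum (bigD1 T) //= mem_set // big1 ?addr0 // => T' T'T.
case: ifP => // /set_mem yT'.
by rewrite (interiors_disjoint hM lamP yT yT') eqxx in T'T.
Qed.

Let T3 : Type := (measurableTypeR R * measurableTypeR R * measurableTypeR R)%type.

Lemma frob_glued m n (f w : broken M 'M[R]_(m, n)) (g : pt3 R -> 'M[R]_(m, n)) y :
  frob (g y) (glued w y) = \sum_T \1_(inner T) y * frob (g y) (w T y).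
Proof.
rewrite glued_sum frob_sumr; apply: eq_bigr => T _; rewrite indicE.
by case: (y \in _); rewrite ?mul1r ?mul0r ?frob0r.
Qed.

Lemma integrable_interior T :
  (@leb3 R).-integrable setT (EFin \o (\1_(interior_pts T) : _ -> R)).
Proof.
have [mT vT _] := interior_pts_measure hM lamP T.
apply/integrableP; split; first exact/measurable_EFinP/measurable_indic.
rewrite (eq_integral (EFin \o (\1_(interior_pts T) : _ -> R))).
  apply: (@le_lt_trans _ _ (leb3 (interior_pts T))); last by rewrite vT ltry.
  by rewrite integral_indic // setIT.
by move=> y _; rewrite /= ger0_norm.
Qed.

(** The cells have disjoint interiors contained in Omega, and [glued] vanishes
    off these interiors, so integrals over Omega are sums over cells. *)
Lemma l2dot_constant m n (f g : broken M 'M[R]_(m, n)) (A B : cell M -> 'M[R]_(m, n)) :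
  (forall T y, f T y = A T) -> (forall T y, g T y = B T) ->
  l2dot Omega (glued f) (glued g) = \sum_T vol T * frob (A T) (B T).
Proof.
move=> fA gB; rewrite /l2dot Rintegral_mkcond.
transitivity (\int[@leb3 R]_y (\sum_T frob (A T) (B T) * \1_(interior_pts T) y)).
  congr Rintegral; apply/funext => y; rewrite patchE.
  transitivity (frob (glued f (to_pt3 y)) (glued g (to_pt3 y))).
    case: ifP => // yO; rewrite [glued f _]glued_sum big1 ?frob0l // => T _.
    case: ifP => // /set_mem /interior_elem_sub yT.
    by case/negP: yO; rewrite inE.
  rewrite frob_glued //; apply: eq_bigr => T _; rewrite !indicE mulrC.
  have -> : (to_pt3 y \in inner T) = (y \in interior_pts T).
    by apply/idP/idP => /set_mem h; apply/mem_set.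
  have [/set_mem yT|_] := boolP (y \in interior_pts T); last by rewrite !mulr0.
  by rewrite (glued_elem _ yT) fA gB.
rewrite Rintegral_lincomb //; last exact: integrable_interior.
apply: eq_bigr => T _; have [mT vT _] := interior_pts_measure hM lamP T.
rewrite mulrC /Rintegral; congr (_ * _).
transitivity (fine (leb3 (interior_pts T))) => //.
by rewrite integral_indic // setIT.
Qed.

Lemma affine_bounded T (u : pt3 R -> R) : affine u ->
  exists K, 0 <= K /\ forall y, elem T y -> `|u y| <= K.
Proof.
move=> hu; exists (\sum_i `|u (@node R M i)|); split; first exact: sumr_ge0.
move=> y [w [w0 _ w1 ->]]; rewrite (affine_combination _ hu w1).
apply: (le_trans (ler_norm_sum _ _ _)); apply: ler_sum => i _.
rewrite normrM (ger0_norm (w0 i)) ler_piMl //.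
by rewrite -w1 (bigD1 i) //= lerDl sumr_ge0.
Qed.

Lemma measurable_affine (u : pt3 R -> R) : affine u ->
  measurable_fun setT (fun y : T3 => u (to_pt3 y)).
Proof.
move=> hu.
rewrite (_ : (fun y => _) = fun y : T3 => u 0 + (slope u 0 0 * y.1.1 + slope u 0 1 * y.1.2 + slope u 0 2 * y.2)).
  have m1 : measurable_fun setT (fun y : T3 => y.1.1) by exact: (measurableT_comp measurable_fst).
  have m2 : measurable_fun setT (fun y : T3 => y.1.2) by exact: (measurableT_comp measurable_snd).
  have mk k (f : T3 -> measurableTypeR R) : measurable_fun setT f -> measurable_fun setT (fun y : T3 => k * f y : measurableTypeR R).
    by move=> mf; exact: (@measurable_funM _ _ _ _ (cst k) f).
  apply: (@measurable_funD _ _ _ _ (cst (u 0))) => //.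
  apply: measurable_funD; last exact: mk.
  by apply: measurable_funD; exact: mk.
by apply/funext => y; rewrite hu frob_row sum3 !to_pt3E.
Qed.

(** The function u is bounded on the cell, and |f| <= 1 + f^2. *)
Lemma load_integrable T (f : T3 -> R) (u : pt3 R -> R) :
  f \in Lfun (@leb3 R) 2%:E -> affine u ->
  (@leb3 R).-integrable setT (EFin \o (fun y => f y * (\1_(interior_pts T) y * u (to_pt3 y)))).
Proof.
move=> f2 hu; have [mT vT _] := interior_pts_measure hM lamP T.
have [K [K0 hK]] := affine_bounded T hu.
have mf : measurable_fun setT f by move: f2; rewrite inE => /andP[]; rewrite inE.
have i1 := integrable_interior T.
have i2 := Lfun2_integrable_sqr f2.
have i3 : (@leb3 R).-integrable setT
    (EFin \o (fun y => \sum_(b <- [:: true; false])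
       K * (if b then \1_(interior_pts T) y else f y ^+ 2))).
  by apply: integrable_lincomb => // -[].
apply: (le_integrable measurableT _ _ i3).
  apply/measurable_EFinP; apply: measurable_funM => //.
  apply: measurable_funM; last exact: measurable_affine.
  exact: measurable_indic.
move=> y _ /=; rewrite lee_fin !big_cons big_nil addr0.
rewrite indicE; have [/set_mem yT|_] := boolP (y \in interior_pts T); last first.
  rewrite mul0r mulr0 normr0 normr_ge0 //.
rewrite mul1r mulr1 normrM.
have uK := hK _ (interior_subset yT).
have h : `|f y| <= 1 + f y ^+ 2.
  rewrite -real_normK ?num_real //; have := normr_ge0 (f y); set a := `|f y|.
  by move=> a0; nra.
apply: (@le_trans _ _ ((1 + f y ^+ 2) * K)).
  by apply: ler_pM.
rewrite ger0_norm; last by rewrite addr_ge0 // mulr_ge0 // sqr_ge0.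
by rewrite mulrDl mul1r mulrC.
Qed.

(** The integral is additive because it splits into integrable terms, one per
    cell and matrix entry. *)
Lemma load_linear m n (g : pt3 R -> 'M[R]_(m, n)) X (t1 t2 : broken M 'M[R]_(m, n)) a :
  L2 Omega X g ->
  (forall T i j, affine (fun y => t1 T y i j)) ->
  (forall T i j, affine (fun y => t2 T y i j)) ->
  l2dot Omega g (glued (fun T y => a *: t1 T y + t2 T y)) =
  a * l2dot Omega g (glued t1) + l2dot Omega g (glued t2).
Proof.
move=> [g2 _] a1 a2.
pose D : set T3 := to_pt3 @^-1` Omega.
pose k (t : broken M 'M[R]_(m, n)) (p : cell M * ('I_m * 'I_n)) (y : T3) : R :=
  ((fun y => g (to_pt3 y) p.2.1 p.2.2) \_ D) y *
  (\1_(interior_pts p.1) y * t p.1 (to_pt3 y) p.2.1 p.2.2).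
have kE t y : ((fun y => frob (g (to_pt3 y)) (glued t (to_pt3 y))) \_ D) y = \sum_p 1 * k t p y.
  rewrite -(pair_bigA _ (fun T p => 1 * k t (T, p) y)) /=.
  rewrite patchE; case: ifP => yD; last first.
    rewrite big1 // => T _; rewrite big1 // => p _.
    by rewrite /k patchE yD mul0r mulr0.
  rewrite frob_glued //; apply: eq_bigr => T _.
  rewrite -(pair_bigA _ (fun i j => 1 * k t (T, (i, j)) y)) /=.
  rewrite /frob mulr_sumr; apply: eq_bigr => i _; rewrite mulr_sumr.
  apply: eq_bigr => j _; rewrite /k patchE yD /= mul1r.
  have -> : \1_(inner T) (to_pt3 y) = \1_(interior_pts T) y :> R.
    by rewrite !indicE.
  ring.
have ki (t : broken M 'M[R]_(m, n)) p : (forall T i j, affine (fun y => t T y i j)) ->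
    (@leb3 R).-integrable setT (EFin \o k t p).
  by move=> ta; exact: (load_integrable p.1 (g2 p.2.1 p.2.2) (ta p.1 p.2.1 p.2.2)).
have intE (t : broken M 'M[R]_(m, n)) : (forall T i j, affine (fun y => t T y i j)) ->
    l2dot Omega g (glued t) = \sum_p \int[@leb3 R]_y k t p y.
  move=> ta; rewrite /l2dot Rintegral_mkcond.
  transitivity (\int[@leb3 R]_y (\sum_p 1 * k t p y)).
    by congr Rintegral; apply/funext => y; rewrite -kE.
  rewrite Rintegral_lincomb //; last by move=> p; exact: ki.
  by apply: eq_bigr => p _; rewrite mul1r.
rewrite !intE //; last first.
  move=> T i j; have [+ _] := affineD a (a1 T i j) (a2 T i j).
  by congr affine; apply/funext => y; rewrite !mxE.
rewrite mulr_sumr -big_split; apply: eq_bigr => p _ /=.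
rewrite -RintegralZl //; last exact: ki.
rewrite -RintegralD //; last exact: ki.
- by congr Rintegral; apply/funext => y; rewrite /k !mxE; ring.
- rewrite (_ : _ \o _ = (fun y => a%:E * (k t1 p y)%:E)%E).
    by apply: integrableZl => //; exact: ki.
  by apply/funext => y /=; rewrite EFinM.
Qed.

End DomainIntegrals.

(** * Sums over cells and faces *)

Section FaceSums.
Context {R : realType} (Omega : set (pt3 R)) (M : mesh R).
Hypothesis hM : is_mesh Omega M.
Variable lam : cell M -> 'I_(nvert M) -> pt3 R -> R.
Hypothesis lamP : barycentric_family lam.
Variable nF : {set 'I_(nvert M)} -> pt3 R.
Hypothesis hnF : unit_normals nF.
Implicit Types (T : cell M) (F : {set 'I_(nvert M)}).

Let out := outward_normal nF.

Lemma outward_neq0 T F : F \in faces M -> out T F != 0.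
Proof.
move=> Ff; have [e [ee oe _]] := outward_sq hnF T Ff; have [n1 _] := hnF Ff.
apply/eqP; rewrite /out oe => /eqP; rewrite scaler_eq0 => /orP[/eqP e0|/eqP n0].
  by move: ee; rewrite e0 mul0r => /eqP; rewrite eq_sym oner_eq0.
by move: n1; rewrite /enorm n0 frob0l sqrtr0 => /eqP; rewrite eq_sym oner_eq0.
Qed.

(** Outward normals of distinct cells at a common face are opposite, so there
    are no three cells with a common face. *)
Lemma interior_face_cells F : interior_face F -> exists T1 T2,
  [/\ F \subset val T1, F \subset val T2, out T1 F = - out T2 F,
      forall T, F \subset val T -> T = T1 \/ T = T2 &
      forall (V : nmodType) (f : cell M -> V),
        \sum_(T : cell M | F \subset val T) f T = f T1 + f T2].
Proof.
move=> /andP[Ff /card_gt1P[S1 [S2 [+ + S12]]]].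
rewrite !inE => /andP[c1 F1] /andP[c2 F2].
pose T1 : cell M := exist _ S1 c1; pose T2 : cell M := exist _ S2 c2.
have T12 : T1 != T2 by apply: contraNneq S12 => /(congr1 val) /= ->.
have opp T T' : F \subset val T -> F \subset val T' -> T != T' -> out T F = - out T' F.
  by move=> *; exact: (outward_opposite hM lamP hnF).
have two T : F \subset val T -> T = T1 \/ T = T2.
  move=> FT; have [->|TT1] := eqVneq T T1; first by left.
  have [->|TT2] := eqVneq T T2; first by right.
  have e1 := @opp T T1 FT F1 TT1; have e2 := @opp T T2 FT F2 TT2.
  have e3 := @opp T1 T2 F1 F2 T12.
  have := outward_neq0 T Ff; have : out T F = - out T F by rewrite {1}e1 e3 -e2.
  move=> /eqP; rewrite -addr_eq0 -mulr2n -scaler_nat scaler_eq0 pnatr_eq0 /=.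
  by move=> ->.
exists T1, T2; split => //; first exact: opp.
move=> V f; rewrite (bigD1 T1) //= (bigD1 T2) //=; last by rewrite F2 eq_sym.
rewrite big1 ?addr0 // => T /andP[/andP[/two[]->]]; by rewrite eqxx.
Qed.

Lemma boundary_face_cell F : boundary_face F -> exists T,
  [/\ F \subset val T, ~~ interior_face F,
      forall T', F \subset val T' -> T' = T &
      forall (V : nmodType) (f : cell M -> V),
        \sum_(T' : cell M | F \subset val T') f T' = f T].
Proof.
move=> /andP[Ff nI]; have [T FT] := face_cell Ff.
have one T' : F \subset val T' -> T' = T.
  move=> FT'; apply/eqP; apply: contraR nI => T'T.
  rewrite /interior_face Ff /=; apply/card_gt1P; exists (val T), (val T'); split.
  - by rewrite inE FT (valP T).
  - by rewrite inE FT' (valP T').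
  - by apply: contraNneq T'T => /val_inj ->.
exists T; split => // V f; rewrite (bigD1 T) //= big1 ?addr0 // => T' /andP[/one->].
by rewrite eqxx.
Qed.

Lemma shared_face_interior F T T' : F \in faces M -> F \subset val T -> F \subset val T' ->
  T != T' -> interior_face F.
Proof.
move=> Ff FT FT' TT'.
have [//|nI] := boolP (interior_face F).
have bF : boundary_face F by rewrite /boundary_face Ff nI.
have [T0 [_ _ one _]] := boundary_face_cell bF.
by move: TT'; rewrite (one _ FT) (one _ FT') eqxx.
Qed.

Lemma face_dichotomy F : F \in faces M -> interior_face F \/ boundary_face F.
Proof. by move=> Ff; rewrite /boundary_face Ff /=; case: interior_face; [left|right]. Qed.

Lemma faces_of_cell (V : nmodType) T (f : {set 'I_(nvert M)} -> V) :
  \sum_(F in faces M | F \subset val T) f F = \sum_(i in val T) f (val T :\ i)%SET.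
Proof.
rewrite -(big_imset f (h := fun i => (val T :\ i)%SET)) /=; last first.
  move=> i j iT jT /setP /(_ i); rewrite !inE eqxx iT andbT /=.
  by case: (i =P j).
apply: eq_bigl => F; apply/andP/imsetP.
  move=> [Ff FT]; have [i [iF TF _]] := faceP hM Ff FT.
  by exists i; rewrite TF ?finset.setU11 // setU1K.
by move=> [i iT ->]; have [] := cell_face hM iT.
Qed.

Lemma slope_sum (J : finType) (f : J -> pt3 R -> R) :
  slope (fun y => \sum_j f j y) = \sum_j slope (f j).
Proof.
apply/rowP => k; rewrite mxE summxE -sumrB; apply: eq_bigr => j _.
by rewrite mxE.
Qed.

Lemma slope_partition T : \sum_i slope (lam T i) = 0.
Proof.
have [_ _ l1 _] := lamP T; rewrite -slope_sum.
by apply/rowP => k; rewrite !mxE !l1 subrr.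
Qed.

Lemma slope_reproduction T (a : pt3 R) :
  \sum_i frob (node i) a *: slope (lam T i) = a.
Proof.
have [la _ _ lx] := lamP T.
apply/rowP => k; rewrite summxE.
transitivity (frob (delta_mx 0 k) a).
  transitivity (frob (\sum_i lam T i (delta_mx 0 k) *: node i - \sum_i lam T i 0 *: node i) a).
    rewrite -sumrB frob_suml; apply: eq_bigr => i _.
    by rewrite -scalerBl frobZl !mxE mulrC.
  by rewrite !lx subr0.
rewrite frob_row (bigD1 k) //= big1 ?addr0 ?mxE ?eqxx ?mul1r // => j /negbTE jk.
by rewrite mxE jk andbF mul0r.
Qed.

Definition face_point F : pt3 R := 3^-1 *: \sum_(i in F) node i.

(** This is the gradient of the identity y.a = sum over F of
    (x_F.a) phi_F(y), with x_F the barycenter of F: an affine function is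
    determined by its face means, and these are dual to the functions phi_F. *)
Lemma face_basis_reproduction T (a : pt3 R) :
  \sum_(F in faces M | F \subset val T)
    frob (face_point F) a *: slope (face_basis lam F T) = a.
Proof.
rewrite faces_of_cell.
have [la l0 _ _] := lamP T.
have sl i : i \in val T ->
    slope (face_basis lam (val T :\ i)%SET T) = - 3 *: slope (lam T i).
  move=> iT; have [Ff FT iF TF] := cell_face hM iT.
  rewrite (face_basisE hM lam Ff FT iF TF).
  have [_ ->] := affineD (- 3) (la i) (affine_cst 1).
  by rewrite [X in _ + X](_ : _ = 0) ?addr0 //; apply/rowP => k; rewrite !mxE subrr.
pose S := \sum_(i in val T) (node i : pt3 R).
have fp i : i \in val T -> face_point (val T :\ i)%SET = 3^-1 *: (S - node i).
  move=> iT; rewrite /face_point; have -> : S = node i + \sum_(j in (val T :\ i)%SET) node j.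
    by rewrite /S (big_setD1 i iT).
  by rewrite [node i + _]addrC addrK.
rewrite (eq_bigr (fun i => - frob S a *: slope (lam T i) + frob (node i) a *: slope (lam T i))).
  have inT (f : 'I_(nvert M) -> pt3 R) : (forall i, i \notin val T -> f i = 0) ->
      \sum_(i in val T) f i = \sum_i f i.
    by move=> f0; rewrite [RHS](bigID (mem (val T))) /= [X in _ = _ + X]big1 ?addr0.
  have s0 i : i \notin val T -> slope (lam T i) = 0.
    by move=> iT; apply/rowP => k; rewrite !mxE !l0 // subrr.
  rewrite big_split /= !inT; first last.
  - by move=> i /s0 ->; rewrite scaler0.
  - by move=> i /s0 ->; rewrite scaler0.
  by rewrite slope_reproduction -scaler_sumr slope_partition scaler0 add0r.
move=> i iT; rewrite sl // fp // frobZl frobDl frobNl scalerA -scalerDl.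
by congr (_ *: _); field.
Qed.

(** The divergence theorem for the piecewise quadratic field (y.a_T) a_T:
    expanding one factor a_T of vol |a_T|^2 in the face basis gives a sum of the
    fluxes (out.a_T) (x_F.a_T) over pairs of a cell and a face.  Fluxes of
    adjacent cells cancel and boundary fluxes vanish. *)
Lemma flux_free_zero (a : cell M -> pt3 R) :
  (forall F T T', F \in faces M -> F \subset val T -> F \subset val T' -> a T = a T') ->
  (forall F T, boundary_face F -> F \subset val T -> frob (nF F) (a T) = 0) ->
  forall T, a T = 0.
Proof.
move=> acont abnd.
have tot : \sum_T vol T * frob (a T) (a T) = 0.
  transitivity (\sum_(T : cell M) \sum_(F in faces M | F \subset val T)
      3 * reference_volume * area F * (frob (face_point F) (a T) * frob (out T F) (a T))).
    apply: eq_bigr => T _; rewrite -{1}(face_basis_reproduction T (a T)).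
    rewrite frob_suml mulr_sumr; apply: eq_bigr => F /andP[Ff FT].
    have := congr1 (fun v => frob v (a T)) (face_basis_slope hM lamP hnF Ff FT).
    rewrite !frobZl -/out => e.
    by rewrite mulrCA e mulrCA.
  rewrite (exchange_big_dep (fun F => F \in faces M)) /=; last by move=> ? ? _ /andP[].
  apply: big1 => F Ff.
  rewrite -mulr_sumr.
  rewrite (eq_bigl (fun T : cell M => F \subset val T)); last by move=> ?; rewrite Ff.
  have [/interior_face_cells[T1 [T2 [F1 F2 o12 _ ->]]]|bF] := face_dichotomy Ff.
    by rewrite (acont _ _ _ Ff F1 F2) o12 frobNl mulrN addNr mulr0.
  have [T [FT _ _ ->]] := boundary_face_cell bF.
  have [e [_ oe _]] := outward_sq hnF T Ff.
  by rewrite /out oe frobZl (abnd _ _ bF FT) !mulr0.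
move=> T; apply: frob_eq0.
have := tot; move/eqP; rewrite psumr_eq0 => [/allP /(_ T (mem_index_enum _))|T' _].
  have [_ _ v0] := interior_pts_measure hM lamP T.
  by rewrite mulf_eq0 gt_eqF //= => /eqP.
have [_ _ v0] := interior_pts_measure hM lamP T'.
by rewrite mulr_ge0 ?frob_ge0 // ltW.
Qed.

(** The flux of the constant-direction field c_T e_0. *)
Lemma continuous_zero (c : cell M -> R) :
  (forall F T T', F \in faces M -> F \subset val T -> F \subset val T' -> c T = c T') ->
  (forall F T, boundary_face F -> F \subset val T -> c T = 0) ->
  forall T, c T = 0.
Proof.
move=> cc cb T.
have h := @flux_free_zero (fun T => c T *: delta_mx 0 0).
have : c T *: delta_mx 0 0 = 0 :> pt3 R.
  apply: h => [F T1 T2 Ff F1 F2|F T1 bF F1]; first by rewrite (cc F T1 T2).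
  by rewrite (cb F T1) // scale0r frob0r.
by move=> /rowP /(_ 0); rewrite !mxE /= mulr1.
Qed.

End FaceSums.

(** * The discrete forms and spaces *)

Section Diameter.
Context {R : realType}.

Lemma enorm_ge0 n (v : 'rV[R]_n) : 0 <= enorm v.
Proof. exact: sqrtr_ge0. Qed.

Lemma enorm_coord (v : pt3 R) K : (forall j, `|v 0 j| <= K) -> enorm v <= 2 * K.
Proof.
move=> h; have K0 : 0 <= K by apply: le_trans (h 0).
rewrite /enorm -[2 * K]ger0_norm ?mulr_ge0 // -sqrtr_sqr ler_wsqrtr //.
rewrite frob_row sum3.
have sq j : v 0 j * v 0 j <= K ^+ 2.
  by rewrite -expr2 -real_normK ?num_real // ler_sqr ?nnegrE.
have := sq 0; have := sq 1; have := sq 2; have := sqr_ge0 K.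
set k := K ^+ 2; rewrite exprMn -/k => ? ? ? ?; lra.
Qed.

Lemma diam_gt0 (A : set (pt3 R)) (K : R) x y : (forall z, A z -> forall j, `|z 0 j| <= K) ->
  A x -> A y -> x != y -> 0 < diam A.
Proof.
move=> AK Ax Ay xy.
have d0 : 0 < enorm (x - y).
  rewrite lt_neqAle enorm_ge0 andbT eq_sym; apply: contra xy => /eqP /(congr1 (fun z => z ^+ 2)).
  rewrite sqr_sqrtr ?frob_ge0 // expr0n /= => /frob_eq0 /eqP.
  by rewrite subr_eq0.
apply: (lt_le_trans d0); apply: sup_ubound; last by exists x, y.
exists (2 * (K + K)) => _ [u [v [Au Av ->]]].
apply: enorm_coord => j; rewrite !mxE.
by apply: (le_trans (ler_normB _ _)); apply: lerD; exact: AK.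
Qed.

End Diameter.

Section Operators.
Context {R : realType}.

(** Differential operators written with [slope]: they agree with the
    derivatives on affine fields and are linear on all fields. *)
Definition Grad m (w : pt3 R -> 'rV[R]_m) : 'M[R]_(m, 3) :=
  \matrix_(i, j) slope (fun y => w y 0 i) 0 j.

Definition Curl (t : pt3 R -> 'M[R]_3) : 'M[R]_3 :=
  \matrix_(i, j) (slope (fun y => t y i (j + 2)) 0 (j + 1)
                  - slope (fun y => t y i (j + 1)) 0 (j + 2)).

Lemma Grad_lin m (w v : pt3 R -> 'rV[R]_m) a :
  Grad (fun y => a *: w y + v y) = a *: Grad w + Grad v.
Proof. by apply/matrixP => i j; rewrite !mxE; ring. Qed.

Lemma Curl_lin (w v : pt3 R -> 'M[R]_3) a :
  Curl (fun y => a *: w y + v y) = a *: Curl w + Curl v.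
Proof. by apply/matrixP => i j; rewrite !mxE; ring. Qed.

Lemma dev_lin (A B : 'M[R]_3) a : dev (a *: A + B) = a *: dev A + dev B.
Proof.
apply/matrixP => i j; rewrite !mxE raddfD /= mxtraceZ.
by case: (i == j); rewrite ?mulr1n ?mulr0n; field.
Qed.

Lemma grad_Grad m (w : pt3 R -> 'rV[R]_m) x : (forall i, affine (fun y => w y 0 i)) ->
  grad w x = Grad w.
Proof. by move=> h; apply/matrixP => i j; rewrite mxE partial_affine // [RHS]mxE. Qed.

Lemma curl_Curl (t : pt3 R -> 'M[R]_3) x : (forall i j, affine (fun y => t y i j)) ->
  curl t x = Curl t.
Proof. by move=> h; apply/matrixP => i j; rewrite mxE !partial_affine // [RHS]mxE. Qed.

Lemma dev_traceless (A : 'M[R]_3) : \tr (dev A) = 0.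
Proof. by rewrite /dev raddfB /= mxtrace_scalar; field. Qed.

Lemma Curl_traceless (t : pt3 R -> 'M[R]_3) : (forall y, (t y)^T = t y) -> \tr (Curl t) = 0.
Proof.
move=> tS.
rewrite /mxtrace sum3 !mxE !ord3_add.
have e y i j : t y i j = t y j i by rewrite -{1}(tS y) mxE.
by rewrite !(e _ 1 0) !(e _ 2 0) !(e _ 2 1); ring.
Qed.

Lemma frob_dev (A P : 'M[R]_3) : \tr P = 0 -> frob (dev A) P = frob A P.
Proof.
move=> P0; rewrite /dev frobDl frobNl.
have -> : frob ((\tr A / 3)%:M) P = \tr A / 3 * \tr P.
  rewrite /frob /mxtrace mulr_sumr; apply: eq_bigr => i _.
  rewrite (bigD1 i) //= mxE eqxx mulr1n [X in _ + X]big1 ?addr0 // => j ji.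
  by rewrite mxE eq_sym (negbTE ji) mulr0n mul0r.
by rewrite P0 mulr0 subr0.
Qed.

End Operators.

Section DiscreteForms.
Context {R : realType} (Omega : set (pt3 R)) (M : mesh R).
Hypothesis hM : is_mesh Omega M.
Hypothesis hO : Omega = (closure Omega)°.
Variable lam : cell M -> 'I_(nvert M) -> pt3 R -> R.
Hypothesis lamP : barycentric_family lam.
Variable nF : {set 'I_(nvert M)} -> pt3 R.
Hypothesis hnF : unit_normals nF.
Implicit Types (T : cell M) (F : {set 'I_(nvert M)}).

Definition affine_field m n (w : broken M 'M[R]_(m, n)) :=
  forall T i j, affine (fun y => w T y i j).

(** Positivity matters because the weight 1 / h_F must not degenerate to 0;
    the supremum in [diam] needs an upper bound to dominate the distance of two
    vertices. *)
Lemma face_diam_gt0 F : F \in faces M -> 0 < face_diam F.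
Proof.
move=> Ff.
have [k [kI kF Fk kE sF]] := face_enum (@node R M) (face_card Ff).
have [T FT] := face_cell Ff.
pose K : R := \sum_(i < nvert M) \sum_(j < 3) `|@node R M i 0 j|.
have vertex i : i \in F -> hull (@node R M) F (node i).
  move=> iF; exists (fun j => (j == i)%:R); split => //.
  - by move=> j jF; case: eqP jF iF => // -> /negbTE ->.
  - by rewrite (bigD1 i) //= eqxx big1 ?addr0 // => j /negbTE ->.
  - rewrite (bigD1 i) //= eqxx scale1r big1 ?addr0 // => j /negbTE ->.
    by rewrite scale0r.
apply: (diam_gt0 (K := K) _ (vertex _ (Fk 0)) (vertex _ (Fk 1))).
  move=> z [w [w0 _ w1 ->]] j; rewrite summxE.
  apply: (le_trans (ler_norm_sum _ _ _)); apply: ler_sum => i _.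
  rewrite mxE normrM (ger0_norm (w0 i)).
  apply: (@le_trans _ _ `|(node i : pt3 R) 0 j|).
    rewrite ler_piMl //.
    by rewrite -w1 (bigD1 i) //= lerDl sumr_ge0.
  by rewrite (bigD1 j) //= lerDl sumr_ge0.
apply/eqP => e; case: hM => nI _ _ _.
by have /kI := nI _ _ e.
Qed.

(** The three forms below are the bilinear forms of the method with all
    integrals evaluated for piecewise affine arguments. *)
Definition stiffness (s t : broken M 'M[R]_3) : R :=
  \sum_(i < 3) \sum_T vol T * frob (Grad (fun y => row i (s T y))) (Grad (fun y => row i (t T y))).

Definition jump_form (r s : broken M 'rV[R]_3) : R :=
  \sum_(F in faces M) (face_diam F)^-1 * (area F * \sum_k
    face_form (fun m => jump nF r F (fnode (@node R M) F m) 0 k)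
              (fun m => jump nF s F (fnode (@node R M) F m) 0 k)).

Definition coupling (t : broken M 'M[R]_3) (s : broken M 'rV[R]_3) (p : broken M 'M[R]_3) : R :=
  \sum_T vol T * frob (Curl (t T) + dev (Grad (s T))) (p T 0).

Lemma jump_affine (r : broken M 'rV[R]_3) F k : affine_field r ->
  affine (fun y => jump nF r F y 0 k).
Proof.
move=> ra.
have sumA (c : cell M -> R) (P : pred (cell M)) :
    affine (fun y => \sum_(T | P T) c T * r T y 0 k).
  have e y : \sum_(T | P T) c T * r T y 0 k
      = \sum_(T | P T) c T * r T 0 0 k + frob (\sum_(T | P T) c T *: slope (fun z => r T z 0 k)) y.
    rewrite frob_suml -big_split; apply: eq_bigr => T _ /=.
    by rewrite (ra T 0 k y) frobZl mulrDr.
  by case: (affineP e).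
rewrite /jump; case: (interior_face F).
  rewrite (_ : (fun y => _) = fun y => \sum_(T : cell M | F \subset val T)
      frob (nF F) (outward_normal nF T F) * r T y 0 k) //.
  by apply/funext => y; rewrite summxE; apply: eq_bigr => T _; rewrite mxE.
rewrite (_ : (fun y => _) = fun y => \sum_(T : cell M | F \subset val T) 1 * r T y 0 k) //.
by apply/funext => y; rewrite summxE; apply: eq_bigr => T _; rewrite mul1r.
Qed.

Lemma a_hE sg r t s : affine_field sg -> affine_field t -> affine_field r -> affine_field s ->
  a_h Omega nF sg r t s = stiffness sg t + jump_form r s.
Proof.
move=> sga ta ra sa; rewrite /a_h; congr (_ + _).
  apply: eq_bigr => i _.
  apply: (l2dot_constant hM hO lamP) => T y; apply: grad_Grad => j.
    by rewrite (_ : (fun _ => _) = fun y => sg T y i j) //; apply/funext => z; rewrite mxE.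
  by rewrite (_ : (fun _ => _) = fun y => t T y i j) //; apply/funext => z; rewrite mxE.
apply: eq_bigr => F _; congr (_ * _).
rewrite /l2dot_face.
transitivity (face_integral F (fun y => \sum_k jump nF r F y 0 k * jump nF s F y 0 k)).
  by congr face_integral; apply/funext => y; rewrite frob_row.
have ja (w : broken M 'rV[R]_3) : affine_field w -> forall k, affine (fun y => jump nF w F y 0 k).
  by move=> wa k; exact: jump_affine.
exact: (face_integral_sum F (ja r ra) (ja s sa)).
Qed.

Lemma b_hE t s p : affine_field t -> affine_field s ->
  (forall T y, p T y = p T 0) ->
  b_h Omega t s p = coupling t s p.
Proof.
move=> ta sa pc; rewrite /b_h.
apply: (l2dot_constant hM hO lamP) => // T y.
by rewrite /curl_dev_grad_h /curl_h /grad_h curl_Curl // grad_Grad.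
Qed.

Lemma jump_lin (r r' : broken M 'rV[R]_3) F y a :
  jump nF (a *: r + r') F y = a *: jump nF r F y + jump nF r' F y.
Proof.
rewrite /jump; case: ifP => _; rewrite scaler_sumr -big_split; apply: eq_bigr => T _ //=.
by rewrite scalerDr !scalerA mulrC.
Qed.

Lemma stiffnessC s t : stiffness s t = stiffness t s.
Proof. by apply: eq_bigr => i _; apply: eq_bigr => T _; rewrite frobC. Qed.

Lemma stiffness_lin s s' t a : stiffness (a *: s + s') t = a * stiffness s t + stiffness s' t.
Proof.
rewrite /stiffness mulr_sumr -big_split; apply: eq_bigr => i _ /=.
rewrite mulr_sumr -big_split; apply: eq_bigr => T _ /=.
have -> : Grad (fun y => row i ((a *: s + s') T y))
    = a *: Grad (fun y => row i (s T y)) + Grad (fun y => row i (s' T y)).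
  rewrite -Grad_lin; congr Grad; apply/funext => y.
  by apply/rowP => j; rewrite !mxE.
by rewrite frobDl frobZl; ring.
Qed.

Lemma jump_formC r s : jump_form r s = jump_form s r.
Proof.
apply: eq_bigr => F _; congr (_ * (_ * _)).
by apply: eq_bigr => k _; rewrite face_formC.
Qed.

Lemma jump_form_lin r r' s a : jump_form (a *: r + r') s = a * jump_form r s + jump_form r' s.
Proof.
rewrite /jump_form mulr_sumr -big_split; apply: eq_bigr => F _ /=.
rewrite (mulrCA a) -mulrDr; congr (_ * _).
rewrite (mulrCA a) -mulrDr; congr (_ * _).
rewrite mulr_sumr -big_split; apply: eq_bigr => k _ /=.
rewrite -face_formDl; congr face_form; apply/funext => m.
by rewrite jump_lin !mxE.
Qed.

Lemma coupling_linl t t' s s' p a :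
  coupling (a *: t + t') (a *: s + s') p = a * coupling t s p + coupling t' s' p.
Proof.
rewrite /coupling mulr_sumr -big_split; apply: eq_bigr => T _ /=.
have -> : Curl ((a *: t + t') T) = a *: Curl (t T) + Curl (t' T) by exact: Curl_lin.
have -> : Grad ((a *: s + s') T) = a *: Grad (s T) + Grad (s' T) by exact: Grad_lin.
rewrite dev_lin.
have aux (C C' D D' : 'M[R]_3) : a *: C + C' + (a *: D + D') = a *: (C + D) + (C' + D').
  by rewrite scalerDr addrACA.
rewrite aux.
by rewrite (frobDl (a *: _)) frobZl; ring.
Qed.

Lemma coupling_linr t s p p' a :
  coupling t s (a *: p + p') = a * coupling t s p + coupling t s p'.
Proof.
rewrite /coupling mulr_sumr -big_split; apply: eq_bigr => T _ /=.
by rewrite frobDr frobZr; ring.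
Qed.

Lemma CRP (v : broken M R) : CR v <-> (forall T, affine (v T)) /\
  (forall F, interior_face F -> forall T1 T2 : cell M, F \subset val T1 -> F \subset val T2 ->
    face_mean F (v T1) = face_mean F (v T2)).
Proof.
have q0 F u : F \in faces M -> affine u -> Q0 F u = face_mean F u.
  by move=> Ff; apply: Q0_affine; exact: (area_gt0 hM lamP Ff).
split=> -[h1 h2].
  have va T : affine (v T) by apply/polynomial_le1P; exact: h1.
  split => // F iF T1 T2 F1 F2; have /andP[Ff _] := iF.
  by rewrite -!q0 //; exact: h2.
split; first by move=> T; apply/polynomial_le1P; exact: h1.
move=> F iF T1 T2 F1 F2; have /andP[Ff _] := iF.
by rewrite !q0 //; exact: h2.
Qed.

Lemma CR0P (v : broken M R) : CR0 v <-> CR v /\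
  (forall F, boundary_face F -> forall T : cell M, F \subset val T -> face_mean F (v T) = 0).
Proof.
have q0 F u : F \in faces M -> affine u -> Q0 F u = face_mean F u.
  by move=> Ff; apply: Q0_affine; exact: (area_gt0 hM lamP Ff).
split=> -[h1 h2]; split => // F bF T FT; have /andP[Ff _] := bF.
  by rewrite -q0 //; [exact: h2|exact: ((CRP v).1 h1).1].
by rewrite q0 //; [exact: h2|exact: ((CRP v).1 h1).1].
Qed.

Lemma face_mean_lin F u v a :
  face_mean (M := M) F (fun x => a * u x + v x) = a * face_mean F u + face_mean F v.
Proof. by rewrite /face_mean !sum3; ring. Qed.

Lemma CR_lin (u v : broken M R) a : CR u -> CR v -> CR (a *: u + v).
Proof.
move=> /CRP[ua um] /CRP[va vm]; apply/CRP; split.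
  by move=> T; have [] := affineD a (ua T) (va T).
move=> F iF T1 T2 F1 F2.
have e T : face_mean F ((a *: u + v) T) = a * face_mean F (u T) + face_mean F (v T).
  exact: face_mean_lin.
by rewrite !e (um F iF T1 T2) // (vm F iF T1 T2).
Qed.

Lemma CR0_lin (u v : broken M R) a : CR0 u -> CR0 v -> CR0 (a *: u + v).
Proof.
move=> /CR0P[uc um] /CR0P[vc vm]; apply/CR0P; split; first exact: CR_lin.
move=> F bF T FT.
have -> : face_mean F ((a *: u + v) T) = a * face_mean F (u T) + face_mean F (v T).
  exact: face_mean_lin.
by rewrite um // vm // mulr0 addr0.
Qed.

Lemma Pk0P (v : broken M R) : Pk 0 v <-> forall T y, v T y = v T 0.
Proof. by split=> h T; apply/polynomial_le0P; exact: h. Qed.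

End DiscreteForms.

(** * Normal and tangential jumps of matrices *)

Section NormalJump.
Context {R : realType}.

(** For symmetric S the hypothesis says that K = J x n (row by row) is skew.
    Its rows are orthogonal to n, so the axial vector w of K satisfies
    w x n = 0.  Moreover J = n x K row by row, since J n = 0 and |n| = 1, so that
    tr J = 2 w.n up to sign, and tr J = 0 gives w.n = 0.  Hence w = 0. *)
Lemma traceless_jump_zero (n : pt3 R) (J : 'M[R]_3) : frob n n = 1 -> \tr J = 0 ->
  (forall i, frob n (row i J) = 0) ->
  (forall S : 'M[R]_3, S^T = S -> \sum_i frob (cross n (row i S)) (row i J) = 0) ->
  J = 0.
Proof.
move=> nn trJ Jn sk.
pose K i : pt3 R := cross (row i J) n.
have triple i (S : 'M[R]_3) : frob (cross n (row i S)) (row i J) = frob (row i S) (K i).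
  rewrite /K !frob_row !sum3.
  by have [-> -> ->] := crossE n (row i S); have [-> -> ->] := crossE (row i J) n; ring.
have skew i j : K i 0 j + K j 0 i = 0.
  pose S : 'M[R]_3 := delta_mx i j + delta_mx j i.
  have ST : S^T = S by rewrite /S linearD /= !trmx_delta addrC.
  have := sk S ST; under eq_bigr => l _ do rewrite triple.
  move=> <-.
  have e (a b : 'I_3) : \sum_l frob (row l (delta_mx a b)) (K l) = K a 0 b.
    rewrite (bigD1 a) //= frob_row (bigD1 b) //= !mxE !eqxx /= mul1r.
    rewrite big1 ?addr0 => [|l /negbTE lb]; last by rewrite !mxE eqxx lb mul0r.
    rewrite big1 ?addr0 // => l /negbTE la; rewrite frob_row big1 // => m _.
    by rewrite !mxE la mul0r.
  rewrite (eq_bigr (fun l => frob (row l (delta_mx i j)) (K l) + frob (row l (delta_mx j i)) (K l))).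
    by rewrite big_split /= !e.
  by move=> l _; rewrite -frobDl; congr frob; apply/rowP => m; rewrite !mxE.
have Kn i : frob (K i) n = 0 by exact: frob_crossr.
have JK i : row i J = cross n (K i).
  apply/rowP => j; have jn := Jn i; move: nn jn.
  rewrite !frob_row !sum3; have [k0 k1 k2] := crossE (row i J) n.
  have [c0 c1 c2] := crossE n (K i).
  rewrite -/(K i) in k0 k1 k2; set r := row i J in k0 k1 k2 *; move=> nn' jn'.
  move: j; apply: ord3; rewrite ?c0 ?c1 ?c2 ?k0 ?k1 ?k2.
  - transitivity (r 0 0 * (n 0 0 * n 0 0 + n 0 1 * n 0 1 + n 0 2 * n 0 2)
        - n 0 0 * (n 0 0 * r 0 0 + n 0 1 * r 0 1 + n 0 2 * r 0 2)).
      by rewrite nn' jn'; ring.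
    by ring.
  - transitivity (r 0 1 * (n 0 0 * n 0 0 + n 0 1 * n 0 1 + n 0 2 * n 0 2)
        - n 0 1 * (n 0 0 * r 0 0 + n 0 1 * r 0 1 + n 0 2 * r 0 2)).
      by rewrite nn' jn'; ring.
    by ring.
  - transitivity (r 0 2 * (n 0 0 * n 0 0 + n 0 1 * n 0 1 + n 0 2 * n 0 2)
        - n 0 2 * (n 0 0 * r 0 0 + n 0 1 * r 0 1 + n 0 2 * r 0 2)).
      by rewrite nn' jn'; ring.
    by ring.
have diag i : K i 0 i = 0 by have := skew i i; lra.
have Jentry i j : J i j = cross n (K i) 0 j by rewrite -JK mxE.
pose w : pt3 R := \row_j [:: K 1 0 2; - K 0 0 2; K 0 0 1]`_j.
have w0 : w = 0.
  have s01 := skew 0 1; have s02 := skew 0 2; have s12 := skew 1 2.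
  have d0 := diag 0; have d1 := diag 1; have d2 := diag 2.
  have n0 := Kn 0; have n1 := Kn 1; have n2 := Kn 2.
  move: trJ nn; rewrite /mxtrace sum3 !Jentry.
  have [a0 _ _] := crossE n (K 0); have [_ a1 _] := crossE n (K 1).
  have [_ _ a2] := crossE n (K 2); rewrite a0 a1 a2 frob_row sum3.
  move: n0 n1 n2; rewrite !frob_row !sum3.
  rewrite d0 d1 d2.
  have -> : K 1 0 0 = - K 0 0 1 by lra.
  have -> : K 2 0 0 = - K 0 0 2 by lra.
  have -> : K 2 0 1 = - K 1 0 2 by lra.
  rewrite /w; move: (K 0 0 1) (K 0 0 2) (K 1 0 2) (n 0 0) (n 0 1) (n 0 2) => a b c x y z.
  move=> h0 h1 h2 tr nn.
  have tr' : c * x - b * y + a * z = 0 by lra.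
  have ez : (a ^+ 2 + b ^+ 2 + c ^+ 2) = 0.
    transitivity ((a ^+ 2 + b ^+ 2 + c ^+ 2) * (x * x + y * y + z * z)).
      by rewrite nn mulr1.
    transitivity ((c * x - b * y + a * z) ^+ 2 + (a * y + b * z) ^+ 2
       + (- a * x + c * z) ^+ 2 + (b * x + c * y) ^+ 2); first by ring.
    have -> : a * y + b * z = 0 by lra.
    have -> : - a * x + c * z = 0 by lra.
    have -> : b * x + c * y = 0 by lra.
    by rewrite tr' !expr0n /= !addr0.
  have sa := sqr_ge0 a; have sb := sqr_ge0 b; have sc := sqr_ge0 c.
  have z2 t : t ^+ 2 = 0 :> R -> t = 0 by move/eqP; rewrite expf_eq0 => /eqP.
  have -> : a = 0 by apply: z2; lra.
  have -> : b = 0 by apply: z2; lra.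
  have -> : c = 0 by apply: z2; lra.
  by apply/rowP; apply: ord3; rewrite !mxE /= ?oppr0.
have k12 : K 1 0 2 = 0 by have := congr1 (fun v : pt3 R => v 0 0) w0; rewrite !mxE.
have k02 : K 0 0 2 = 0.
  by have := congr1 (fun v : pt3 R => v 0 1) w0; rewrite !mxE /= => /eqP; rewrite oppr_eq0 => /eqP.
have k01 : K 0 0 1 = 0 by have := congr1 (fun v : pt3 R => v 0 2) w0; rewrite !mxE.
have K0 i j : K i 0 j = 0.
  have s01 := skew 0 1; have s02 := skew 0 2; have s12 := skew 1 2.
  have d0 := diag 0; have d1 := diag 1; have d2 := diag 2.
  by move: i j; apply: ord3; apply: ord3; lra.
apply/matrixP => i j; rewrite Jentry [RHS]mxE.
have [h0 h1 h2] := crossE n (K i).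
by move: j; apply: ord3; rewrite ?h0 ?h1 ?h2 !K0; ring.
Qed.

End NormalJump.

(** * Face test functions *)

Section TestFunctions.
Context {R : realType} (Omega : set (pt3 R)) (M : mesh R).
Hypothesis hM : is_mesh Omega M.
Variable lam : cell M -> 'I_(nvert M) -> pt3 R -> R.
Hypothesis lamP : barycentric_family lam.
Variable nF : {set 'I_(nvert M)} -> pt3 R.
Hypothesis hnF : unit_normals nF.
Implicit Types (T : cell M) (F : {set 'I_(nvert M)}).

Lemma CR_zero : CR (fun (_ : cell M) (_ : pt3 R) => 0 : R).
Proof. by apply/(CRP hM lamP); split => // T; exact: affine_cst. Qed.

Lemma CR0_zero : CR0 (fun (_ : cell M) (_ : pt3 R) => 0 : R).
Proof.
apply/(CR0P hM lamP); split; first exact: CR_zero.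
by move=> F bF T FT; rewrite /face_mean big1 ?mul0r.
Qed.

Lemma face_basis_CR F c : F \in faces M ->
  CR (fun T y => face_basis lam F T y * c).
Proof.
move=> Ff.
have h : CR (face_basis lam F).
  apply/(CRP hM lamP); split; first by move=> T; exact: (face_basis_affine hM lamP).
  move=> F' /andP[F'f _] T1 T2 F1 F2.
  by rewrite !(face_basis_mean hM lamP).
have := CR_lin hM lamP c h CR_zero; congr CR; apply/funext => T; apply/funext => y.
by rewrite /= mulrC; exact: addr0.
Qed.

Lemma face_basis_CR0 F c : interior_face F ->
  CR0 (fun T y => face_basis lam F T y * c).
Proof.
move=> iF; have /andP[Ff _] := iF.
apply/(CR0P hM lamP); split; first exact: face_basis_CR.
move=> F' /andP[F'f bF'] T F'T.
have -> : face_mean F' (fun y => face_basis lam F T y * c) = face_mean F' (face_basis lam F T) * c.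
  by rewrite /face_mean -mulr_suml; ring.
rewrite (face_basis_mean hM lamP) // (_ : (F == F') = false) ?mul0r //.
by apply: contraNF bF' => /eqP <-.
Qed.

Definition vector_test F (k : 'I_3) : broken M 'rV[R]_3 :=
  fun T y => face_basis lam F T y *: delta_mx 0 k.

Definition matrix_test F (S : 'M[R]_3) : broken M 'M[R]_3 :=
  fun T y => face_basis lam F T y *: S.

Lemma vector_test_Vh F k : F \in faces M -> Vh (vector_test F k).
Proof.
move=> Ff; split => // i j.
have := face_basis_CR (delta_mx 0 k i j) Ff; congr CR.
by apply/funext => T; apply/funext => y; rewrite /vector_test [RHS]mxE.
Qed.

Lemma matrix_test_V0S F S : interior_face F -> S^T = S -> V0S (matrix_test F S).
Proof.
move=> iF ST; split => [i j|T y]; last by rewrite /symmetric_matrices /matrix_test /= linearZ /= ST.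
have := face_basis_CR0 (S i j) iF; congr CR0.
by apply/funext => T; apply/funext => y; rewrite /matrix_test mxE.
Qed.

(** Testing with a face basis function: any quantity f that is linear in its
    gradient, with kernel g, sees only the outward normals of the cells at F. *)
Lemma sum_cells_face F (f : cell M -> R) (g : cell M -> pt3 R -> R) :
  F \in faces M ->
  (forall T a v, g T (a *: v) = a * g T v) ->
  (forall T, f T = vol T * g T (slope (face_basis lam F T))) ->
  \sum_T f T = 3 * reference_volume * area F *
    \sum_(T : cell M | F \subset val T) g T (outward_normal nF T F).
Proof.
move=> Ff gl fE; rewrite mulr_sumr [RHS]big_mkcond; apply: eq_bigr => T _.
rewrite fE -gl; case: ifPn => FT; last first.
  by rewrite (face_basis_slope0 _ FT) scaler0 -(scale0r (0 : pt3 R)) gl mul0r.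
by rewrite (face_basis_slope hM lamP hnF Ff FT) gl.
Qed.

Lemma coupling_vector_test F k (p : broken M 'M[R]_3) : F \in faces M ->
  (forall T, \tr (p T 0) = 0) ->
  coupling 0 (vector_test F k) p = 3 * reference_volume * area F *
    \sum_(T : cell M | F \subset val T) frob (outward_normal nF T F) (row k (p T 0)).
Proof.
move=> Ff trp.
apply: (sum_cells_face (g := fun T v => frob v (row k (p T 0)))) => //.
  by move=> T a v; rewrite frobZl.
move=> T; congr (_ * _).
have -> : Curl ((0 : broken M 'M[R]_3) T) = 0.
  by apply/matrixP => i j; rewrite !mxE !subrr.
rewrite add0r frob_dev // frob_row /frob (bigD1 k) //= [X in _ + X]big1 ?addr0.
  apply: eq_bigr => j _; rewrite !mxE !eqxx /=; ring.
move=> i ik; rewrite big1 // => j _.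
by rewrite !mxE (negbTE ik) andbF !mulr0 subrr mul0r.
Qed.

Lemma crossZ a (u v : pt3 R) : cross (a *: u) v = a *: cross u v.
Proof. by apply/rowP => j; rewrite !mxE; ring. Qed.

Lemma coupling_matrix_test F S (p : broken M 'M[R]_3) : F \in faces M ->
  coupling (matrix_test F S) 0 p = 3 * reference_volume * area F *
    \sum_(T : cell M | F \subset val T)
      \sum_i frob (cross (outward_normal nF T F) (row i S)) (row i (p T 0)).
Proof.
move=> Ff.
apply: (sum_cells_face (g := fun T v => \sum_i frob (cross v (row i S)) (row i (p T 0)))) => //.
  by move=> T a v; rewrite mulr_sumr; apply: eq_bigr => i _; rewrite crossZ frobZl.
move=> T; congr (_ * _).
have -> : dev (Grad ((0 : broken M 'rV[R]_3) T)) = 0.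
  have -> : Grad ((0 : broken M 'rV[R]_3) T) = 0.
    by apply/matrixP => i j; rewrite !mxE subrr.
  by apply/matrixP => i j; rewrite !mxE mxtrace0 mul0r mul0rn subrr.
rewrite addr0 /frob; apply: eq_bigr => i _; rewrite [RHS]big_ord1.
apply: eq_bigr => j _; rewrite !mxE; ring.
Qed.

End TestFunctions.

(** * Uniqueness of the three components *)

Section Uniqueness.
Context {R : realType} (Omega : set (pt3 R)) (M : mesh R).
Hypothesis hM : is_mesh Omega M.
Variable lam : cell M -> 'I_(nvert M) -> pt3 R -> R.
Hypothesis lamP : barycentric_family lam.
Variable nF : {set 'I_(nvert M)} -> pt3 R.
Hypothesis hnF : unit_normals nF.
Implicit Types (T : cell M) (F : {set 'I_(nvert M)}).

Lemma V0S_affine (s : broken M 'M[R]_3) : V0S s -> affine_field s.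
Proof. by move=> [h _] T i j; have /(CR0P hM lamP)[/(CRP hM lamP)[+ _] _] := h i j. Qed.

Lemma Vh_affine (s : broken M 'rV[R]_3) : Vh s -> affine_field s.
Proof. by move=> [h _] T i j; have /(CRP hM lamP)[+ _] := h i j. Qed.

Lemma affine_slope0 (f : pt3 R -> R) : affine f -> slope f = 0 -> forall y, f y = f 0.
Proof. by move=> fa s0 y; rewrite fa s0 frob0l addr0. Qed.

Lemma sum_vol_eq0 (f : cell M -> R) : (forall T, 0 <= f T) ->
  \sum_T vol T * f T = 0 -> forall T, f T = 0.
Proof.
move=> f0 /eqP; rewrite psumr_eq0 => [/allP h T|T _]; last first.
  by have [_ _ v0] := interior_pts_measure hM lamP T; rewrite mulr_ge0 // ltW.
have [_ _ v0] := interior_pts_measure hM lamP T.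
by have := h T (mem_index_enum _); rewrite mulf_eq0 gt_eqF //= => /eqP.
Qed.

Lemma stiffness_ge0 (s : broken M 'M[R]_3) : 0 <= stiffness s s.
Proof.
apply: sumr_ge0 => i _; apply: sumr_ge0 => T _.
by have [_ _ v0] := interior_pts_measure hM lamP T; rewrite mulr_ge0 ?frob_ge0 // ltW.
Qed.

Lemma stiffness_eq0 (s : broken M 'M[R]_3) : stiffness s s = 0 ->
  forall T i j, slope (fun y => s T y i j) = 0.
Proof.
move=> /eqP; rewrite psumr_eq0 => [/allP h T i j|i _]; last first.
  apply: sumr_ge0 => T _.
  by have [_ _ v0] := interior_pts_measure hM lamP T; rewrite mulr_ge0 ?frob_ge0 // ltW.
have /eqP/sum_vol_eq0 e := h i (mem_index_enum _).
have /frob_eq0 G := e (fun T => frob_ge0 _) T.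
apply/rowP => k; have := congr1 (fun A : 'M[R]_3 => A j k) G.
by rewrite !mxE.
Qed.

Lemma jump_form_term_ge0 (r : broken M 'rV[R]_3) F : F \in faces M ->
  0 <= (face_diam F)^-1 * (area F * \sum_k
    face_form (fun m => jump nF r F (fnode (@node R M) F m) 0 k)
              (fun m => jump nF r F (fnode (@node R M) F m) 0 k)).
Proof.
move=> Ff; apply: mulr_ge0; first by rewrite invr_ge0 ltW // (face_diam_gt0 hM).
apply: mulr_ge0; first by rewrite ltW // (area_gt0 hM lamP).
by apply: sumr_ge0 => k _; exact: face_form_ge0.
Qed.

Lemma jump_form_ge0 (r : broken M 'rV[R]_3) : 0 <= jump_form nF r r.
Proof. by apply: sumr_ge0 => F Ff; exact: jump_form_term_ge0. Qed.

Lemma jump_form_eq0 (r : broken M 'rV[R]_3) : jump_form nF r r = 0 ->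
  forall F, F \in faces M -> forall m, jump nF r F (fnode (@node R M) F m) = 0.
Proof.
move=> /eqP; rewrite psumr_eq0 => [/allP h F Ff m|F Ff]; last exact: jump_form_term_ge0.
have := h F (mem_index_enum _); rewrite Ff /= mulf_eq0 invr_eq0.
rewrite gt_eqF ?(face_diam_gt0 hM) //= mulf_eq0 gt_eqF ?(area_gt0 hM lamP) //=.
rewrite psumr_eq0 => [/allP hk|k _]; last exact: face_form_ge0.
apply/rowP => k; rewrite [RHS]mxE.
have /eqP e := hk k (mem_index_enum _).
exact: (face_form_eq0 e m).
Qed.

(** Constants equal their face means, so v is single-valued across interior
    faces and zero at the boundary. *)
Lemma CR0_constant_zero (v : broken M R) : CR0 v -> (forall T, slope (v T) = 0) ->
  forall T y, v T y = 0.
Proof.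
move=> /(CR0P hM lamP)[/(CRP hM lamP)[va vm] vb] s0.
have c T y : v T y = v T 0 by exact: affine_slope0.
have mean F T : face_mean F (v T) = v T 0.
  by rewrite /face_mean sum3 !(c T (fnode _ _ _)); field.
move=> T y; rewrite c; move: T.
apply: (continuous_zero hM lamP hnF) => [F T T' Ff FT FT'|F T bF FT].
  have [iF|bF] := face_dichotomy Ff; first by rewrite -!(mean F); exact: vm.
  by rewrite -!(mean F) !vb.
by rewrite -(mean F); exact: vb.
Qed.

(** At an interior face the two outward normals are opposite, so the jump is
    the difference of the two traces up to sign. *)
Lemma jump_trace (r : broken M 'rV[R]_3) F : F \in faces M ->
  (forall m, jump nF r F (fnode (@node R M) F m) = 0) ->
  (forall T T' m, F \subset val T -> F \subset val T' ->
     r T (fnode (@node R M) F m) = r T' (fnode (@node R M) F m)) /\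
  (boundary_face F -> forall T m, F \subset val T -> r T (fnode (@node R M) F m) = 0).
Proof.
move=> Ff j0.
have [iF|bF] := face_dichotomy Ff.
  split; last by rewrite /boundary_face iF andbF.
  have [T1 [T2 [F1 F2 o12 two sum12]]] := interior_face_cells hM lamP hnF iF.
  have e12 m : r T1 (fnode (@node R M) F m) = r T2 (fnode (@node R M) F m).
    have := j0 m; rewrite /jump iF sum12 o12 frobNr scaleNr.
    have [e [ee _ ->]] := outward_sq hnF T2 Ff.
    rewrite addrC -scalerBr => /eqP; rewrite scaler_eq0 => /orP[/eqP e0|].
      by move: ee; rewrite e0 mul0r => /eqP; rewrite eq_sym oner_eq0.
    by rewrite subr_eq0 => /eqP.
  by move=> T T' m /two[]-> /two[]->.
have [T [FT nI one sumT]] := boundary_face_cell bF.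
split; first by move=> T1 T2 m /one-> /one->.
move=> _ T1 m /one->.
by have := j0 m; rewrite /jump (negbTE nI) sumT.
Qed.

Lemma face_nodes_distinct F : F \in faces M ->
  exists k, fnode (@node R M) F 1 0 k != fnode (@node R M) F 0 0 k.
Proof.
move=> Ff; have [k [kI _ _ kE _]] := face_enum (@node R M) (face_card Ff).
apply/existsP; rewrite -negb_forall; apply/negP => /forallP h.
have : fnode (@node R M) F 1 = fnode (@node R M) F 0.
  by apply/rowP => j; exact/eqP/h.
rewrite !kE; case: hM => nI _ _ _ /nI /kI //.
Qed.

(** If dev grad w = 0 then grad w is a multiple of the identity. *)
Lemma dev_Grad_zero (w : pt3 R -> 'rV[R]_3) : (forall k, affine (fun y => w y 0 k)) ->
  dev (Grad w) = 0 ->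
  exists c, forall y k, w y 0 k = c * y 0 k + w 0 0 k.
Proof.
move=> wa dG; exists (\tr (Grad w) / 3) => y k.
have G : Grad w = (\tr (Grad w) / 3)%:M by apply/eqP; rewrite -subr_eq0; apply/eqP.
rewrite (wa k y) addrC; congr (_ + _).
transitivity (\sum_j Grad w k j * y 0 j).
  by rewrite frob_row; apply: eq_bigr => j _; rewrite [Grad w k j]mxE.
rewrite {1}G (bigD1 k) //= mxE eqxx mulr1n big1 ?addr0 // => j /negbTE jk.
by rewrite mxE eq_sym jk mulr0n mul0r.
Qed.

(** On each cell r = c_T y + b_T.  Such a function is determined by its values
    at two points, so continuity at the vertices of the faces passes to c_T and
    b_T, which then vanish since they vanish at the boundary. *)
Lemma rigid_zero (r : broken M 'rV[R]_3) : affine_field r ->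
  (forall T, dev (Grad (r T)) = 0) ->
  (forall F, F \in faces M -> forall m, jump nF r F (fnode (@node R M) F m) = 0) ->
  forall T y, r T y = 0.
Proof.
move=> ra dG j0.
have ex T := dev_Grad_zero (ra T 0) (dG T).
pose c T := projT1 (cid (ex T)).
have cE T y k : r T y 0 k = c T * y 0 k + r T 0 0 k by exact: (projT2 (cid (ex T))).
(* two scaled translations agreeing at the vertices of a face coincide *)
have same F (a a' : R) (b b' : pt3 R) : F \in faces M ->
    (forall m k, a * fnode (@node R M) F m 0 k + b 0 k
               = a' * fnode (@node R M) F m 0 k + b' 0 k) ->
    a = a' /\ forall k, b 0 k = b' 0 k.
  move=> Ff e; have [k nk] := face_nodes_distinct Ff.
  have aa : a = a'.
    apply/eqP; rewrite -subr_eq0; apply/eqP; apply: (mulIf (x := fnode (@node R M) F 1 0 k - fnode (@node R M) F 0 0 k)).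
      by rewrite subr_eq0.
    by have := e 0 k; have := e 1 k; move=> e1 e2; rewrite mul0r; lra.
  split => // l; have := e 0 l; rewrite aa; exact: addrI.
have cont F T T' : F \in faces M -> F \subset val T -> F \subset val T' ->
    c T = c T' /\ forall k, r T 0 0 k = r T' 0 0 k.
  move=> Ff FT FT'; have [tr _] := jump_trace Ff (j0 F Ff).
  by apply: (same F) => // m k; rewrite -!cE (tr T T' m FT FT').
have bnd F T : boundary_face F -> F \subset val T -> c T = 0 /\ forall k, r T 0 0 k = 0.
  move=> bF FT; have /andP[Ff _] := bF; have [_ tr] := jump_trace Ff (j0 F Ff).
  have [|-> h] := same F (c T) 0 (r T 0) 0 Ff.
    by move=> m k; rewrite -cE (tr bF T m FT) !mxE mul0r addr0.
  by split => // k; rewrite h mxE.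
have c0 : forall T, c T = 0.
  apply: (continuous_zero hM lamP hnF) => [F T T' Ff FT FT'|F T bF FT].
    by have [] := cont F T T' Ff FT FT'.
  by have [] := bnd F T bF FT.
have b0 k : forall T, r T 0 0 k = 0.
  apply: (continuous_zero hM lamP hnF) => [F T T' Ff FT FT'|F T bF FT].
    by have [_ ->] := cont F T T' Ff FT FT'.
  by have [_ ->] := bnd F T bF FT.
by move=> T y; apply/rowP => k; rewrite cE c0 b0 mul0r addr0 mxE.
Qed.

(** The inf-sup condition.  The first family of tests makes P n continuous
    across interior faces and zero on boundary faces; together with the second
    family, jumps of P vanish altogether.  The rows of P are then single-valued
    with zero normal component at the boundary. *)
Lemma multiplier_zero (P : cell M -> 'M[R]_3) : (forall T, \tr (P T) = 0) ->
  (forall F k, F \in faces M ->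
     \sum_(T : cell M | F \subset val T) frob (outward_normal nF T F) (row k (P T)) = 0) ->
  (forall F S, interior_face F -> S^T = S ->
     \sum_(T : cell M | F \subset val T)
       \sum_i frob (cross (outward_normal nF T F) (row i S)) (row i (P T)) = 0) ->
  forall T, P T = 0.
Proof.
move=> trP nrm tan.
have cont F T T' : F \in faces M -> F \subset val T -> F \subset val T' -> P T = P T'.
  move=> Ff FT FT'; have [->//|TT'] := eqVneq T T'.
  have iF := shared_face_interior Ff FT FT' TT'.
  have [T1 [T2 [F1 F2 o12 two sum12]]] := interior_face_cells hM lamP hnF iF.
  have [n1 _] := hnF Ff.
  have oo : frob (outward_normal nF T1 F) (outward_normal nF T1 F) = 1.
    have [e [ee oe _]] := outward_sq hnF T1 Ff.
    by rewrite oe frobZl frobZr (frob_unit n1) mulr1.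
  have o21 : outward_normal nF T2 F = - outward_normal nF T1 F by rewrite o12 opprK.
  have P12 : P T1 = P T2.
    apply/eqP; rewrite -subr_eq0; apply/eqP.
    apply: (traceless_jump_zero oo).
    - by rewrite raddfB /= !trP subrr.
    - move=> i; have := nrm F i Ff; rewrite sum12 o21 frobNl => <-.
      by rewrite -frobNr -frobDr; congr frob; apply/rowP => j; rewrite !mxE.
    - move=> S ST; have e := tan F S iF ST; rewrite sum12 o21 -big_split /= in e.
      rewrite -[RHS]e; apply: eq_bigr => i _.
      have -> : cross (- outward_normal nF T1 F) (row i S)
          = - cross (outward_normal nF T1 F) (row i S).
        by rewrite -scaleN1r crossZ scaleN1r.
      rewrite frobNl -frobNr -frobDr; congr frob.
      by apply/rowP => j; rewrite !mxE.
  by have [->|->] := two T FT; have [->|->] := two T' FT'; rewrite ?P12.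
have rows k : forall T, row k (P T) = 0.
  apply: (flux_free_zero hM lamP hnF) => [F T T' Ff FT FT'|F T bF FT].
    by rewrite (cont F T T').
  have /andP[Ff _] := bF; have [T0 [FT0 _ _ sumT]] := boundary_face_cell bF.
  have := nrm F k Ff; rewrite sumT (cont F T0 T) //.
  have [e [ee -> _]] := outward_sq hnF T0 Ff.
  rewrite frobZl => /eqP; rewrite mulf_eq0 => /orP[/eqP e0|/eqP//].
  by move: ee; rewrite e0 mul0r => /eqP; rewrite eq_sym oner_eq0.
move=> T; apply/row_matrixP => k; by rewrite rows row0.
Qed.

End Uniqueness.

(** * Well-posedness *)

(** Stated for abstract modules, so that the operations on concrete triples of
    broken fields stay folded. *)
Lemma triple_lin (R : realType) (A B C : lmodType R) a (u v : A * B * C) :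
  a *: u + v = (a *: u.1.1 + v.1.1, a *: u.1.2 + v.1.2, a *: u.2 + v.2).
Proof. by []. Qed.

Section WellPosedness.
Context {R : realType} (Omega : set (pt3 R)) (M : mesh R).
Hypothesis hM : is_mesh Omega M.
Hypothesis hO : Omega = (closure Omega)°.
Variable lam : cell M -> 'I_(nvert M) -> pt3 R -> R.
Hypothesis lamP : barycentric_family lam.
Variable nF : {set 'I_(nvert M)} -> pt3 R.
Hypothesis hnF : unit_normals nF.
Variables (X : set 'M[R]_3) (g : pt3 R -> 'M[R]_3).
Hypothesis g2 : L2 Omega X g.
Implicit Types (T : cell M) (F : {set 'I_(nvert M)}).

Let V : lmodType R := (broken M 'M[R]_3 * broken M 'M[R]_3 * broken M 'rV[R]_3)%type.

Definition trial_space : set V := [set u : V | [/\ V0S u.1.1, P0T u.1.2 & Vh u.2]].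

(** The sum of both equations of the method, with the second one tested by the
    third component of v. *)
Definition saddle_form (u v : V) : R :=
  stiffness u.1.1 v.1.1 + jump_form nF u.2 v.2
  + coupling v.1.1 v.2 u.1.2 + coupling u.1.1 u.2 v.1.2.

Definition load (v : V) : R := l2dot Omega g (glued v.1.1).

Let W := trial_space.

Lemma P0T_constant (p : broken M 'M[R]_3) : P0T p -> forall T y, p T y = p T 0.
Proof.
move=> [h _] T y; apply/matrixP => i j.
exact: ((Pk0P (fun T x => p T x i j)).1 (h i j)).
Qed.

Lemma P0T_trace (p : broken M 'M[R]_3) : P0T p -> forall T y, \tr (p T y) = 0.
Proof. by move=> [_ h] T y; exact: h. Qed.

Lemma saddle_formE (u v : V) : W u -> W v ->
  a_h Omega nF u.1.1 u.2 v.1.1 v.2 + b_h Omega v.1.1 v.2 u.1.2 + b_h Omega u.1.1 u.2 v.1.2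
  = saddle_form u v.
Proof.
move=> [u1 u2 u3] [v1 v2 v3].
have := V0S_affine hM lamP u1; have := V0S_affine hM lamP v1 => va ua.
have := Vh_affine hM lamP u3; have := Vh_affine hM lamP v3 => vs us.
rewrite (a_hE hM hO lamP) // !(b_hE hM hO lamP) //; exact: P0T_constant.
Qed.

Lemma trial_space0 : W 0.
Proof.
split.
- split => [i j|T y]; last by rewrite /symmetric_matrices /= trmx0.
  have := CR0_zero hM lamP; congr CR0.
  by apply/funext => T; apply/funext => y; rewrite mxE.
- split => [i j|T y]; last by rewrite /traceless_matrices /= mxtrace0.
  by apply/Pk0P => T y; rewrite !mxE.
- split => [i j|]; last by move=> T y.
  have := CR_zero hM lamP; congr CR.
  by apply/funext => T; apply/funext => y; rewrite mxE.
Qed.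

Lemma broken_linE m n a (s t : broken M 'M[R]_(m, n)) T y :
  (a *: s + t) T y = a *: s T y + t T y.
Proof. by []. Qed.

Lemma V0S_lin a (s t : broken M 'M[R]_3) : V0S s -> V0S t -> V0S (a *: s + t).
Proof.
move=> [s1 s2] [t1 t2]; split => [i j|T y].
  rewrite (_ : (fun T x => (a *: s + t) T x i j) =
    a *: (fun T x => s T x i j : R) + (fun T x => t T x i j : R)).
    exact: (CR0_lin hM lamP a (s1 i j) (t1 i j)).
  by apply/funext => T; apply/funext => y; rewrite broken_linE 2!mxE.
have := s2 T y; have := t2 T y; rewrite /symmetric_matrices /= broken_linE => e1 e2.
by rewrite linearP /= e1 e2.
Qed.

Lemma P0T_lin a (s t : broken M 'M[R]_3) : P0T s -> P0T t -> P0T (a *: s + t).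
Proof.
move=> hs ht; split => [i j|T y].
  by apply/Pk0P => T y; rewrite !broken_linE (P0T_constant hs) (P0T_constant ht).
rewrite /traceless_matrices /= broken_linE linearP /=.
by rewrite (P0T_trace hs) (P0T_trace ht) mulr0 addr0.
Qed.

Lemma Vh_lin a (s t : broken M 'rV[R]_3) : Vh s -> Vh t -> Vh (a *: s + t).
Proof.
move=> [s1 _] [t1 _]; split => [i j|]; last by move=> T y.
rewrite (_ : (fun T x => (a *: s + t) T x i j) =
    a *: (fun T x => s T x i j : R) + (fun T x => t T x i j : R)).
  exact: (CR_lin hM lamP a (s1 i j) (t1 i j)).
by apply/funext => T; apply/funext => y; rewrite broken_linE 2!mxE.
Qed.

Lemma tripleE a (u v : V) :
  a *: u + v = (a *: u.1.1 + v.1.1, a *: u.1.2 + v.1.2, a *: u.2 + v.2).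
Proof. exact: triple_lin. Qed.

Lemma trial_space_lin a (u v : V) : W u -> W v -> W (a *: u + v).
Proof.
move=> [u1 u2 u3] [v1 v2 v3]; rewrite tripleE; split.
- exact: (V0S_lin a u1 v1).
- exact: (P0T_lin a u2 v2).
- exact: (Vh_lin a u3 v3).
Qed.

Lemma saddle_formC u v : saddle_form u v = saddle_form v u.
Proof. by rewrite /saddle_form stiffnessC jump_formC; ring. Qed.

Lemma saddle_form_linl a u v w :
  saddle_form (a *: u + v) w = a * saddle_form u w + saddle_form v w.
Proof.
rewrite /saddle_form tripleE /= stiffness_lin jump_form_lin coupling_linr coupling_linl.
ring.
Qed.

Lemma saddle_form_linr a u v w :
  saddle_form w (a *: u + v) = a * saddle_form w u + saddle_form w v.
Proof. by rewrite saddle_formC saddle_form_linl !(saddle_formC w). Qed.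

Lemma load_lin a u v : W u -> W v -> load (a *: u + v) = a * load u + load v.
Proof.
move=> [u1 _ _] [v1 _ _]; rewrite tripleE /load /=.
exact: (load_linear hM lamP a g2 (V0S_affine hM lamP u1) (V0S_affine hM lamP v1)).
Qed.

(* an affine function is determined by its values at 0 and the unit vectors *)
Let point (k : 'I_4) : pt3 R := oapp (delta_mx 0) 0 (unlift 0 k).
Let J : finType := (cell M * 'I_4 * ('I_3 * 'I_3 + 'I_3 * 'I_3 + 'I_3))%type.
Let dof_at (u : V) (j : J) : R :=
  match j.2 with
  | inl (inl ab) => u.1.1 j.1.1 (point j.1.2) ab.1 ab.2
  | inl (inr ab) => u.1.2 j.1.1 (point j.1.2) ab.1 ab.2
  | inr k => u.2 j.1.1 (point j.1.2) 0 k
  end.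
Let dof (u : V) : 'rV[R]_#|J| := \row_k dof_at u (enum_val k).

Let dof_lin a u v : dof (a *: u + v) = a *: dof u + dof v.
Proof.
apply/rowP => k; rewrite tripleE !mxE /dof_at /=; case: (enum_val k) => -[T m] [[ab|ab]|l] /=;
  by rewrite !mxE.
Qed.

Let affine_zero (f : pt3 R -> R) : affine f -> (forall k, f (point k) = 0) -> forall y, f y = 0.
Proof.
move=> fa f0 y.
have z : f 0 = 0 by have := f0 0; rewrite /point unlift_none.
have s : slope f = 0.
  apply/rowP => j; rewrite !mxE z subr0.
  by have := f0 (lift 0 j); rewrite /point liftK.
by rewrite fa z s frob0l addr0.
Qed.

Let dof_inj u : W u -> dof u = 0 -> u = 0.
Proof.
move=> [u1 u2 u3] d0.
have e (j : J) : dof_at u j = 0.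
  by have := congr1 (fun v : 'rV_#|J| => v 0 (enum_rank j)) d0; rewrite !mxE enum_rankK.
case: u => [[s p] r] /= in u1 u2 u3 e {d0} *.
have -> : s = 0.
  apply/funext => T; apply/funext => y; apply/matrixP => i j; rewrite [RHS]mxE.
  apply: (affine_zero (f := fun y => s T y i j)); first exact: (V0S_affine hM lamP u1).
  by move=> k; exact: (e (T, k, inl (inl (i, j)))).
have -> : p = 0.
  apply/funext => T; apply/funext => y; apply/matrixP => i j; rewrite [RHS]mxE.
  rewrite (P0T_constant u2); have := e (T, 0, inl (inr (i, j))).
  by rewrite /dof_at /= /point unlift_none.
have -> // : r = 0.
apply/funext => T; apply/funext => y; apply/rowP => j; rewrite [RHS]mxE.
apply: (affine_zero (f := fun y => r T y 0 j)); first exact: (Vh_affine hM lamP u3).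
by move=> k; exact: (e (T, k, inr j)).
Qed.

(** The left-hand side of the constraint, as a cellwise constant field.  It is
    itself an admissible test function in the second equation, being traceless
    because curl maps symmetric fields to traceless ones. *)
Definition constraint (u : V) : broken M 'M[R]_3 :=
  fun T _ => Curl (u.1.1 T) + dev (Grad (u.2 T)).

Lemma constraint_P0T u : W u -> P0T (constraint u).
Proof.
move=> [u1 _ _]; split => [i j|T y].
  by apply/Pk0P.
rewrite /traceless_matrices /= /constraint raddfD /= dev_traceless addr0.
by apply: Curl_traceless => z; exact: (u1.2 T z).
Qed.

Lemma coupling_constraint0 u : W u ->
  coupling u.1.1 u.2 (constraint u) = 0 -> forall T, Curl (u.1.1 T) + dev (Grad (u.2 T)) = 0.
Proof.
move=> Wu h T; apply: frob_eq0; move: T.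
exact: (sum_vol_eq0 hM lamP (fun T => frob_ge0 _) h).
Qed.

Lemma multiplier_test (q : broken M 'M[R]_3) : P0T q -> W (0, q, 0).
Proof. by have [h1 _ h3] := trial_space0; split. Qed.

Lemma stiffness0r s : stiffness s (0 : broken M 'M[R]_3) = 0.
Proof. by rewrite stiffnessC; have := stiffness_lin (0 : broken M 'M[R]_3) 0 s 1; rewrite scaler0 addr0; lra. Qed.

Lemma jump_form0r s : jump_form nF s (0 : broken M 'rV[R]_3) = 0.
Proof. by rewrite jump_formC; have := jump_form_lin nF (0 : broken M 'rV[R]_3) 0 s 1; rewrite scaler0 addr0; lra. Qed.

Lemma coupling0l p : coupling (0 : broken M 'M[R]_3) 0 p = 0.
Proof.
have := coupling_linl (0 : broken M 'M[R]_3) 0 (0 : broken M 'rV[R]_3) 0 p 1.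
rewrite !scaler0 !addr0; lra.
Qed.

Lemma coupling0r s r : coupling s r (0 : broken M 'M[R]_3) = 0.
Proof. by have := coupling_linr s r (0 : broken M 'M[R]_3) 0 1; rewrite scaler0 addr0; lra. Qed.

Lemma saddle_form_multiplier u q : saddle_form u (0, q, 0) = coupling u.1.1 u.2 q.
Proof. by rewrite /saddle_form /= stiffness0r jump_form0r coupling0l !add0r. Qed.

(** The multiplier test gives curl s + dev grad r = 0, then testing with
    (s, 0, r) leaves the two nonnegative parts of a_h, and finally p is
    annihilated by all face test functions. *)
Lemma saddle_form_nondegenerate u : W u -> (forall v, W v -> saddle_form u v = 0) -> u = 0.
Proof.
move=> Wu h.
have C0 : forall T, Curl (u.1.1 T) + dev (Grad (u.2 T)) = 0.
  apply: coupling_constraint0 => //.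
  by rewrite -saddle_form_multiplier; apply: h; apply: multiplier_test; exact: constraint_P0T.
have cpl q : coupling u.1.1 u.2 q = 0.
  by rewrite /coupling big1 // => T _; rewrite C0 frob0l mulr0.
case: u => [[s p] r] /= in Wu h C0 cpl *.
have [u1 u2 u3] := Wu; rewrite /= in u1 u2 u3.
have energy : stiffness s s + jump_form nF r r = 0.
  have Wsr : W (s, 0, r) by have [_ h2 _] := trial_space0; split.
  have := h _ Wsr; rewrite /saddle_form /= !cpl addr0; lra.
have s0 := stiffness_ge0 hM lamP s; have r0 := jump_form_ge0 hM lamP nF r.
have sz : s = 0.
  have ss : stiffness s s = 0 by lra.
  apply/funext => T; apply/funext => y; apply/matrixP => i j; rewrite [RHS]mxE.
  apply: (CR0_constant_zero hM lamP hnF (u1.1 i j)) => T'.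
  exact: (stiffness_eq0 hM lamP ss).
have rz : r = 0.
  have rr : jump_form nF r r = 0 by lra.
  apply/funext => T; apply/funext => y.
  apply: (rigid_zero hM lamP hnF (Vh_affine hM lamP u3)) => [T'|].
    have := C0 T'; rewrite sz (_ : Curl _ = 0) ?add0r //.
    by apply/matrixP => i j; rewrite !mxE subrr.
  exact: (jump_form_eq0 hM lamP rr).
rewrite {s}sz {r}rz in h Wu u1 u3 C0 cpl energy s0 r0 *.
have trp T : \tr (p T 0) = 0 by exact: (P0T_trace u2).
have test t w : V0S t -> Vh w -> coupling t w p = 0.
  move=> ht hw.
  have Wtw : W (t, 0, w) by have [_ h2 _] := trial_space0; split.
  have := h _ Wtw; rewrite /saddle_form /= coupling0l stiffnessC stiffness0r jump_formC jump_form0r.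
  by rewrite !add0r addr0.
have K0 F : F \in faces M -> 3 * reference_volume * area F != 0 :> R.
  move=> Ff; rewrite gt_eqF // mulr_gt0 ?(area_gt0 hM lamP) //.
  by rewrite mulr_gt0 // reference_volume_gt0.
suff pz : forall T, p T 0 = 0.
  congr (_, _, _); apply/funext => T; apply/funext => y.
  by rewrite (P0T_constant u2) pz.
have [h1 _ h3] := trial_space0.
apply: (multiplier_zero hM lamP hnF trp) => [F k Ff|F S iF ST].
  have := test 0 (vector_test lam F k) h1 (vector_test_Vh hM lamP k Ff).
  rewrite (coupling_vector_test hM lamP hnF) // => /eqP.
  by rewrite mulf_eq0 (negbTE (K0 _ Ff)) => /eqP.
have /andP[Ff _] := iF.
have := test (matrix_test lam F S) 0 (matrix_test_V0S hM lamP iF ST) h3.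
rewrite (coupling_matrix_test hM lamP hnF) // => /eqP.
by rewrite mulf_eq0 (negbTE (K0 _ Ff)) => /eqP.
Qed.

Lemma CR_methodP (u : V) :
  CR_method Omega nF g u <-> W u /\ forall v, W v -> saddle_form u v = load v.
Proof.
case: u => [[s p] r]; split.
  move=> [hs hp hr e1 e2].
  have Wu : W (s, p, r) by split.
  split => // -[[t q] w] Wv; have [ht hq hw] := Wv.
  by rewrite -saddle_formE //= e1 // e2 // addr0.
move=> [Wu h]; have [hs hp hr] := Wu; split => //.
- move=> t w ht hw.
  have Wv : W (t, 0, w) by have [_ h2 _] := trial_space0; split.
  have := h _ Wv; rewrite -saddle_formE // /load /= => <-.
  rewrite [X in _ = _ + X](b_hE hM hO lamP) ?coupling0r ?addr0 //.
    exact: (V0S_affine hM lamP hs).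
  exact: (Vh_affine hM lamP hr).
- move=> q hq.
  have Wv := multiplier_test hq.
  have := h _ Wv; rewrite saddle_form_multiplier /load /= => e.
  rewrite (b_hE hM hO lamP); first rewrite e.
  + have := load_lin 1 trial_space0 trial_space0; rewrite scaler0 addr0 /load /=; lra.
  + exact: (V0S_affine hM lamP hs).
  + exact: (Vh_affine hM lamP hr).
  + exact: P0T_constant.
Qed.

Lemma CR_method_well_posed : exists! u, CR_method Omega nF g u.
Proof.
have [u Wu hu] := galerkin trial_space0 trial_space_lin dof_lin dof_inj
  (fun a u v w _ _ _ => saddle_form_linl a u v w)
  (fun a u v w _ _ _ => saddle_form_linr a u v w)
  load_lin saddle_form_nondegenerate.
exists u; split; first exact/CR_methodP.
move=> u' /CR_methodP[Wu' hu'].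
suff : (-1) *: u + u' = 0 by rewrite scaleN1r addrC => /eqP; rewrite subr_eq0 => /eqP.
apply: saddle_form_nondegenerate; first exact: trial_space_lin.
by move=> v Wv; rewrite saddle_form_linl hu // hu' // mulN1r addNr.
Qed.

Lemma CR_method_constraint (s p : broken M 'M[R]_3) (r : broken M 'rV[R]_3) :
  CR_method Omega nF g (s, p, r) -> forall T x, curl_h s T x + dev (grad_h r T x) = 0.
Proof.
move=> /(CR_methodP (s, p, r)) [Wu h] T x.
have [hs hp hr] := Wu.
rewrite /curl_h /grad_h curl_Curl; last exact: (V0S_affine hM lamP hs).
rewrite grad_Grad; last exact: (Vh_affine hM lamP hr).
apply: (coupling_constraint0 Wu).
have hq := constraint_P0T Wu.
have := h _ (multiplier_test hq); rewrite saddle_form_multiplier => ->.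
by have := load_lin 1 trial_space0 trial_space0; rewrite scaler0 addr0 /load /=; lra.
Qed.

End WellPosedness.

Unset Implicit Arguments.

Theorem theorem3p5 (R : realType) (Omega : set 'rV[R]_3)
  (I : set R) (Th : R -> mesh R)
  (nF : forall h, {set 'I_(nvert (Th h))} -> 'rV[R]_3)
  (g : R -> 'rV[R]_3 -> 'M[R]_3) :
  bounded_polyhedral_domain Omega -> contractible Omega ->
  (forall h, I h -> 0 < h) ->
  (forall h, I h -> is_mesh Omega (Th h)) ->
  shape_regular I Th ->
  (forall h, I h -> unit_normals (nF h)) ->
  (forall h, I h -> L2 Omega symmetric_matrices (g h)) ->
  forall h, I h ->
    (exists! u, CR_method Omega (nF h) (g h) u) /\
    (forall sigma p r, CR_method Omega (nF h) (g h) (sigma, p, r) ->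
       forall (T : cell (Th h)) x, elem T x ->
         curl_h sigma T x + dev (grad_h r T x) = 0).
Proof.
move=> [_ _ _ _ [_ hO]] _ _ hM _ hnF hg h Ih.
have [lam lamP] := barycentric_family_exists (hM h Ih).
split; first exact: (CR_method_well_posed (hM h Ih) hO lamP (hnF h Ih) (hg h Ih)).
move=> sigma p r sol T x _.
exact: (CR_method_constraint (hM h Ih) hO lamP (hg h Ih) sol).
Qed.
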